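(* Let $f\in\mathrm{BL}([0,1])$ and let $v:\mathcal{M}([0,1])\times[0,1]\to\mathbb{R}$ satisfy the Velocity Assumption (see context). For all $T>0$ and $\tilde R>0$ there is a constant $C_{\tilde R,T}$ such that for all $\mu_0,\nu_0\in\mathcal{M}^+([0,1])$ satisfying $\|\mu_0\|_{\mathrm{TV}}\le\tilde R$ and $\|\nu_0\|_{\mathrm{TV}}\le\tilde R$, the corresponding mild solutions $\mu,\nu\in C([0,T];\mathcal{M}^+([0,1]))$ on $[0,T]$ of $$\frac{\partial}{\partial t}\mu_t+\frac{\partial}{\partial x}\bigl(v[\mu_t]\,\mu_t\bigr)=f\cdot\mu_t$$ with initial values $\mu_0$ and $\nu_0$, respectively, satisfy $$\sup_{\tau\in[0,T]}\|\mu_\tau-\nu_\tau\|_{\mathrm{BL}}^*\le C_{\tilde R,T}\,\|\mu_0-\nu_0\|_{\mathrm{BL}}^*.$$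
   Context: **Norms.** $\mathcal{M}([0,1])$ is the space of finite (signed) Borel measures on $[0,1]$, $\mathcal{M}^+([0,1])$ the cone of positive ones, $\|\cdot\|_{\mathrm{TV}}$ the total variation norm. $\mathrm{BL}([0,1])$ is the space of real-valued bounded Lipschitz functions on $[0,1]$ with norm $\|\phi\|_{\mathrm{BL}}=\|\phi\|_\infty+|\phi|_{\mathrm{L}}$, where $|\phi|_{\mathrm{L}}$ is the (smallest) Lipschitz constant. $\|\mu\|_{\mathrm{BL}}^*:=\sup\{|\int\phi\,d\mu| : \phi\in\mathrm{BL}([0,1]),\ \|\phi\|_{\mathrm{BL}}\le 1\}$. $C([0,T];\mathcal{M}([0,1]))$ (resp. $C([0,T];\mathcal{M}^+([0,1]))$) denotes maps $t\mapsto\mu_t$ into $\mathcal{M}([0,1])$ (resp. $\mathcal{M}^+([0,1])$) that are continuous for $\|\cdot\|_{\mathrm{BL}}^*$. **Stopped flow.** For $w\in\mathrm{BL}([0,1])$ and $x_0\in[0,1]$, let $x(\cdot;x_0)$ be the unique maximal solution, for $t\ge 0$ and with values in $[0,1]$, of $\dot x=w(x)$, $x(0)=x_0$, with maximal interval of existence $I_{x_0}\subset[0,\infty)$, and let $\tau_\partial(x_0)=\sup I_{x_0}\in[0,\infty]$ (so $\tau_\partial(x_0)=0$ if $x_0$ is a boundary point where $w$ points outwards). Define $\Phi^w_t(x_0)=x(t;x_0)$ if $t\in I_{x_0}$ and $\Phi^w_t(x_0)=x(\tau_\partial(x_0);x_0)$ otherwise, and $P^w_t\mu:=\Phi^w_t\#\mu=\mu\circ(\Phi^w_t)^{-1}$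 for $\mu\in\mathcal{M}([0,1])$. **Solution operator for fixed velocity.** For $w,f\in\mathrm{BL}([0,1])$ and each $\nu\in\mathcal{M}([0,1])$ it is known that on every interval $[0,T]$ there is a unique map $t\mapsto\mu_t\in\mathcal{M}([0,1])$ that is $\|\cdot\|_{\mathrm{BL}}^*$-continuous, $\|\cdot\|_{\mathrm{TV}}$-bounded and satisfies $\mu_t=P^w_t\nu+\int_0^tP^w_{t-s}(f\cdot\mu_s)\,ds$ for all $t\in[0,T]$ (Bochner integral in the completion of $\mathcal{M}([0,1])$ for $\|\cdot\|_{\mathrm{BL}}^*$); here $f\cdot\mu$ is the measure with density $f$ with respect to $\mu$. Put $Q^w_t\nu:=\mu_t$. (The function $f$ is fixed and suppressed in the notation.) **Velocity Assumption.** Write $v[\mu]:=v(\mu,\cdot)$. (i) $v[\mu]\in\mathrm{BL}([0,1])$ for each $\mu\in\mathcal{M}([0,1])$; and for any $R>0$ there are constants $K_R,L_R,M_R$ such that for all $\mu,\nu\in\mathcal{M}([0,1])$ with $\|\mu\|_{\mathrm{TV}}\le R$, $\|\nu\|_{\mathrm{TV}}\le R$: (ii) $\|v[\mu]\|_\infty\le K_R$; (iii) $|v[\mu]|_{\mathrm{L}}\le L_R$; (iv) $\|v[\mu]-v[\nu]\|_\infty\le M_R\|\mu-\nu\|_{\mathrm{BL}}^*$. **Euler approximation.** A partition of $[0,T]$ is a finite set $\alpha=\{t_0,\dots,t_N\}$, $N\ge1$, with $0=t_0<t_1<\dots<t_N=T$. The Euler approximation with partition $\alpha$ and initial value $\mu_0$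 is the trajectory $\mu\in C([0,T];\mathcal{M}([0,1]))$ that equals $\mu_0$ at $t=0$ and is given by $\mu_t:=Q^{v_j}_{t-t_j}\mu_{t_j}$ for $t\in(t_j,t_{j+1}]$, where $v_j:=v[\mu_{t_j}]$, $j=0,\dots,N-1$. **Admissible sequence of partitions.** A sequence $(\alpha_k)_{k\in\mathbb{N}}$ of partitions $\alpha_k=\{t^k_0<\dots<t^k_{N_k}\}$ of $[0,T]$ is admissible if $M^{(k)}:=\max_{0\le j\le N_k-1}(t^k_{j+1}-t^k_j)$ is nonincreasing in $k$ and $M^{(k)}\to0$ as $k\to\infty$. **Mild solution (nonlinear equation).** For any admissible sequence $(\alpha_k)_{k\in\mathbb{N}}$ of partitions of $[0,T]$, let $\mu^k$ be the Euler approximation with partition $\alpha_k$ and initial value $\mu_0$. Any limit, in the metric $\sup_{t\in[0,T]}\|\mu_t-\nu_t\|_{\mathrm{BL}}^*$, of a subsequence of $(\mu^k)_{k\in\mathbb{N}}$, for any such $(\alpha_k)$, is called a mild solution on $[0,T]$ with initial value $\mu_0$. For $\mu_0\in\mathcal{M}^+([0,1])$, under the Velocity Assumption, the mild solution on $[0,T]$ exists, is unique, takes values in $\mathcal{M}^+([0,1])$, and is the limit of the full sequence $(\mu^k)$ for every admissible $(\alpha_k)$. *)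

(* Defs.v *)
From HB Require Import structures.
From mathcomp Require Import all_boot all_order all_algebra.
From mathcomp Require Import all_classical all_reals all_analysis.

Set Implicit Arguments.
Unset Strict Implicit.
Unset Printing Implicit Defensive.

Import Order.TTheory GRing.Theory Num.Theory.
Import numFieldNormedType.Exports.

Local Open Scope classical_set_scope.
Local Open Scope ring_scope.

Definition choose_or {T : Type} (x0 : T) (P : T -> Prop) : T :=
  if pselect (exists x, P x) is left e then sval (cid e) else x0.

Definition itv01 (R : realType) := {x : R | 0 <= x <= 1}.

Lemma itv01_zero_subproof (R : realType) : 0 <= (0 : R) <= 1.
Proof. by rewrite lexx ler01. Qed.

Definition itv01_zero (R : realType) : itv01 R :=
  exist _ 0 (itv01_zero_subproof R).

HB.instance Definition _ (R : realType) := Choice.on (itv01 R).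
HB.instance Definition _ (R : realType) :=
  isPointed.Build (itv01 R) (itv01_zero R).

Definition itv01_val (R : realType) (x : itv01 R) : measurableTypeR R := sval x.

(* The measurable space [0, 1]: its measurable sets are the preimages under the
   inclusion of the Borel sets of the line, i.e. the Borel sets of [0, 1]. *)
Definition I01 (R : realType) := g_sigma_algebra_preimageType (@itv01_val R).

Definition rval (R : realType) (x : I01 R) : R := sval x.

(* Charges are functions on all subsets but are only constrained on measurable
   ones, so that Leibniz equality of charges is finer than equality of
   measures. Everything below (norms, integrals, convergence) depends only on
   the values on measurable sets. *)
Definition M (R : realType) := {charge set (I01 R) -> \bar R}.

Definition M0 {R : realType} : M R := @czero _ (I01 R) R.
Definition Madd {R : realType} (mu nu : M R) : M R := cadd mu nu.
Definition Mscale {R : realType} (c : R) (mu : M R) : M R := cscale c mu.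
Definition Msub {R : realType} (mu nu : M R) : M R := Madd mu (copp nu).

Definition Mpos {R : realType} (mu : M R) : Prop :=
  forall A, measurable A -> (0 <= mu A)%E.

(* the element of M whose values on measurable sets are given by m *)
Definition Mof {R : realType} (m : set (I01 R) -> \bar R) : M R :=
  choose_or M0 (fun rho : M R => forall A, measurable A -> rho A = m A).

Definition hahn_P {R : realType} (mu : M R) : set (I01 R) :=
  sval (cid (Hahn_decomposition mu)).

Definition hahn_N {R : realType} (mu : M R) : set (I01 R) :=
  sval (cid (svalP (cid (Hahn_decomposition mu)))).

Definition hahnPN {R : realType} (mu : M R) :
    hahn_decomposition mu (hahn_P mu) (hahn_N mu) :=
  svalP (cid (svalP (cid (Hahn_decomposition mu)))).

Definition Mplus {R : realType} (mu : M R) :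
  {measure set (I01 R) -> \bar R} := jordan_pos (hahnPN mu).

Definition Mminus {R : realType} (mu : M R) :
  {measure set (I01 R) -> \bar R} := jordan_neg (hahnPN mu).

Definition cint_on {R : realType} (mu : M R) (A : set (I01 R))
    (phi : I01 R -> R) : R :=
  \int[Mplus mu]_(x in A) phi x - \int[Mminus mu]_(x in A) phi x.

Definition cint {R : realType} (mu : M R) (phi : I01 R -> R) : R :=
  cint_on mu setT phi.

Definition normTV {R : realType} (mu : M R) : R :=
  fine (charge_variation (hahnPN mu) setT).

Definition lip_bound {R : realType} (phi : I01 R -> R) : set R :=
  [set L | 0 <= L /\
    forall x y, `|phi x - phi y| <= L * `|rval x - rval y|].

Definition BL {R : realType} (phi : I01 R -> R) : Prop :=
  (exists B, forall x, `|phi x| <= B) /\ lip_bound phi !=set0.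

Definition norm_sup {R : realType} (phi : I01 R -> R) : R :=
  sup [set `|phi x| | x in setT].

Definition lip_const {R : realType} (phi : I01 R -> R) : R :=
  inf (lip_bound phi).

Definition normBL {R : realType} (phi : I01 R -> R) : R :=
  norm_sup phi + lip_const phi.

Definition normBLdual {R : realType} (mu : M R) : R :=
  sup [set `|cint mu phi| | phi in [set phi | BL phi /\ normBL phi <= 1]].

Definition distBL {R : realType} (mu nu : M R) : R := normBLdual (Msub mu nu).

Definition path_continuous {R : realType} (T : R) (mu : R -> M R) : Prop :=
  forall t : R, t \in `[0, T] ->
    distBL (mu s) (mu t) @[s --> within `[0, T] (nbhs t)] --> 0.

(* in \bar R, since the paths are not known a priori to be bounded *)
Definition path_dist {R : realType} (T : R) (mu nu : R -> M R) : \bar R :=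
  ereal_sup [set (distBL (mu t) (nu t))%:E | t in `[0, T]].

(* Difference quotients are restricted to I, so derivatives at endpoints of I
   are one-sided, and the equation is void when I = [set 0]. *)
Definition ode_solution {R : realType} (w : I01 R -> R) (x0 : I01 R)
    (I : set R) (x : R -> I01 R) : Prop :=
  [/\ is_interval I, I `<=` [set t | 0 <= t], I 0, x 0 = x0 &
    forall t, I t ->
      (rval (x s) - rval (x t)) / (s - t) @[s --> within I t^'] --> w (x t)].

Definition maximal_solution {R : realType} (w : I01 R -> R) (x0 : I01 R)
    (I : set R) (x : R -> I01 R) : Prop :=
  ode_solution w x0 I x /\
  forall J y, ode_solution w x0 J y -> I `<=` J ->
    (forall t, I t -> y t = x t) -> J `<=` I.

Definition max_sol {R : realType} (w : I01 R -> R) (x0 : I01 R) :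
    set R * (R -> I01 R) :=
  choose_or ([set 0], fun=> x0) (fun p => maximal_solution w x0 p.1 p.2).

(* A time t >= 0 outside the maximal interval J exists only when J is bounded,
   and then the exit time is the real number sup J, which belongs to J. *)
Definition flow {R : realType} (w : I01 R -> R) (t : R) (x0 : I01 R) : I01 R :=
  let: (J, x) := max_sol w x0 in
  if `[< J t >] then x t else x (sup J).

Definition Pw {R : realType} (w : I01 R -> R) (t : R) (mu : M R) : M R :=
  Mof (pushforward mu (flow w t)).

Definition density {R : realType} (f : I01 R -> R) (mu : M R) : M R :=
  Mof (fun A => (cint_on mu A f)%:E).

(* Simple functions on the line with values in M: the list of pairs (A, rho)
   stands for the sum of the functions s |-> \1_A s *: rho. *)
Definition simple_path (R : realType) := seq (set (measurableTypeR R) * M R).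

Definition simple_wf {R : realType} (t : R) (g : simple_path R) : Prop :=
  forall i, (i < size g)%N ->
    let A := (nth (set0, M0) g i).1 in measurable A /\ A `<=` `[0, t].

Definition simple_eval {R : realType} (g : simple_path R) (s : R) : M R :=
  \big[Madd/M0]_(p <- g) Mscale (\1_(p.1) s) p.2.

Definition simple_int {R : realType} (g : simple_path R) : M R :=
  \big[Madd/M0]_(p <- g) Mscale (fine (lebesgue_measure p.1)) p.2.

(* The element I of M is the Bochner integral of h over [0, t], with respect to
   the dual bounded Lipschitz norm. The integral is the one in the completion
   of M: as M is dense there, simple functions with values in M suffice. *)
Definition bochner_integral {R : realType} (t : R) (h : R -> M R) (I : M R) :
    Prop :=
  exists g : nat -> simple_path R,
    [/\ forall n, simple_wf t (g n),
        {ae lebesgue_measure, forall s, s \in `[0, t] ->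
          distBL (simple_eval (g n) s) (h s) @[n --> \oo] --> (0 : R)},
        (\int[lebesgue_measure]_(s in `[0%R, t])
          (distBL (simple_eval (g n) s) (h s))%:E)%E @[n --> \oo] --> 0%E &
        distBL (simple_int (g n)) I @[n --> \oo] --> (0 : R)].

(* rho is the path t |-> Q^w_t nu on [0, T]. The variation of constants formula
   is stated with the integral term isolated, as this term lies in M. *)
Definition linear_solution {R : realType} (f w : I01 R -> R) (T : R) (nu : M R)
    (rho : R -> M R) : Prop :=
  [/\ path_continuous T rho,
      exists B : R, forall t : R, t \in `[0, T] -> normTV (rho t) <= B &
      forall t : R, t \in `[0, T] ->
        bochner_integral t (fun s => Pw w (t - s) (density f (rho s)))
          (Msub (rho t) (Pw w t nu))].

Definition velocity_assumption {R : realType} (v : M R -> I01 R -> R) : Prop :=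
  (forall mu, BL (v mu)) /\
  forall r : R, 0 < r -> exists KLM : R * R * R,
    let: (K, L, C) := KLM in
    forall mu nu, normTV mu <= r -> normTV nu <= r ->
      [/\ norm_sup (v mu) <= K,
          lip_const (v mu) <= L &
          norm_sup (fun x => v mu x - v nu x) <= C * distBL mu nu].

(* A partition t_0 < ... < t_N of [0, T] is given by a : seq R with
   itv_partition 0 T a, listing t_1, ..., t_N (so N = size a). *)
Definition node {R : realType} (a : seq R) (j : nat) : R := nth 0 (0 :: a) j.

Definition mesh {R : realType} (a : seq R) : R :=
  \big[Num.max/0]_(j < size a) (node a j.+1 - node a j).

Definition admissible {R : realType} (T : R) (alpha : nat -> seq R) : Prop :=
  [/\ forall k, itv_partition 0 T (alpha k),
      forall k l, (k <= l)%N -> mesh (alpha l) <= mesh (alpha k) &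
      mesh (alpha k) @[k --> \oo] --> 0].

Definition euler_approx {R : realType} (f : I01 R -> R) (v : M R -> I01 R -> R)
    (T : R) (a : seq R) (mu0 : M R) (mu : R -> M R) : Prop :=
  [/\ path_continuous T mu, mu 0 = mu0 &
      forall j, (j < size a)%N ->
        let tj := node a j in let tj1 := node a j.+1 in
        exists2 rho,
          linear_solution f (v (mu tj)) (tj1 - tj) (mu tj) rho &
          forall t : R, t \in `]tj, tj1] -> mu t = rho (t - tj)].

Definition mild_solution {R : realType} (f : I01 R -> R)
    (v : M R -> I01 R -> R) (T : R) (mu0 : M R) (mu : R -> M R) : Prop :=
  path_continuous T mu /\
  exists (alpha : nat -> seq R) (muk : nat -> R -> M R) (sub : nat -> nat),
    [/\ admissible T alpha,
        forall k, euler_approx f v T (alpha k) mu0 (muk k),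
        {homo sub : m n / (m < n)%N} &
        path_dist T (muk (sub n)) mu @[n --> \oo] --> 0%E].

(* Main.v *)
Require Import Defs.
(* Two Euler approximations mu and nu, for possibly different partitions, are
   compared through D(t) = distBL (mu t) (nu t). The stopped flow inherits the
   one-sided Lipschitz bound of the velocity, since stopping at the boundary can
   only decrease (x - y) * (x' - y'); hence it is Lipschitz in the initial point,
   in time and in the velocity. Testing the variation of constants formula
   against bounded Lipschitz functions gives, for small d,
     D(t + d) <= D(t) + d * (k * D(t) + A * (mesh a + mesh b) + O(d)),
   so D(t) <= (D(0) + A * (mesh a + mesh b)) * e^(k t), where k and A depend only
   on f, v, T and a bound on the total variations. That bound is itself obtained
   by a growth estimate, because the total variation is the supremum of the
   integrals of the Lipschitz functions with values in [-1, 1]. The mesh terms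
   vanish for mild solutions. *)
From HB Require Import structures.
From mathcomp Require Import all_boot all_order all_algebra.
From mathcomp Require Import all_classical all_reals all_analysis.
From mathcomp Require Import measurable_realfun ring lra.

Import Order.TTheory GRing.Theory Num.Theory.
Import numFieldNormedType.Exports.

Local Open Scope classical_set_scope.
Local Open Scope ring_scope.

(** * Integration against charges *)

Section finite_measures.
Context {d} {T : measurableType d} {R : realType}.
Implicit Types (m : {measure set T -> \bar R}) (g phi : T -> R).

(** A mild solution is given only as a limit, so every estimate is made on Euler approximations,
    with constants that do not see the partition. Pairing with a bounded Lipschitz function turns
    the Bochner integral into a scalar one. The Gronwall argument closes because a test function
    with bounds [B + Lp <= 1], carried along the flow for a time d, has bounds with sum at most
    $1+O(d)$: in one step the coefficient of $D(t)$ is 1 to leading order. Two obstacles shape the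
    argument. The speed of the stopped flow may jump when the boundary is reached, so that only
    right derivatives are available; and the nodes of two partitions interlace. Real induction meets
    both: a property has to survive on some interval to the right of each time, of uncontrolled
    length, and to pass to limits from the left. In the growth estimates the barrier is an
    exponential whose rate exceeds the true one by a fixed amount. Terms of second order in d are
    then absorbed by shortening the step, and the bound does not depend on how short the step is. *)

Definition bounded_by (B : R) phi := forall x, `|phi x| <= B.

Lemma bounded_integrable m B phi : (m setT < +oo)%E ->
  measurable_fun setT phi -> bounded_by B phi ->
  m.-integrable setT (EFin \o phi).
Proof.
move=> mfin mphi hB; apply: measurable_bounded_integrable => //.
exists B; split=> [|y /ltW hy x _ /=]; [exact: num_real|exact: le_trans (hB x) hy].
Qed.

Lemma le_Rintegral_bounded m B phi : (m setT < +oo)%E ->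
  measurable_fun setT phi -> bounded_by B phi ->
  `|\int[m]_x phi x| <= B * fine (m setT).
Proof.
move=> mfin mphi hB.
have intphi := bounded_integrable m B phi mfin mphi hB.
apply: (le_trans (le_normr_Rintegral _ intphi)) => //.
rewrite -Rintegral_cst//; apply: le_Rintegral => //.
- by have := integrable_norm intphi.
- by apply: (bounded_integrable m `|B|) => // x /=.
Qed.

Lemma sum_measureE m1 m2 A :
  (measure_add m1 m2 : {measure set T -> \bar R}) A = (m1 A + m2 A)%E.
Proof. exact: measure_addE. Qed.

Lemma Rintegral_measure_addE m1 m2 B phi :
  (m1 setT < +oo)%E -> (m2 setT < +oo)%E ->
  measurable_fun setT phi -> bounded_by B phi ->
  \int[measure_add m1 m2]_x phi x = \int[m1]_x phi x + \int[m2]_x phi x.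
Proof.
move=> f1 f2 mphi hB.
have i1 := bounded_integrable m1 B phi f1 mphi hB.
have i2 := bounded_integrable m2 B phi f2 mphi hB.
rewrite /Rintegral integral_measure_add// fineD//;
  exact: integrable_fin_num.
Qed.

Lemma eq_measure_Rintegral m1 m2 phi :
  (forall A, measurable A -> m1 A = m2 A) ->
  \int[m1]_x phi x = \int[m2]_x phi x.
Proof.
move=> h; rewrite /Rintegral; congr fine.
by apply: eq_measure_integral => A mA _; exact: h.
Qed.

End finite_measures.

(** [g] coincides [m]-almost everywhere with the Radon-Nikodym derivative of [n], since both have
    the same integral over every measurable set; the change of variables for that derivative then
    applies. *)
Lemma integral_of_density {d} {T : measurableType d} {R : realType}
    (m n : {finite_measure set T -> \bar R}) (g phi : T -> R) (B C : R) :
  measurable_fun setT g -> bounded_by B g -> (forall x, 0 <= g x) ->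
  measurable_fun setT phi -> bounded_by C phi ->
  (forall A, measurable A -> n A = \int[m]_(x in A) (g x)%:E)%E ->
  \int[n]_x phi x = \int[m]_x (g x * phi x).
Proof.
move=> mg hB g0 mphi hC nE.
have mfin : (m setT < +oo)%E by rewrite ltey_eq fin_num_measure.
have nfin : (n setT < +oo)%E by rewrite ltey_eq fin_num_measure.
have ig := bounded_integrable m B g mfin mg hB.
have dom : n `<< m.
  apply/null_content_dominatesP => A mA mA0.
  by rewrite nE// null_set_integral//; exact/measurable_EFinP/measurable_funTS.
rewrite /Rintegral; congr fine.
rewrite -(Radon_Nikodym_change_of_variables dom)//; last first.
  exact: bounded_integrable nfin mphi hC.
apply: ae_eq_integral => //.
- apply: emeasurable_funM; first exact/measurable_EFinP.
  by [].
- by apply/measurable_EFinP; exact: measurable_funM.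
under [X in ae_eq _ _ _ X]eq_fun do rewrite mulrC EFinM.
apply: ae_eqe_mul2l.
apply: integral_ae_eq => //.
- exact: Radon_Nikodym_integrable.
- exact/measurable_EFinP.
- by move=> E _ mE; rewrite -Radon_Nikodym_integral//= -nE.
Qed.

Section pairing.
Context {R : realType}.
Implicit Types (mu nu rho : M R) (phi psi : I01 R -> R).

Lemma Mplus_lty mu : (Mplus mu setT < +oo)%E.
Proof. by rewrite ltey_eq fin_num_measure. Qed.

Lemma Mminus_lty mu : (Mminus mu setT < +oo)%E.
Proof. by rewrite ltey_eq fin_num_measure. Qed.

Lemma MplusB mu A : measurable A -> mu A = (Mplus mu A - Mminus mu A)%E.
Proof.
by move=> mA; rewrite (jordan_decomp (hahnPN mu) mA) /cadd/= cscaleN1.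
Qed.

(** [cint] is built on the Jordan decomposition, but any decomposition into finite measures serves:
    crossing the negative parts over turns an equality of differences into an equality of two sums
    of measures. Pairings with sums, multiples, push-forwards and densities are computed this
    way. *)
Lemma cintE rho (m1 m2 : {measure set (I01 R) -> \bar R}) B phi :
  (m1 setT < +oo)%E -> (m2 setT < +oo)%E ->
  (forall A, measurable A -> rho A = m1 A - m2 A)%E ->
  measurable_fun setT phi -> bounded_by B phi ->
  cint rho phi = \int[m1]_x phi x - \int[m2]_x phi x.
Proof.
move=> f1 f2 rhoE mphi hB.
have fin (m : {measure set (I01 R) -> \bar R}) A : (m setT < +oo)%E -> measurable A -> m A \is a fin_num.
  move=> fm mA; rewrite ge0_fin_numE//; apply: le_lt_trans fm.
  by apply: le_measure; rewrite ?inE.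
suff : \int[measure_add (Mplus rho) m2]_x phi x =
       \int[measure_add m1 (Mminus rho)]_x phi x.
  rewrite !(Rintegral_measure_addE _ _ B) ?Mplus_lty ?Mminus_lty//.
  rewrite /cint /cint_on => h; lra.
apply: eq_measure_Rintegral => A mA.
have := rhoE A mA; rewrite MplusB// => h.
rewrite !sum_measureE; move: h.
have := fin _ _ (Mplus_lty rho) mA; have := fin _ _ (Mminus_lty rho) mA.
have := fin _ _ f1 mA; have := fin _ _ f2 mA.
move=> /fineK <- /fineK <- /fineK <- /fineK <-.
by rewrite -!EFinB -!EFinD => -[h]; congr EFin; lra.
Qed.

Lemma cint_Madd mu nu B phi : measurable_fun setT phi -> bounded_by B phi ->
  cint (Madd mu nu) phi = cint mu phi + cint nu phi.
Proof.
move=> mphi hB.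
rewrite (cintE _ (measure_add (Mplus mu) (Mplus nu))
  (measure_add (Mminus mu) (Mminus nu)) B)//.
- rewrite !(Rintegral_measure_addE _ _ B) ?Mplus_lty ?Mminus_lty//.
  by rewrite /cint /cint_on; lra.
- by rewrite sum_measureE lte_add_pinfty ?Mplus_lty.
- by rewrite sum_measureE lte_add_pinfty ?Mminus_lty.
move=> A mA; rewrite /Madd /= /cadd /= !MplusB// !sum_measureE.
have fp (rho : M R) : Mplus rho A \is a fin_num by rewrite fin_num_measure.
have fm (rho : M R) : Mminus rho A \is a fin_num by rewrite fin_num_measure.
rewrite -(fineK (fp mu)) -(fineK (fp nu)) -(fineK (fm mu)) -(fineK (fm nu)).
by rewrite -!EFinB -!EFinD; congr EFin; lra.
Qed.

Lemma cint_copp mu B phi : measurable_fun setT phi -> bounded_by B phi ->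
  cint (copp mu : M R) phi = - cint mu phi.
Proof.
move=> mphi hB.
rewrite (cintE _ (Mminus mu) (Mplus mu) B) ?Mplus_lty ?Mminus_lty//.
  by rewrite /cint /cint_on; lra.
move=> A mA; rewrite /= /copp MplusB//.
have fp : Mplus mu A \is a fin_num by rewrite fin_num_measure.
have fm : Mminus mu A \is a fin_num by rewrite fin_num_measure.
by rewrite fin_num_oppeB// addeC.
Qed.

Lemma cint_Msub mu nu B phi : measurable_fun setT phi -> bounded_by B phi ->
  cint (Msub mu nu) phi = cint mu phi - cint nu phi.
Proof.
by move=> mphi hB; rewrite (cint_Madd _ _ B)// (cint_copp _ B).
Qed.

Lemma cint_M0 B phi : measurable_fun setT phi -> bounded_by B phi ->
  cint (M0 : M R) phi = 0.
Proof.
move=> mphi hB; rewrite (cintE _ (Mplus M0) (Mplus M0) B) ?Mplus_lty//.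
  by rewrite subrr.
move=> A mA; rewrite subee//; last by rewrite fin_num_measure.
Qed.

Lemma cint_ext mu nu B phi : (forall A, measurable A -> mu A = nu A) ->
  measurable_fun setT phi -> bounded_by B phi -> cint mu phi = cint nu phi.
Proof.
move=> h mphi hB.
rewrite [LHS](cintE _ (Mplus nu) (Mminus nu) B) ?Mplus_lty ?Mminus_lty//.
by move=> A mA; rewrite h// MplusB.
Qed.

Lemma cint_Mscale c mu B phi : measurable_fun setT phi -> bounded_by B phi ->
  cint (Mscale c mu) phi = c * cint mu phi.
Proof.
(* [mscale] takes only nonnegative factors; the sign of a negative one is moved onto [copp mu]. *)
wlog c0 : c mu / 0 <= c => [hw|] mphi hB.
  have [/hw|/ltW c0] := leP 0 c; first exact.
  have cN0 : 0 <= - c by rewrite oppr_ge0.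
  have := hw _ (copp mu : M R) cN0 mphi hB; rewrite (cint_copp _ B)// mulrNN.
  move=> <-; apply: cint_ext mphi hB => A mA.
  by rewrite /Mscale /= /cscale /copp EFinN muleNN.
rewrite (cintE _ (mscale (NngNum c0) (Mplus mu))
  (mscale (NngNum c0) (Mminus mu)) B)//.
- have ig (m : {measure set (I01 R) -> \bar R}) : (m setT < +oo)%E ->
      \int[mscale (NngNum c0) m]_x phi x = c * \int[m]_x phi x.
    move=> fm; have ip := bounded_integrable _ _ _ fm mphi hB.
    rewrite /Rintegral integralE !ge0_integral_mscale//; last 2 first.
      by apply: measurable_funeneg; exact: measurable_int ip.
      by apply: measurable_funepos; exact: measurable_int ip.
    rewrite -muleBr//= -?integralE ?fineM//; first exact: integrable_fin_num.
    rewrite fin_num_adde_defr//; apply: integrable_fin_num => //.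
    exact: integrable_funepos.
  by rewrite !ig ?Mplus_lty ?Mminus_lty// /cint /cint_on mulrBr.
- by rewrite /mscale lte_mul_pinfty ?Mplus_lty.
- by rewrite /mscale lte_mul_pinfty ?Mminus_lty.
move=> A mA; rewrite /Mscale /= /cscale MplusB// /mscale /=.
by rewrite muleBr// fin_num_adde_defr// fin_num_measure.
Qed.

Lemma le_cint mu B phi : measurable_fun setT phi -> bounded_by B phi ->
  `|cint mu phi| <= B * normTV mu.
Proof.
move=> mphi hB; rewrite /cint /cint_on (le_trans (ler_normB _ _))//.
rewrite /normTV /charge_variation fineD ?fin_num_measure// mulrDr.
by apply: lerD; apply: le_Rintegral_bounded => //;
  rewrite ?Mplus_lty ?Mminus_lty.
Qed.

Lemma cintD mu B C phi psi : measurable_fun setT phi -> bounded_by B phi ->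
  measurable_fun setT psi -> bounded_by C psi ->
  cint mu (fun x => phi x + psi x) = cint mu phi + cint mu psi.
Proof.
move=> mphi hB mpsi hC; rewrite /cint /cint_on.
have ip := bounded_integrable _ _ _ _ mphi hB.
have iq := bounded_integrable _ _ _ _ mpsi hC.
rewrite !RintegralD//; last first.
- exact/iq/Mplus_lty.
- exact/ip/Mplus_lty.
- exact/iq/Mminus_lty.
- exact/ip/Mminus_lty.
lra.
Qed.

Lemma cintZ mu c B phi : measurable_fun setT phi -> bounded_by B phi ->
  cint mu (fun x => c * phi x) = c * cint mu phi.
Proof.
move=> mphi hB; rewrite /cint /cint_on.
have ip := bounded_integrable _ _ _ _ mphi hB.
rewrite !RintegralZl//; last first.
- exact/ip/Mplus_lty.
- exact/ip/Mminus_lty.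
lra.
Qed.

Lemma cintB mu B C phi psi : measurable_fun setT phi -> bounded_by B phi ->
  measurable_fun setT psi -> bounded_by C psi ->
  cint mu (fun x => phi x - psi x) = cint mu phi - cint mu psi.
Proof.
move=> mphi hB mpsi hC.
have -> : (fun x => phi x - psi x) = (fun x => phi x + -1 * psi x).
  by apply/funext => x; rewrite mulN1r.
rewrite (cintD _ B C)//; last 2 first.
- exact: measurable_funM.
- by move=> x; rewrite mulN1r normrN.
by rewrite (cintZ _ _ C)// mulN1r.
Qed.

(** [Mof] falls back on [M0] when no charge has the prescribed values, so its values are known only
    once a witness [rho] is exhibited. *)
Lemma MofE (m : set (I01 R) -> \bar R) rho :
  (forall A, measurable A -> rho A = m A) ->
  forall A, measurable A -> Mof m A = m A.
Proof.
move=> h; rewrite /Mof /choose_or; case: pselect => [e|]; last by case; exists rho.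
exact: svalP (cid e).
Qed.

Lemma cint_pushforward mu (F : I01 R -> I01 R) B phi :
  measurable_fun setT F -> measurable_fun setT phi -> bounded_by B phi ->
  cint (Mof (pushforward mu F)) phi = cint mu (phi \o F).
Proof.
move=> mF mphi hB.
have mpre A : measurable A -> measurable (F @^-1` A).
  by move=> mA; rewrite -[X in measurable X]setTI; exact: mF.
(* Bundled as a measurable map, [F] makes [pushforward] a measure for the two Jordan parts and a
   charge for [mu], the witness that [MofE] asks for. *)
pose F' : {mfun I01 R >-> I01 R} := mfun_Sub (mem_set mF).
have iphiF (m : {measure set (I01 R) -> \bar R}) : (m setT < +oo)%E ->
    m.-integrable setT (EFin \o (phi \o F)).
  move=> fm; apply: (bounded_integrable _ B) => // [|x]; last exact: hB.
  exact: measurableT_comp.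
rewrite (cintE _ (pushforward (Mplus mu) F') (pushforward (Mminus mu) F') B)//.
- rewrite /cint /cint_on /Rintegral !integral_pushforward//.
  + exact/measurable_EFinP.
  + exact: iphiF (Mminus_lty mu).
  + exact/measurable_EFinP.
  + exact: iphiF (Mplus_lty mu).
- exact: (Mplus_lty mu).
- exact: (Mminus_lty mu).
move=> A mA; rewrite (MofE _ (pushforward mu F' : M R))//.
by rewrite /pushforward MplusB//; exact: mpre.
Qed.

End pairing.

Section density_measure.
Context {d} {T : measurableType d} {R : realType}.
Variables (m : {measure set T -> \bar R}) (g : T -> R).
Hypotheses (ig : m.-integrable setT (EFin \o g)) (g0 : forall x, 0 <= g x).

Lemma induced_charge_ge0 E : (0 <= induced_charge ig E)%E.
Proof. by apply: integral_ge0 => x _; rewrite lee_fin. Qed.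

(** The induced charge of a nonnegative density repackaged as a finite measure, the form in which
    [cintE] and [integral_of_density] take it. *)
Definition density_measure : set T -> \bar R :=
  measure_of_charge (induced_charge ig) induced_charge_ge0.

HB.instance Definition _ := Measure.on density_measure.

Let density_measure_fin : fin_num_fun density_measure.
Proof. by move=> U mU; rewrite /density_measure /measure_of_charge fin_num_measure. Qed.

HB.instance Definition _ := @Measure_isFinite.Build _ _ _
  density_measure density_measure_fin.

End density_measure.

Section density.
Context {R : realType}.
Implicit Types (mu nu rho : M R) (f phi psi : I01 R -> R).

Lemma cint_induced_charge (m : {finite_measure set (I01 R) -> \bar R})
    f phi (B C : R) (ifm : m.-integrable setT (EFin \o f)) :
  measurable_fun setT f -> bounded_by B f ->
  measurable_fun setT phi -> bounded_by C phi ->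
  cint (induced_charge ifm : M R) phi = \int[m]_x (f x * phi x).
Proof.
move=> mf hB mphi hC.
have mfin : (m setT < +oo)%E by rewrite ltey_eq fin_num_measure.
(* The densities [fp] and [fn] decompose the charge into finite measures; [cintE] accepts them
   without a proof that this is the Jordan decomposition. *)
pose fp x := Num.max (f x) 0; pose fn x := Num.max (- f x) 0.
have fE x : f x = fp x - fn x.
  by rewrite /fp /fn; case: (leP (f x) 0) => h; case: leP => h'; lra.
have mfp : measurable_fun setT fp by exact: measurable_maxr.
have mfn : measurable_fun setT fn.
  by apply: measurable_maxr => //; exact: measurableT_comp.
have fp0 x : 0 <= fp x by rewrite le_max lexx orbT.
have fn0 x : 0 <= fn x by rewrite le_max lexx orbT.
have hBp : bounded_by B fp.
  move=> x; rewrite ger0_norm// ge_max (le_trans (ler_norm _) (hB x))/=.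
  exact: le_trans (normr_ge0 _) (hB x).
have hBn : bounded_by B fn.
  move=> x; rewrite ger0_norm// ge_max.
  rewrite (le_trans (ler_norm (- f x)))/=; last by rewrite normrN.
  exact: le_trans (normr_ge0 _) (hB x).
have ip := bounded_integrable _ _ _ mfin mfp hBp.
have im := bounded_integrable _ _ _ mfin mfn hBn.
rewrite (cintE _ (density_measure _ _ ip fp0) (density_measure _ _ im fn0) C)//.
- rewrite (integral_of_density m (density_measure _ _ ip fp0) _ _ B C mfp)//.
  rewrite (integral_of_density m (density_measure _ _ im fn0) _ _ B C mfn)//.
  have bm (g : I01 R -> R) : bounded_by B g ->
      bounded_by (B * C) (fun x => g x * phi x).
    by move=> hg x; rewrite normrM ler_pM.
  rewrite -RintegralB//.
  + by apply: eq_Rintegral => x _; rewrite fE mulrBl.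
  + by apply: bounded_integrable (bm _ hBp) => //; exact: measurable_funM.
  + by apply: bounded_integrable (bm _ hBn) => //; exact: measurable_funM.
- by rewrite ltey_eq fin_num_measure.
- by rewrite ltey_eq fin_num_measure.
move=> A mA; rewrite /= /induced_charge -integralB//; last 2 first.
- exact: integrableS ip.
- exact: integrableS im.
by apply: eq_integral => x _; rewrite /= fE EFinB.
Qed.

Lemma cint_density mu f phi (B C : R) :
  measurable_fun setT f -> bounded_by B f ->
  measurable_fun setT phi -> bounded_by C phi ->
  cint (density f mu) phi = cint mu (fun x => f x * phi x).
Proof.
move=> mf hB mphi hC.
have ip := bounded_integrable _ _ _ (Mplus_lty mu) mf hB.
have im := bounded_integrable _ _ _ (Mminus_lty mu) mf hB.
(* The charge that [Mof] needs as a witness: the density is taken against each Jordan part of [mu]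
   separately. *)
set rho : M R := Msub (induced_charge ip : M R) (induced_charge im : M R).
have rhoE A : measurable A -> rho A = (cint_on mu A f)%:E.
  move=> mA; rewrite /rho /Msub /Madd /= /cadd /copp /= /induced_charge.
  rewrite /cint_on EFinB /Rintegral !fineK//; apply: integrable_fin_num => //;
    exact: (integrableS measurableT).
rewrite (cint_ext _ rho C)//; last first.
  by move=> A mA; rewrite rhoE//; exact: MofE rhoE _ mA.
by rewrite (cint_Msub _ _ C)// !(cint_induced_charge _ _ _ B C).
Qed.

End density.

(** * Bounded Lipschitz functions and the dual norm *)

Section bounded_lipschitz.
Context {R : realType}.
Implicit Types (mu nu : M R) (phi psi : I01 R -> R).

Definition lip_by (L : R) phi :=
  forall x y, `|phi x - phi y| <= L * `|rval x - rval y|.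

Lemma clamp01_subproof (y : R) : 0 <= Num.min 1 (Num.max 0 y) <= 1.
Proof. by rewrite ge_min lexx le_min ler01 le_max lexx. Qed.

(** Retraction of the line onto $[0,1]$. Composing with it extends a function on [I01 R] to the line
    without increasing its Lipschitz constant. *)
Definition clamp01 (y : R) : I01 R := 
  exist (fun x : R => 0 <= x <= 1) _ (clamp01_subproof y).

Lemma rval_itv (x : I01 R) : 0 <= rval x <= 1.
Proof. exact: (proj2_sig x). Qed.

Lemma rval_inj : injective (@rval R).
Proof. exact: val_inj. Qed.

Lemma clamp01K (x : I01 R) : clamp01 (rval x) = x.
Proof.
apply: rval_inj; rewrite /rval /clamp01 /=.
by have /andP[h0 h1] := rval_itv x; rewrite (max_idPr h0) (min_idPr h1).
Qed.

Lemma clamp01_id (y : R) : 0 <= y <= 1 -> rval (clamp01 y) = y.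
Proof. by move=> /andP[h0 h1]; rewrite /rval /= (max_idPr h0) (min_idPr h1). Qed.

Lemma clamp01_lip (y z : R) : `|rval (clamp01 y) - rval (clamp01 z)| <= `|y - z|.
Proof.
rewrite /rval /= /Num.min /Num.max.
case: (ltP 0 y) => hy; case: (ltP 0 z) => hz; case: (ltP 1 y) => hy1;
  case: (ltP 1 z) => hz1; rewrite ?ltr10; case: (ler0P (y - z)) => ?;
  rewrite ?ler_norml; lra.
Qed.

Lemma measurable_rval : measurable_fun setT (@rval R : I01 R -> R).
Proof.
by move=> _ Y mY; exists Y => //.
Qed.

Lemma continuous_lip (f : R -> R) (L : R) :
  (forall y z, `|f y - f z| <= L * `|y - z|) -> continuous f.
Proof.
move=> hL y; apply/cvgrPdist_le => e e0.
have L0 : 0 < `|L| + 1 by rewrite ltr_pwDr.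
near=> z; rewrite (le_trans (hL _ _))// (@le_trans _ _ ((`|L| + 1) * `|y - z|))//.
  by rewrite ler_wpM2r// (le_trans (ler_norm _))// lerDl.
rewrite -ler_pdivlMl// mulrC; apply: ltW.
by near: z; apply: cvgr_dist_lt; rewrite ?divr_gt0.
Unshelve. all: by end_near. Qed.

Lemma measurable_lip (L : R) phi : lip_by L phi -> measurable_fun setT phi.
Proof.
move=> hL; have -> : phi = (phi \o clamp01) \o (@rval R).
  by apply/funext => x; rewrite /= clamp01K.
apply: measurableT_comp measurable_rval.
apply: continuous_measurable_fun; apply: (@continuous_lip _ `|L|) => y z /=.
rewrite (le_trans (hL _ _))// (@le_trans _ _ (`|L| * `|rval (clamp01 y) - rval (clamp01 z)|))//.
  by rewrite ler_wpM2r// ler_norm.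
by rewrite ler_wpM2l// clamp01_lip.
Qed.

Lemma measurable_lip_map (L : R) (F : I01 R -> I01 R) :
  lip_by L (@rval R \o F) -> measurable_fun setT F.
Proof.
move=> hL _ A [B mB <-]; rewrite setTI.
have := measurable_lip _ _ hL measurableT B mB; rewrite setTI.
by congr measurable; apply/seteqP; split => x /= => [|[]].
Qed.

(** Some bounds rather than the norms themselves: they follow products and compositions with the
    flow by plain arithmetic, with no supremum or infimum to recompute. *)
Definition BL_by (B L : R) phi := [/\ 0 <= B, 0 <= L, bounded_by B phi & lip_by L phi].

Lemma BL_BL_by phi : BL phi -> exists B L, BL_by B L phi.
Proof.
move=> [[B hB] [L [L0 hL]]]; exists B, L; split=> //.
exact: le_trans (normr_ge0 _) (hB point).
Qed.

Lemma BL_byP B L phi : BL_by B L phi -> BL phi.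
Proof. by move=> [B0 L0 hB hL]; split; [exists B|exists L]. Qed.

Lemma norm_sup_le B phi : bounded_by B phi -> norm_sup phi <= B.
Proof.
move=> hB; apply: ge_sup => [|_ [x _ <-]]; last exact: hB.
by exists `|phi point|; exists point.
Qed.

Lemma bounded_by_norm_sup phi : BL phi -> bounded_by (norm_sup phi) phi.
Proof.
move=> [[B hB] _] x; apply: ub_le_sup; last by exists x.
by exists B => _ [y _ <-].
Qed.

Lemma has_inf_lip_bound phi : BL phi -> has_inf (lip_bound phi).
Proof. by move=> [_ h]; split=> //; exists 0 => L []. Qed.

Lemma lip_const_le L phi : 0 <= L -> lip_by L phi -> lip_const phi <= L.
Proof. by move=> L0 hL; apply: ge_inf => //; exists 0 => ? []. Qed.

Lemma lip_const_ge0 phi : BL phi -> 0 <= lip_const phi.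
Proof. by move=> [_ h]; apply: lb_le_inf => // L []. Qed.

Lemma lip_by_lip_const phi : BL phi -> lip_by (lip_const phi) phi.
Proof.
move=> hphi x y; apply/ler_addgt0Pr => e e0.
(* The summand 1 covers [x = y]; the excess over the infimum, multiplied by the distance, stays
   below [e]. *)
have d0 : 0 < e / (`|rval x - rval y| + 1) by rewrite divr_gt0// ltr_pwDr.
have [L [L0 hL] Lt] := inf_adherent d0 (has_inf_lip_bound _ hphi).
rewrite (le_trans (hL x y))//.
rewrite (@le_trans _ _
  ((lip_const phi + e / (`|rval x - rval y| + 1)) * `|rval x - rval y|))//.
  by rewrite ler_wpM2r// ltW.
rewrite mulrDl lerD2l mulrAC ler_pdivrMr ?ltr_pwDr//.
by rewrite ler_wpM2l ?ltW// ltrDl.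
Qed.

Lemma norm_sup_ge0 phi : BL phi -> 0 <= norm_sup phi.
Proof. by move=> /bounded_by_norm_sup /(_ point); apply: le_trans. Qed.

Lemma normTV_ge0 mu : 0 <= normTV mu.
Proof. by rewrite /normTV fine_ge0// /charge_variation adde_ge0. Qed.

Lemma BL_by_normBL phi : BL phi -> normBL phi <= 1 ->
  exists B L, BL_by B L phi /\ B + L <= 1.
Proof.
move=> hphi h1; exists (norm_sup phi), (lip_const phi); split=> //.
split; [exact: norm_sup_ge0|exact: lip_const_ge0|exact: bounded_by_norm_sup|].
exact: lip_by_lip_const.
Qed.

Definition dual_values mu :=
  [set `|cint mu phi| | phi in [set phi | BL phi /\ normBL phi <= 1]].

Lemma dual_values_ub mu : has_ubound (dual_values mu).
Proof.
exists (normTV mu) => _ [phi [hphi h1] <-].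
have [B [L [[B0 L0 hB hL] BL1]]] := BL_by_normBL _ hphi h1.
rewrite (le_trans (le_cint _ B _ (measurable_lip _ _ hL) hB))//.
rewrite ler_piMl ?normTV_ge0//; lra.
Qed.

Lemma normBL_le B L phi : BL_by B L phi -> normBL phi <= B + L.
Proof.
by move=> [B0 L0 hB hL]; apply: lerD; [exact: norm_sup_le|exact: lip_const_le].
Qed.

Lemma le_normBLdual1 mu B L phi : BL_by B L phi -> B + L <= 1 ->
  `|cint mu phi| <= normBLdual mu.
Proof.
move=> h h1; apply: ub_le_sup; first exact: dual_values_ub.
exists phi => //; split; first exact: BL_byP h.
exact: le_trans (normBL_le _ _ _ h) h1.
Qed.

Lemma cst_BL_by : BL_by 0 0 (fun=> 0).
Proof. by split=> // x; rewrite ?subrr normr0// mul0r. Qed.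

Lemma normBLdual_ge0 mu : 0 <= normBLdual mu.
Proof.
by apply: le_trans (le_normBLdual1 mu _ _ _ cst_BL_by _); rewrite ?addr0.
Qed.

Lemma BL_byZ c B L phi : 0 <= c -> BL_by B L phi ->
  BL_by (c * B) (c * L) (fun x => c * phi x).
Proof.
move=> c0 [B0 L0 hB hL]; split; rewrite ?mulr_ge0// => x.
  by rewrite normrM (ger0_norm c0) ler_wpM2l.
by move=> y; rewrite -mulrBr normrM (ger0_norm c0) -mulrA ler_wpM2l.
Qed.

Lemma le_normBLdual mu B L phi : BL_by B L phi ->
  `|cint mu phi| <= (B + L) * normBLdual mu.
Proof.
move=> h; have [B0 L0 hB hL] := h.
have mphi := measurable_lip _ _ hL.
have : 0 <= B + L by exact: addr_ge0.
(* [phi] is scaled by the inverse of [B + L]; when that sum is 0, [phi] vanishes and the pairing is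
   bounded directly. *)
rewrite le_eqVlt => /orP[/eqP BL0|BL0].
  rewrite -BL0 mul0r (le_trans (le_cint _ 0 _ mphi _)) ?mul0r//.
  by move=> x; rewrite (le_trans (hB x))//; lra.
have c0 : 0 <= (B + L)^-1 by rewrite invr_ge0 ltW.
have := le_normBLdual1 mu _ _ _ (BL_byZ _ _ _ _ c0 h).
rewrite -mulrDr mulVf ?gt_eqF// => /(_ (lexx _)).
by rewrite (cintZ _ _ B)// normrM ger0_norm// ler_pdivrMl.
Qed.

Lemma normBLdual_le mu D :
  (forall B L phi, BL_by B L phi -> B + L <= 1 -> `|cint mu phi| <= D) ->
  normBLdual mu <= D.
Proof.
move=> h; apply: ge_sup.
  exists `|cint mu (fun=> 0)|; exists (fun=> 0) => //; split.
    exact: BL_byP cst_BL_by.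
  by rewrite (le_trans (normBL_le _ _ _ cst_BL_by))// addr0.
move=> _ [phi [hphi h1] <-].
by have [B [L [hBL BL1]]] := BL_by_normBL _ hphi h1; exact: h hBL BL1.
Qed.

Lemma cint_Msub_BL mu nu B L phi : BL_by B L phi ->
  cint (Msub mu nu) phi = cint mu phi - cint nu phi.
Proof.
by move=> [_ _ hB hL]; apply: cint_Msub hB; exact: measurable_lip hL.
Qed.

Lemma distBL_ge0 mu nu : 0 <= distBL mu nu.
Proof. exact: normBLdual_ge0. Qed.

Lemma le_distBL mu nu B L phi : BL_by B L phi ->
  `|cint mu phi - cint nu phi| <= (B + L) * distBL mu nu.
Proof. by move=> h; rewrite -(cint_Msub_BL _ _ _ _ _ h); exact: le_normBLdual. Qed.

Lemma distBL_le mu nu D :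
  (forall B L phi, BL_by B L phi -> B + L <= 1 ->
    `|cint mu phi - cint nu phi| <= D) -> distBL mu nu <= D.
Proof.
move=> h; apply: normBLdual_le => B L phi hBL BL1.
by rewrite (cint_Msub_BL _ _ _ _ _ hBL); exact: h hBL BL1.
Qed.

Lemma distBL_le1 mu nu B L phi : BL_by B L phi -> B + L <= 1 ->
  `|cint mu phi - cint nu phi| <= distBL mu nu.
Proof.
move=> h h1; apply: le_trans (le_distBL mu nu _ _ _ h) _.
by rewrite ler_piMl// distBL_ge0.
Qed.

Lemma distBLC mu nu : distBL mu nu = distBL nu mu.
Proof.
by apply/eqP; rewrite eq_le; apply/andP; split; apply: distBL_le => B L phi h h1;
  rewrite distrC; exact: distBL_le1 h h1.
Qed.

Lemma distBL_triangle mu rho nu :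
  distBL mu nu <= distBL mu rho + distBL rho nu.
Proof.
apply: distBL_le => B L phi h h1.
rewrite (le_trans (ler_distD (cint rho phi) _ _))//.
by apply: lerD; exact: distBL_le1 h h1.
Qed.

End bounded_lipschitz.

Lemma ler_dist_max {R : realType} (a b c d : R) :
  `|Num.max a b - Num.max c d| <= `|a - c| + `|b - d|.
Proof.
have := ler_norm (a - c); have := ler_norm (b - d).
have := ler_norm (- (a - c)); have := ler_norm (- (b - d)); rewrite !normrN.
by move=> ? ? ? ?; rewrite ler_norml; case: (leP a b) => ?; case: (leP c d) => ?; lra.
Qed.

(** * Lipschitz approximation of indicators, and total variation by duality *)

Section lipschitz_approximation.
Context {R : realType}.
Variable m : {measure set (I01 R) -> \bar R}.
Hypothesis mfin : (m setT < +oo)%E.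
Implicit Types (E F : set (I01 R)) (phi psi : I01 R -> R).

Definition lip_approx phi := forall e : R, 0 < e -> exists L psi,
  [/\ 0 <= L, lip_by L psi, forall x, 0 <= psi x <= 1 &
      \int[m]_x `|psi x - phi x| <= e].

Lemma indic_itv E x : 0 <= (\1_E x : R) <= 1.
Proof. by rewrite indicE; case: (x \in E); rewrite lexx ler01. Qed.

Let integrable_dist phi psi :
  measurable_fun setT phi -> measurable_fun setT psi ->
  (forall x, 0 <= phi x <= 1) -> (forall x, 0 <= psi x <= 1) ->
  m.-integrable setT (EFin \o (fun x => `|phi x - psi x|)).
Proof.
move=> mphi mpsi h1 h2; apply: (bounded_integrable _ 1) => //.
  by apply: measurableT_comp => //; exact: measurable_funB.
by move=> x; rewrite normr_id; have := h1 x; have := h2 x; rewrite ler_norml; lra.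
Qed.

Lemma lip_approxC E : measurable E -> lip_approx (\1_E) -> lip_approx (\1_(~` E)).
Proof.
move=> mE hE e e0; have [L [psi [L0 hL h01 hi]]] := hE e e0.
exists L, (fun x => 1 - psi x); split => //.
- by move=> x y; rewrite (_ : _ - _ = psi y - psi x) 1?distrC//; ring.
- by move=> x; have := h01 x; lra.
apply: le_trans hi; rewrite le_eqVlt; apply/orP; left; apply/eqP.
apply: eq_Rintegral => x _.
rewrite -[LHS]normrN !indicE in_setC; congr `|_|.
by case: (x \in E) => /=; ring.
Qed.

(** Dominated convergence brings some [u N] within [e / 2] of [phi] in $L^1$, and the other half of
    [e] is spent on approximating [u N]. *)
Lemma lip_approx_cvg phi (u : nat -> I01 R -> R) :
  measurable_fun setT phi -> (forall n, measurable_fun setT (u n)) ->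
  (forall x, 0 <= phi x <= 1) -> (forall n x, 0 <= u n x <= 1) ->
  (forall x, u n x @[n --> \oo] --> phi x) ->
  (forall n, lip_approx (u n)) -> lip_approx phi.
Proof.
move=> mphi mu phi01 u01 uphi hu e e0.
have /cvgrPdist_lt /(_ (e / 2)) :
    \int[m]_x `|u n x - phi x| @[n --> \oo] --> (0 : R).
  have mi n : measurable_fun setT (fun x => (`|u n x - phi x|%:E : \bar R)).
    apply/measurable_EFinP; apply: measurableT_comp => //.
    exact: measurable_funB.
  have [] := @dominated_convergence _ _ _ m setT measurableT
    (fun n x => `|u n x - phi x|%:E) (cst 0%E) (cst 1%E) mi.
  - exact: measurable_cst.
  - apply: aeW => x _; apply: cvg_EFin; first exact: nearW.
    have := cvg_norm (cvgB (uphi x) (cvg_cst (phi x))); rewrite subrr normr0.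
    exact.
  - by apply: (bounded_integrable m 1 (cst 1)) => // x; rewrite /= normr1.
  - apply: aeW => x n _; rewrite /= lee_fin normr_id.
    by have := u01 n x; have := phi01 x; rewrite ler_norml; lra.
  move=> _ _; rewrite integral0 => h.
  exact: (cvg_trans _ (fine_cvg h)).
rewrite divr_gt0// => /(_ isT) [N _ /(_ N (leqnn N))] /=.
rewrite sub0r normrN => hN.
have [L [psi [L0 hL h01 hi]]] := hu N (e / 2) (divr_gt0 e0 (ltr0n _ 2)).
exists L, psi; split => //.
have mpsi := measurable_lip _ _ hL.
have i1 := integrable_dist _ _ mpsi (mu N) h01 (u01 N).
have i2 := integrable_dist _ _ (mu N) mphi (u01 N) phi01.
apply: (@le_trans _ _ (\int[m]_x (`|psi x - u N x| + `|u N x - phi x|))).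
  apply: le_Rintegral => //; first exact: integrable_dist.
    exact: (integrableD measurableT i1 i2).
  by move=> x _; exact: ler_distD.
rewrite RintegralD//; have := le_lt_trans (ler_norm _) hN; lra.
Qed.

(** The indicator of a union is the maximum of the indicators, and the maximum of the two
    approximants is again Lipschitz. *)
Lemma lip_approxU E F : measurable E -> measurable F ->
  lip_approx \1_E -> lip_approx \1_F -> lip_approx (\1_(E `|` F)).
Proof.
move=> mE mF hE hF e e0.
have e2 : 0 < e / 2 by rewrite divr_gt0.
have [L [psi [L0 hL h01 hi]]] := hE _ e2.
have [K [phi [K0 hK k01 ki]]] := hF _ e2.
exists (L + K), (fun x => Num.max (psi x) (phi x)); split => //.
- exact: addr_ge0.
- move=> x y; apply: (@le_trans _ _ (`|psi x - psi y| + `|phi x - phi y|)).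
    exact: ler_dist_max.
  by rewrite mulrDl lerD.
- by move=> x; have := h01 x; have := k01 x; case: (leP (psi x) (phi x)) => ?; lra.
have mpsi := measurable_lip _ _ hL; have mphi := measurable_lip _ _ hK.
have i1 : m.-integrable setT (EFin \o (fun x => `|psi x - \1_E x|)).
  by apply: integrable_dist => //; exact: indic_itv.
have i2 : m.-integrable setT (EFin \o (fun x => `|phi x - \1_F x|)).
  by apply: integrable_dist => //; exact: indic_itv.
apply: (@le_trans _ _ (\int[m]_x (`|psi x - \1_E x| + `|phi x - \1_F x|))).
  apply: le_Rintegral => //.
  - apply: integrable_dist => //; [exact: measurable_maxr| | |exact: indic_itv].
      by apply: measurable_indic; exact: measurableU.
    by move=> x; have := h01 x; have := k01 x; case: (leP (psi x) (phi x)) => ?; lra.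
  - exact: (integrableD measurableT i1 i2).
  move=> x _; rewrite (_ : \1_(E `|` F) x = Num.max (\1_E x) (\1_F x)).
    exact: ler_dist_max.
  by rewrite !indicE in_setU /Num.max; case: (x \in E); case: (x \in F);
    rewrite ?ltxx ?ltr01 ?ltr10.
by rewrite RintegralD//; lra.
Qed.

Lemma Rintegral_eq0 phi : (forall x, phi x = 0) -> \int[m]_x phi x = 0.
Proof. by move=> /funext ->; rewrite Rintegral_cst// mul0r. Qed.

Lemma lip_approx0 : lip_approx (\1_set0).
Proof.
move=> e e0; exists 0, (fun=> 0); split => //.
- by move=> x y; rewrite subrr normr0 mul0r.
- by move=> x; rewrite lexx ler01.
rewrite Rintegral_eq0 ?ltW// => x.
by rewrite indic0 subrr normr0.
Qed.

Lemma measurable_ray (a : R) : measurable [set x : I01 R | a < rval x].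
Proof.
have := @measurable_rval R measurableT `]a, +oo[%classic (measurable_itv _).
by rewrite setTI; congr measurable; apply/seteqP; split => x /=;
  rewrite in_itv/= andbT.
Qed.

(** Ramps of slope [n] that start at [a] converge pointwise to the indicator; at [a] itself they
    vanish, in accordance with the strict inequality. *)
Lemma lip_approx_ray (a : R) : lip_approx \1_[set x : I01 R | a < rval x].
Proof.
pose u n (x : I01 R) := rval (clamp01 (n%:R * (rval x - a))) : R.
have ulip n : lip_by n%:R (u n).
  move=> x y; rewrite (le_trans (clamp01_lip _ _))// -mulrBr normrM ger0_norm//.
  by rewrite (_ : rval x - a - (rval y - a) = rval x - rval y)//; ring.
apply: (lip_approx_cvg _ u) => //.
- by apply: measurable_indic; exact: measurable_ray.
- by move=> n; exact: measurable_lip (ulip n).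
- exact: indic_itv.
- by move=> n x; exact: rval_itv.
- move=> x; apply: cvg_near_cst; rewrite indicE.
  have [ax|xa] := ltP a (rval x).
    rewrite mem_set//; near=> n; rewrite /u /rval /= -/(rval x).
    have n1 : 1 <= n%:R * (rval x - a).
      rewrite -ler_pdivrMr ?subr_gt0//; near: n; exact: nbhs_infty_ger.
    by rewrite (max_r (le_trans ler01 n1)) (min_l n1).
  rewrite memNset; last by apply/negP; rewrite -leNgt.
  near=> n; rewrite /u /rval /= -/(rval x) max_l ?min_r//.
  by rewrite mulr_ge0_le0// subr_le0.
- move=> n e e0; exists n%:R, (u n); split => //; first by move=> x; exact: rval_itv.
  rewrite Rintegral_eq0 ?ltW// => x.
  by rewrite subrr normr0.
Unshelve. all: by end_near. Qed.

(** Good sets principle: the Borel sets whose preimage can be approximated form a sigma-algebra that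
    contains the open rays, and these generate. *)
Lemma lip_approx_measurable E : measurable E -> lip_approx \1_E.
Proof.
move=> [B mB <-]; rewrite setTI.
pose G := [set A : set (measurableTypeR R) |
  measurable (@rval R @^-1` A) /\ lip_approx \1_(@rval R @^-1` A)].
have {}mB : (@RGenOInfty.G R).-sigma.-measurable B.
  by rewrite -RGenOInfty.measurableE.
suff [] : G B by [].
apply: smallest_sub B mB.
  split.
  - by split; rewrite preimage_set0//; exact: lip_approx0.
  - move=> A [mA hA]; rewrite setTD; split; rewrite preimage_setC.
      exact: measurableC.
    exact: lip_approxC.
  move=> A GA; split; rewrite preimage_bigcup.
    by apply: bigcupT_measurable => n; exact: (GA n).1.
  (* A countable union is the pointwise limit of its finite partial unions, which [lip_approxU]
     builds one set at a time. *)
  pose U n := \big[setU/set0]_(i < n) (@rval R @^-1` A i).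
  have UE n : U n = \bigcup_(i < n) (@rval R @^-1` A i).
    by symmetry; exact: bigcup_mkord.
  have [mU hU] : (forall n, measurable (U n)) /\ (forall n, lip_approx \1_(U n)).
    apply/all_and2; elim => [|n [mUn hUn]]; rewrite /U.
      by rewrite big_ord0; split => //; exact: lip_approx0.
    have [mAn hAn] := GA n.
    by rewrite big_ord_recr; split; [exact: measurableU|exact: lip_approxU].
  apply: (lip_approx_cvg _ (fun n => \1_(U n))) => //.
  - apply: measurable_indic; apply: bigcupT_measurable => n; exact: (GA n).1.
  - exact: indic_itv.
  - by move=> n x; exact: indic_itv.
  move=> x; apply: cvg_near_cst.
  have [[k _ Ak]|nA] := pselect ((\bigcup_n (@rval R @^-1` A n)) x).
    near=> n; have Ux : U n x.
      rewrite UE; exists k => //=; near: n.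
      exact: nbhs_infty_gt.
    by rewrite !indicE !mem_set//; exists k.
  near=> n; rewrite !indicE !memNset// UE => -[k _ Ak].
  by apply: nA; exists k.
move=> A [a ->]; rewrite /G /= (_ : _ @^-1` _ = [set x : I01 R | a < rval x]).
  by split; [exact: measurable_ray|exact: lip_approx_ray].
by apply/seteqP; split => x /=; rewrite in_itv/= andbT.
Unshelve. all: by end_near. Qed.

End lipschitz_approximation.

(** With [P] the positive set of the Hahn decomposition, the total variation is $\int (2\cdot 1_P -
    1)\,d\mu$. A Lipschitz [psi] with values in $[0,1]$, close to $1_P$ in $L^1(|\mu|)$, yields the
    test function [2 * psi - 1]. This opens the total variation to estimates that see only Lipschitz
    functions. *)
Lemma normTV_le {R : realType} (mu : M R) (C : R) :
  (forall L phi, 0 <= L -> bounded_by 1 phi -> lip_by L phi ->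
    `|cint mu phi| <= C) -> normTV mu <= C.
Proof.
move=> hC; apply/ler_addgt0Pr => e e0.
have [posP negN PN PN0] := hahnPN mu.
set P := hahn_P mu in posP PN PN0 *; set N := hahn_N mu in negN PN PN0 *.
have [mP mN] : measurable P /\ measurable N by split; [exact: posP.1|exact: negN.1].
pose m : {measure set (I01 R) -> \bar R} := measure_add (Mplus mu) (Mminus mu).
have fp := Mplus_lty mu; have fm := Mminus_lty mu.
have mfin : (m setT < +oo)%E by rewrite sum_measureE lte_add_pinfty.
have [L [psi [L0 hL h01 hi]]] :=
  lip_approx_measurable m mfin P mP (e / 2) (divr_gt0 e0 (ltr0n _ 2)).
have mpsi := measurable_lip _ _ hL.
have bpsi : bounded_by 1 psi by move=> x; have := h01 x; rewrite ler_norml; lra.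
have b1 : bounded_by 1 (\1_P : I01 R -> R).
  by move=> x; have := indic_itv P x; rewrite ler_norml; lra.
have m1 : measurable_fun setT (\1_P : I01 R -> R) by exact: measurable_indic.
have mdist : measurable_fun setT (fun x => `|psi x - \1_P x|).
  by apply: measurableT_comp => //; exact: measurable_funB.
have bdist : bounded_by 1 (fun x => `|psi x - \1_P x|).
  by move=> x; rewrite normr_id; have := h01 x; have := indic_itv P x;
    rewrite ler_norml; lra.
have dpsi : `|cint mu psi - cint mu \1_P| <= e / 2.
  rewrite -(cintB _ 1 1)// /cint /cint_on (le_trans (ler_normB _ _))//.
  apply: le_trans hi; rewrite (Rintegral_measure_addE _ _ 1)//.
  by apply: lerD; apply: le_normr_Rintegral => //; apply: (bounded_integrable _ 2) => //;
    [exact: measurable_funB| |exact: measurable_funB|] => x;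
    have := h01 x; have := indic_itv P x; rewrite ler_norml; lra.
have plusN : Mminus mu P = 0%E.
  apply: etrans (cjordan_negE (hahnPN mu) P) _.
  by rewrite /crestr0 mem_set// /crestr PN0 charge0 oppe0.
have plusP : Mplus mu setT = Mplus mu P.
  apply: etrans (cjordan_posE (hahnPN mu) setT) _.
  apply: etrans _ (esym (cjordan_posE (hahnPN mu) P)).
  by rewrite /crestr0 !mem_set// /crestr setTI setIid.
have c1 : cint mu \1_P = fine (Mplus mu setT).
  rewrite /cint /cint_on /Rintegral !integral_indic// !setIT.
  by rewrite plusN plusP subr0.
have c2 : cint mu (fun=> 1) = fine (Mplus mu setT) - fine (Mminus mu setT).
  by rewrite /cint /cint_on !Rintegral_cst// !mul1r.
have TVE : normTV mu = 2 * cint mu \1_P - cint mu (fun=> 1).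
  rewrite c1 c2 /normTV /charge_variation fineD ?fin_num_measure//.
  by rewrite -/(Mplus mu) -/(Mminus mu); lra.
pose phi x := 2 * psi x - 1.
have bphi : bounded_by 1 phi.
  by move=> x; rewrite /phi; have := h01 x; rewrite ler_norml; lra.
have lphi : lip_by (2 * L) phi.
  move=> x y; rewrite /phi (_ : _ - _ = 2 * (psi x - psi y)); last by ring.
  by rewrite normrM ger0_norm// -mulrA ler_wpM2l.
have := hC _ _ (mulr_ge0 (ler0n _ 2) L0) bphi lphi.
rewrite /phi (cintB _ 2 1)//; first last.
- by move=> x; rewrite normr1.
- by move=> x; have := h01 x; rewrite ler_norml; lra.
- exact: measurable_funM.
rewrite (cintZ _ _ 1)// TVE => /ler_normlP[_ h].
move/ler_normlP : dpsi => [h1 h2]; lra.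
Qed.

(** * The stopped flow *)

Section real_curves.
Context {R : realType}.
Implicit Types (y d : R -> R) (P : R -> Prop).

(** Consider the supremum of the times up to which [P] holds throughout: [Pleft] makes [P] hold
    there, and [Pright] moves beyond it unless it is [t]. The length [e] may depend on [r] without
    any uniformity. *)
Lemma real_induction (t : R) P : P 0 ->
  (forall r : R, 0 <= r < t -> P r ->
    exists2 e : R, 0 < e & forall q : R, r < q < r + e -> q <= t -> P q) ->
  (forall r : R, 0 < r <= t -> (forall q : R, 0 <= q < r -> P q) -> P r) ->
  forall r : R, 0 <= r <= t -> P r.
Proof.
move=> P0 Pright Pleft r /andP[r0 rt].
have t0 : 0 <= t := le_trans r0 rt.
pose S := [set u : R | 0 <= u <= t /\ forall q : R, 0 <= q <= u -> P q].
have S0 : S 0.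
  split; first by rewrite lexx.
  by move=> q q0; rewrite (_ : q = 0) //; apply/eqP; rewrite eq_le andbC.
have Sub : has_ubound S by exists t => u [/andP[]].
have supS : has_sup S by split => //; exists 0.
have m0 : 0 <= sup S by exact: ub_le_sup.
have mt : sup S <= t by apply: ge_sup; [exists 0|move=> u [/andP[]]].
have below q : 0 <= q < sup S -> P q.
  move=> /andP[q0 qm]; have [u [_ hu] qu] := sup_gt supS.1 qm.
  by apply: hu; rewrite q0 ltW.
have Pm : P (sup S).
  have := m0; rewrite le_eqVlt => /orP[/eqP <-//|m0'].
  by apply: Pleft => //; rewrite m0'.
have upto q : 0 <= q <= sup S -> P q.
  by move=> /andP[q0]; rewrite le_eqVlt => /orP[/eqP ->//|qm]; apply: below; rewrite q0.
have mE : sup S = t.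
  apply/eqP; rewrite eq_le mt leNgt; apply/negP => mlt.
  have [|e e0 he] := Pright (sup S) _ Pm; first by rewrite m0.
  pose u := Num.min t (sup S + e / 2).
  have mu : sup S < u by rewrite /u lt_min mlt ltrDl divr_gt0.
  have ue : u <= sup S + e / 2 by rewrite /u ge_min lexx orbT.
  have ut : u <= t by rewrite /u ge_min lexx.
  have : S u.
    split; first by rewrite ut andbT (le_trans m0)// ltW.
    move=> q /andP[q0 qu]; have [qm|qm] := leP q (sup S).
      by apply: upto; rewrite q0.
    by apply: he; [lra|exact: le_trans ut].
  by move=> /(ub_le_sup Sub); rewrite leNgt mu.
by apply: upto; rewrite mE r0.
Qed.

(** One-sided, because at the moment of stopping a curve may have two different one-sided
    derivatives; written as an estimate on increments, so that it can be used with no quotient. *)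
Definition right_deriv y (t e : R) := forall eps : R, 0 < eps ->
  exists2 h : R, 0 < h & forall s : R, t < s < t + h ->
    `|y s - y t - e * (s - t)| <= eps * (s - t).

Definition left_cont y (t : R) := y s @[s --> t^'-] --> y t.

Lemma right_derivB y1 y2 t e1 e2 : right_deriv y1 t e1 -> right_deriv y2 t e2 ->
  right_deriv (fun s => y1 s - y2 s) t (e1 - e2).
Proof.
move=> h1 h2 eps eps0.
have eps2 : 0 < eps / 2 by rewrite divr_gt0.
have [d1 d10 {}h1] := h1 _ eps2; have [d2 d20 {}h2] := h2 _ eps2.
exists (Num.min d1 d2); first by rewrite lt_min d10.
move=> s /andP[ts sd].
have sd1 : s < t + d1 by rewrite (lt_le_trans sd)// lerD2l ge_min lexx.
have sd2 : s < t + d2 by rewrite (lt_le_trans sd)// lerD2l ge_min lexx orbT.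
have := h1 s; rewrite ts sd1 => /(_ isT) {}h1.
have := h2 s; rewrite ts sd2 => /(_ isT) {}h2.
rewrite (_ : _ - _ = (y1 s - y1 t - e1 * (s - t)) - (y2 s - y2 t - e2 * (s - t)));
  last by ring.
by rewrite (le_trans (ler_normB _ _))//; lra.
Qed.

Lemma right_derivN y t e : right_deriv y t e -> right_deriv (fun s => - y s) t (- e).
Proof.
move=> h eps /h[d d0 {}h]; exists d => // s /h.
by rewrite -normrN (_ : - (_ - _) = - y s - - y t - - e * (s - t))//; ring.
Qed.

Lemma left_le (g : R -> R) (a t : R) : a < t -> left_cont g t ->
  (forall s, a <= s < t -> g s <= 0) -> g t <= 0.
Proof.
move=> at_ gt h; apply: (cvgr_to_le gt); near=> s; apply: h; apply/andP; split.
  by near: s; exact: nbhs_left_ge.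
by near: s; exact: nbhs_left_lt.
Unshelve. all: by end_near. Qed.

(** A mean value inequality for right derivatives. An allowance [e1] per unit time pays for the
    error term of the derivative, and the denominator [t + 1] keeps the total below [eps]. *)
Lemma right_deriv_bound y (t a k : R) : 0 <= t ->
  (forall r, 0 <= r < t -> exists2 e, `|e - a| <= k & right_deriv y r e) ->
  (forall r, 0 < r <= t -> left_cont y r) ->
  `|y t - y 0 - a * t| <= k * t.
Proof.
move=> t0 hd hc; apply/ler_addgt0Pr => eps eps0.
have e0 : 0 < eps / (t + 1) by rewrite divr_gt0// ltr_pwDr.
set e1 := eps / (t + 1) in e0.
suff : `|y t - y 0 - a * t| <= (k + e1) * t.
  move=> h; apply: le_trans h _; rewrite mulrDl lerD2l /e1 mulrAC ler_pdivrMr ?ltr_pwDr//.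
  by rewrite ler_wpM2l ?ltW// ltrDl.
apply: (real_induction t (fun r => `|y r - y 0 - a * r| <= (k + e1) * r)).
- by rewrite subrr !mulr0 subr0 normr0.
- move=> r rt Pr; have [e ek /(_ _ e0)[h h0 hh]] := hd r rt.
  exists h => // q /[dup] rq /hh qh _.
  have qr : 0 <= q - r by rewrite subr_ge0; case/andP: rq => /ltW.
  rewrite (_ : _ - _ = (y r - y 0 - a * r) + (y q - y r - e * (q - r)) + (e - a) * (q - r));
    last by ring.
  rewrite (le_trans (ler_normD _ _))// (le_trans (lerD (ler_normD _ _) (lexx _)))//.
  rewrite (normrM (e - a)) (ger0_norm qr).
  have := ler_wpM2r qr ek; lra.
- move=> r /[dup] rt /andP[r0 _] Pq.
  have := @left_le (fun r => `|y r - y 0 - a * r| - (k + e1) * r) 0 r r0.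
  rewrite subr_le0; apply.
    apply: cvgB; last by apply: cvgM; [exact: cvg_cst|exact: cvg_at_left_filter cvg_id].
    apply: cvg_norm; apply: cvgB; last by apply: cvgM; [exact: cvg_cst|exact: cvg_at_left_filter cvg_id].
    by apply: cvgB; [exact: hc|exact: cvg_cst].
  by move=> s /Pq; rewrite subr_le0.
by rewrite lexx t0.
Qed.

Section growth_bound.
Variables (c k eta : R).
Hypotheses (c0 : 0 < c) (k0 : 0 <= k) (eta0 : 0 <= eta).

(** A supersolution of $g'=kg+\eta$ with value $c$ at 0. The exact solution would contain
    $\eta(e^{kr}-1)/k$ and require a separate case for [k = 0]. *)
Definition gbound (r : R) := (c + eta * r) * expR (k * r).

Lemma gbound_gt0 r : 0 <= r -> 0 < gbound r.
Proof. by move=> r0; rewrite mulr_gt0 ?expR_gt0// ltr_pwDl// mulr_ge0. Qed.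

Lemma gbound_step (q r : R) : 0 <= r <= q ->
  gbound r + (k * gbound r + eta) * (q - r) <= gbound q.
Proof.
move=> /andP[r0 rq]; have qr : 0 <= q - r by rewrite subr_ge0.
have qE : gbound q = (gbound r + eta * (q - r) * expR (k * r)) * expR (k * (q - r)).
  rewrite /gbound (_ : expR (k * q) = expR (k * r) * expR (k * (q - r))).
    by ring.
  by rewrite -expRD; congr expR; ring.
rewrite qE.
have g0 := gbound_gt0 r r0.
have e1 : 1 <= expR (k * r) by rewrite -expR0 ler_expR mulr_ge0.
have e2 := expR_ge1Dx (k * (q - r)).
have h1 : gbound r + eta * (q - r) <= gbound r + eta * (q - r) * expR (k * r).
  by rewrite lerD2l ler_peMr// mulr_ge0.
have h2 : 0 <= eta * (q - r) by rewrite mulr_ge0.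
have h3 : 0 <= k * (q - r) by rewrite mulr_ge0.
apply: (@le_trans _ _ ((gbound r + eta * (q - r)) * (1 + k * (q - r)))).
  have : 0 <= eta * (q - r) * (k * (q - r)) by rewrite mulr_ge0.
  lra.
by apply: ler_pM => //; lra.
Qed.

(** At a contact the strict order of the slopes keeps [d] under the barrier. Below the barrier the
    positive gap suffices: for a short time [d] grows at rate at most [|e| + 1], while the barrier
    does not decrease. *)
Lemma gbound_right d r e : 0 <= r -> right_deriv d r e ->
  d r <= gbound r -> (d r = gbound r -> e < k * gbound r + eta) ->
  exists2 h, 0 < h & forall q, r < q < r + h -> d q <= gbound q.
Proof.
move=> r0 hd; rewrite le_eqVlt => /orP[/eqP dE|dlt] he.
  have e0 : 0 < k * gbound r + eta - e by rewrite subr_gt0 he.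
  have [h h0 hh] := hd _ e0; exists h => // q /[dup] /andP[rq _] /hh.
  move=> /ler_normlP[_ h1].
  have := gbound_step q r; rewrite r0 ltW// => /(_ isT); rewrite dE in h1; lra.
have g0 : 0 < gbound r - d r by rewrite subr_gt0.
have [h h0 hh] := hd _ ltr01.
have a0 : 0 < `|e| + 1 by rewrite ltr_pwDr.
exists (Num.min h ((gbound r - d r) / (`|e| + 1))).
  by rewrite lt_min h0 divr_gt0.
move=> q /andP[rq qh].
have qr : 0 <= q - r by rewrite subr_ge0 ltW.
have := hh q; rewrite rq (lt_le_trans qh)/=; last by rewrite lerD2l ge_min lexx.
move=> /(_ isT) /ler_normlP[_ h1].
have h2 : (`|e| + 1) * (q - r) <= gbound r - d r.
  rewrite mulrC -ler_pdivlMr// lerBlDl (le_trans (ltW qh))// lerD2l.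
  by rewrite ge_min lexx orbT.
have := ler_wpM2r qr (ler_norm e).
have := gbound_step q r; rewrite r0 ltW// => /(_ isT).
have : 0 <= (k * gbound r + eta) * (q - r).
  by rewrite mulr_ge0// addr_ge0// mulr_ge0// ltW// gbound_gt0.
lra.
Qed.

Lemma left_cont_gbound r : left_cont gbound r.
Proof.
have cM (a : R) : a * s @[s --> r^'-] --> a * r.
  by apply: cvgM; [exact: cvg_cst|exact: cvg_at_left_filter cvg_id].
apply: cvgM; first by apply: cvgD; [exact: cvg_cst|exact: cM].
by apply: (cvg_comp _ _ (cM k)); exact: continuous_expR.
Qed.

End growth_bound.

(** A one-sided Gronwall inequality. At a contact with the positive barrier the bound on the product
    can be divided by the distance of [y1 r] and [y2 r], which bounds the slope of whichever of
    [y1 - y2] and [y2 - y1] touches the barrier. *)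
Lemma right_deriv_comparison y1 y2 (e1 e2 : R -> R) (t L eta : R) :
  0 <= t -> 0 <= L -> 0 <= eta ->
  (forall r, 0 <= r < t -> right_deriv y1 r (e1 r) /\ right_deriv y2 r (e2 r)) ->
  (forall r, 0 < r <= t -> left_cont y1 r /\ left_cont y2 r) ->
  (forall r, 0 <= r < t -> (y1 r - y2 r) * (e1 r - e2 r) <=
     L * `|y1 r - y2 r| ^+ 2 + eta * `|y1 r - y2 r|) ->
  `|y1 t - y2 t| <= (`|y1 0 - y2 0| + eta * t) * expR (L * t).
Proof.
move=> t0 L0 eta0 hd hc hm; apply/ler_addgt0Pr => eps eps0.
have E0 : 0 < expR (L * t) by exact: expR_gt0.
(* Raising both the initial value and [eta] by [dl] makes the barrier positive and the slopes
   strictly ordered. It costs [dl * (t + 1) * expR (L * t)], which equals [eps]. *)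
pose dl := eps / ((t + 1) * expR (L * t)).
have dl0 : 0 < dl by rewrite divr_gt0// mulr_gt0// ltr_pwDr.
pose c := `|y1 0 - y2 0| + dl.
have c0 : 0 < c by rewrite ltr_pwDr.
have eta'0 : 0 <= eta + dl by rewrite addr_ge0// ltW.
suff : `|y1 t - y2 t| <= gbound c L (eta + dl) t.
  move=> h; apply: le_trans h _; rewrite /gbound /c le_eqVlt; apply/orP; left.
  apply/eqP; rewrite /dl; field.
  by rewrite !gt_eqF// ltr_pwDr.
have right r (s : R) : 0 <= r -> 0 <= s -> s = `|y1 r - y2 r| -> s = gbound c L (eta + dl) r ->
    forall e, s * e <= L * s ^+ 2 + eta * s -> e < L * s + (eta + dl).
  move=> r0 s0 sE sb e he.
  have s1 : 0 < s by rewrite sb gbound_gt0.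
  have : e <= L * s + eta.
    by rewrite -(ler_pM2l s1); apply: le_trans he _; rewrite le_eqVlt; apply/orP; left; apply/eqP; ring.
  lra.
apply: (real_induction t (fun r => `|y1 r - y2 r| <= gbound c L (eta + dl) r)).
- by rewrite /gbound !mulr0 addr0 expR0 mulr1 lerDl ltW.
- move=> r /[dup] rt /andP[r0 _] /ler_normlP[Pn Pp].
  have [h1 h2] := hd r rt.
  have h12 := right_derivB _ _ _ _ _ h1 h2.
  have h21 := right_derivN _ _ _ h12.
  have hmr := hm r rt.
  have [|ha a0 Ha] := gbound_right _ _ _ c0 L0 eta'0 _ _ _ r0 h12 Pp.
    move=> E; rewrite -E.
    have dpos : 0 <= y1 r - y2 r by rewrite E ltW// gbound_gt0.
    apply: (right r) => //; first by rewrite ger0_norm.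
    by move: hmr; rewrite (ger0_norm dpos).
  have [|hb b0 Hb] := gbound_right _ _ _ c0 L0 eta'0 _ _ _ r0 h21 Pn.
    move=> E; rewrite -E.
    have dpos : 0 <= - (y1 r - y2 r) by rewrite E ltW// gbound_gt0.
    have nE : `|y1 r - y2 r| = - (y1 r - y2 r) by rewrite -normrN ger0_norm.
    by apply: (right r) => //; move: hmr; rewrite nE mulrNN.
  exists (Num.min ha hb); first by rewrite lt_min a0.
  move=> q /andP[rq qh] _.
  have qa : q < r + ha by rewrite (lt_le_trans qh)// lerD2l ge_min lexx.
  have qb : q < r + hb by rewrite (lt_le_trans qh)// lerD2l ge_min lexx orbT.
  by apply/ler_normlP; split; [apply: Hb|apply: Ha]; rewrite rq.
- move=> r /[dup] rt /andP[r0 _] Pq.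
  have := @left_le (fun r => `|y1 r - y2 r| - gbound c L (eta + dl) r) 0 r r0.
  rewrite subr_le0; apply; last by move=> s /Pq; rewrite subr_le0.
  apply: cvgB; last exact: left_cont_gbound.
  by apply: cvg_norm; have [] := hc r rt; exact: cvgB.
by rewrite lexx t0.
Qed.

End real_curves.

(** * Local existence for a scalar velocity *)

Section local_existence.
Context {R : realType}.

Lemma exists_primitive (f : R -> R) (a b : R) : continuous f -> a < b ->
  exists G : R -> R, forall x, a < x < b -> is_derive x 1 G (f x).
Proof.
move=> cf ab; exists (fun x => \int[lebesgue_measure]_(t in `[a, x]) f t).
move=> x /andP[ax xb].
have intf : lebesgue_measure.-integrable `[a, b] (EFin \o f).
  apply: continuous_compact_integrable; first exact: segment_compact.
  exact: continuous_subspaceT.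
have [h1 h2] := continuous_FTC1_closed xb intf ax (cf x).
by split; [exact: h1|rewrite -derive1E; exact: h2].
Qed.

Lemma is_derive_MVT (G g : R -> R) (a b : R) : a <= b ->
  (forall x, a <= x <= b -> is_derive x 1 G (g x)) ->
  exists2 c, a <= c <= b & G b - G a = g c * (b - a).
Proof.
rewrite le_eqVlt => /orP[/eqP <- _|ab hG].
  by exists a; rewrite ?lexx// !subrr mulr0.
have [| |c] := @MVT _ G g a b ab.
- by move=> x; rewrite in_itv/= => /andP[h1 h2]; apply: hG; rewrite !ltW.
- apply: derivable_within_continuous => x; rewrite in_itv/= => h.
  by have [] := hG x h.
by rewrite in_itv/= => /andP[h1 h2] E; exists c => //; rewrite !ltW.
Qed.

(* The solution is the inverse of a primitive of 1 / W. *)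
Lemma scalar_ode (W : R -> R) (L c p p1 : R) : 0 < c -> p < p1 ->
  (forall y z, `|W y - W z| <= L * `|y - z|) -> (forall y, c <= W y) ->
  exists h X, [/\ 0 < h, X 0 = p, forall t, 0 <= t <= h -> p <= X t <= p1 &
    forall t u, 0 <= t -> t <= u -> u <= h ->
      exists2 xi, X t <= xi <= X u & X u - X t = W xi * (u - t)].
Proof.
move=> c0 pp1 WL Wc.
have W0 y : 0 < W y := lt_le_trans c0 (Wc y).
have cf : continuous (fun y => (W y)^-1).
  move=> y; apply: continuousV; first by rewrite gt_eqF.
  exact: (continuous_lip _ _ WL).
(* A margin of 1 on both sides puts [p] and [p1] in the interior, where the primitive is
   differentiable. *)
have ab : p - 1 < p1 + 1 by lra.
have [G hG] := exists_primitive _ _ _ cf ab.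
have dG x : p <= x <= p1 -> is_derive x 1 G (W x)^-1.
  by move=> /andP[h1 h2]; apply: hG; lra.
have mvt a b : p <= a -> a <= b -> b <= p1 ->
    exists2 xi, a <= xi <= b & b - a = W xi * (G b - G a).
  move=> pa ab' bp.
  have [x /andP[ax xb]|xi hxi E] := is_derive_MVT G (fun x => (W x)^-1) a b ab'.
    by apply: dG; lra.
  by exists xi => //; rewrite E mulrA divff ?mul1r// gt_eqF.
(* The time needed to travel from [p] to [p1]. *)
pose h := G p1 - G p.
have h0 : 0 < h.
  have [xi _ E] := mvt p p1 (lexx _) (ltW pp1) (lexx _).
  by rewrite -(pmulr_rgt0 _ (W0 xi)) /h -E subr_gt0.
have ivt t : 0 <= t <= h -> exists x, p <= x <= p1 /\ G x = G p + t.
  move=> /andP[t0 th].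
  have [| |x] := @IVT _ G p p1 (G p + t) (ltW pp1).
  - apply: derivable_within_continuous => x; rewrite in_itv/= => hx.
    by have [] := dG x hx.
  - rewrite min_l ?max_r; rewrite /h in h0 th *; lra.
  by rewrite in_itv/= => hx E; exists x.
pose X t := if pselect (0 <= t <= h) is left e then sval (cid (ivt t e)) else p.
have XP t : 0 <= t <= h -> p <= X t <= p1 /\ G (X t) = G p + t.
  by move=> ht; rewrite /X; case: pselect => // e; case: cid.
have Xmono t u : 0 <= t -> t <= u -> u <= h -> X t <= X u.
  move=> t0 tu uh; rewrite leNgt; apply/negP => lt.
  have [|/andP[a1 a2] a3] := XP t; first by rewrite t0 (le_trans tu).
  have [|/andP[b1 b2] b3] := XP u; first by rewrite uh (le_trans t0).
  have [xi _ E] := mvt (X u) (X t) b1 (ltW lt) a2.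
  have : 0 < W xi * (G (X t) - G (X u)) by rewrite -E subr_gt0.
  by rewrite pmulr_rgt0// a3 b3; lra.
have hXt t u : 0 <= t -> t <= u -> u <= h ->
    exists2 xi, X t <= xi <= X u & X u - X t = W xi * (u - t).
  move=> t0 tu uh.
  have [|/andP[a1 a2] a3] := XP t; first by rewrite t0 (le_trans tu).
  have [|/andP[b1 b2] b3] := XP u; first by rewrite uh (le_trans t0).
  have [xi hxi E] := mvt _ _ a1 (Xmono t u t0 tu uh) b2.
  by exists xi => //; rewrite E; congr (_ * _); rewrite a3 b3; ring.
exists h, X; split => //; last by move=> t /XP[].
have [|/andP[a1 a2] a3] := XP 0; first by rewrite lexx ltW.
have [xi _ E] := mvt p (X 0) (lexx _) a1 a2.
by apply/eqP; rewrite -subr_eq0 E a3; apply/eqP; ring.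
Qed.

(* For w bounded by K and L-Lipschitz this is equivalent to the differential
   equation on the interval I (ode_solutionP), but it visibly survives unions,
   limits and concatenation of solutions. *)
Definition qsol (w : I01 R -> R) (K L : R) (I : set R) (y : R -> I01 R) :=
  forall t u, I t -> I u -> t <= u ->
    `|rval (y u) - rval (y t)| <= K * (u - t) /\
    `|rval (y u) - rval (y t) - w (y t) * (u - t)| <= L * K * (u - t) ^+ 2.

(** [scalar_ode] wants a positive velocity on the whole line. Multiplying by the sign [s] of [w p]
    makes the motion increasing, [clamp01] extends [w] beyond the interval, and the cutoff [c] keeps
    it away from 0. Up to distance [r] from [p] the cutoff is inactive: [w] varies there by at most
    [L * r <= c], and [c] is half of the initial speed. *)
Lemma local_ode (w : I01 R -> R) (K L : R) (p : I01 R) : BL_by K L w ->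
  (0 < w p /\ rval p < 1) \/ (w p < 0 /\ 0 < rval p) ->
  exists h z, [/\ 0 < h, z 0 = p & qsol w K L [set t | 0 <= t <= h] z].
Proof.
move=> [K0 L0 hK hL] hp.
pose c := `|w p| / 2.
have c0 : 0 < c by rewrite divr_gt0// normr_gt0; case: hp => -[]; lra.
pose W (s y : R) := Num.max (s * w (clamp01 (s * y))) c.
have WL s : `|s| = 1 -> forall y z, `|W s y - W s z| <= L * `|y - z|.
  move=> s1 y z; apply: (@le_trans _ _ `|s * w (clamp01 (s * y)) - s * w (clamp01 (s * z))|).
    rewrite /W; set a := s * w _; set b := s * w _.
    have := ler_norm (a - b); have := ler_norm (- (a - b)); rewrite normrN => ? ?.
    have := normr_ge0 (a - b) => ?.
    by rewrite ler_norml; case: (leP a c) => ?; case: (leP b c) => ?; lra.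
  rewrite -mulrBr normrM s1 mul1r (le_trans (hL _ _))// ler_wpM2l//.
  by rewrite (le_trans (clamp01_lip _ _))// -mulrBr normrM s1 mul1r.
have Wc s y : c <= W s y by rewrite /W le_max lexx orbT.
have [/andP[p0 p1]] : 0 <= rval p <= 1 := rval_itv p.
have L1 : 0 < L + 1 by lra.
pose r := c / (L + 1).
have r0 : 0 < r by rewrite divr_gt0.
have Lr : L * r <= c by rewrite /r mulrA ler_pdivrMr// ; nra.
have near s (y : R) : `|s| = 1 -> `|w p| = s * w p -> `|s * y - rval p| <= r -> 0 <= s * y <= 1 ->
    W s y = s * w (clamp01 (s * y)).
  move=> s1 sw yr y01; rewrite /W max_l//.
  have := hL (clamp01 (s * y)) p; rewrite clamp01_id// => h.
  have h2 : `|w (clamp01 (s * y)) - w p| <= c.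
    by apply: (le_trans h); apply: le_trans Lr; rewrite ler_wpM2l.
  have h3 : `|s * w (clamp01 (s * y)) - s * w p| <= c by rewrite -mulrBr normrM s1 mul1r.
  move/ler_normlP : h3 => [h3 h4]; rewrite -sw in h3 h4; rewrite /c in h3 h4 *; lra.
suff main s q : `|s| = 1 -> `|w p| = s * w p -> s * rval p < q -> q <= s * rval p + r ->
    (forall y, s * rval p <= y <= q -> 0 <= s * y <= 1) ->
    exists h z, [/\ 0 < h, z 0 = p & qsol w K L [set t | 0 <= t <= h] z].
  case: hp => -[wp pp].
    apply: (main 1 (Num.min 1 (rval p + r))); rewrite ?mul1r ?normr1//.
    - by rewrite gtr0_norm.
    - by rewrite lt_min pp ltrDl.
    - by rewrite ge_min lexx orbT.
    move=> y /andP[y1]; rewrite le_min => /andP[y2 _]; rewrite mul1r; lra.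
  apply: (main (-1) (Num.min 0 (- rval p + r))); rewrite ?mulN1r ?normrN ?normr1//.
  - by rewrite ltr0_norm.
  - by rewrite lt_min ltrDl r0 andbT oppr_lt0.
  - by rewrite ge_min lexx orbT.
  move=> y /andP[y1]; rewrite le_min => /andP[y2 _]; rewrite mulN1r; lra.
move=> s1 sw pq qr hq.
have ss : s * s = 1.
  by rewrite -expr2 -(real_normK (num_real s)) s1 expr1n.
have [h [X [h0 X0 Xr Xd]]] := scalar_ode (W s) L c _ _ c0 pq (WL s s1) (Wc s).
have XW t : 0 <= t <= h -> forall y, s * rval p <= y <= X t -> W s y = s * w (clamp01 (s * y)).
  move=> th y /andP[y1 y2]; have /andP[x1 x2] := Xr t th.
  apply: near => //; last by apply: hq; lra.
  rewrite (_ : s * y - rval p = s * (y - s * rval p)); last by rewrite mulrBr mulrA ss mul1r.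
  rewrite normrM s1 mul1r ger0_norm; lra.
exists h, (fun t => clamp01 (s * X t)); split => //.
  by rewrite X0 mulrA ss mul1r clamp01K.
move=> t u /andP[t0 th] /andP[u0 uh] tu.
have zE v : 0 <= v <= h -> rval (clamp01 (s * X v)) = s * X v.
  by move=> hv; rewrite clamp01_id//; apply: hq; exact: Xr.
rewrite !zE ?t0 ?u0//.
have [xi /andP[x1 x2] E] := Xd t u t0 tu uh.
have ut : 0 <= u - t by rewrite subr_ge0.
have /andP[tl _] : s * rval p <= X t <= q by apply: Xr; rewrite t0.
have /andP[ul uq] : s * rval p <= X u <= q by apply: Xr; rewrite u0.
have Wxi := XW u _ xi; rewrite Wxi ?u0// in E; last by rewrite (le_trans tl).
have XE : s * X u - s * X t = w (clamp01 (s * xi)) * (u - t).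
  by rewrite -mulrBr E !mulrA ss mul1r.
have hK1 : `|s * X u - s * X t| <= K * (u - t).
  by rewrite XE normrM (ger0_norm ut) ler_wpM2r.
split=> //.
rewrite XE -mulrBl normrM (ger0_norm ut) expr2 mulrA ler_wpM2r//.
rewrite (le_trans (hL _ _))// -mulrA ler_wpM2l// (le_trans _ hK1)//.
rewrite (le_trans (clamp01_lip _ _))// -!mulrBr !normrM s1 !mul1r.
rewrite (ger0_norm (_ : 0 <= xi - X t)) ?subr_ge0//.
by rewrite ger0_norm ?subr_ge0 ?(le_trans x1 x2)// lerB.
Qed.

End local_existence.

(** * The differential equation as an estimate on increments *)

Section maximal_solutions.
Context {R : realType}.
Variables (w : I01 R -> R) (K L : R).
Hypothesis hw : BL_by K L w.
Implicit Types (I J : set R) (y z : R -> I01 R) (p : I01 R).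

Let K0 : 0 <= K. Proof. by have [] := hw. Qed.
Let L0 : 0 <= L. Proof. by have [] := hw. Qed.
Let wK : bounded_by K w. Proof. by have [] := hw. Qed.
Let wL : lip_by L w. Proof. by have [] := hw. Qed.
Let LK0 : 0 <= L * K. Proof. exact: mulr_ge0. Qed.

Lemma ode_deriv_eps I y t :
  (rval (y s) - rval (y t)) / (s - t) @[s --> within I t^'] --> w (y t) ->
  forall eps : R, 0 < eps -> exists2 h : R, 0 < h & forall s, I s -> `|s - t| < h ->
    `|rval (y s) - rval (y t) - w (y t) * (s - t)| <= eps * `|s - t|.
Proof.
move=> /cvgrPdist_le hy eps /hy /nbhs_ballP[h h0 hh]; exists h => // s Is st.
have [->|nst] := eqVneq s t; first by rewrite !subrr mulr0 subr0 !normr0 mulr0.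
have := hh s; rewrite /ball/= distrC => /(_ st nst Is) /= h1.
have st0 : s - t != 0 by rewrite subr_eq0.
rewrite (_ : _ - _ = - ((w (y t) - (rval (y s) - rval (y t)) / (s - t)) * (s - t))).
  by rewrite normrN normrM ler_wpM2r.
by field.
Qed.

Lemma left_cont_lip (g : R -> R) (c t : R) : 0 < t ->
  (forall s, 0 <= s < t -> `|g t - g s| <= c * (t - s)) -> left_cont g t.
Proof.
move=> t0 hg; apply/cvgrPdist_le => eps eps0.
have c1 : 0 < `|c| + 1 by rewrite ltr_pwDr.
near=> s.
have st : s < t by near: s; exact: nbhs_left_lt.
have s0 : 0 <= s by near: s; exact: nbhs_left_ge.
rewrite (le_trans (hg s _)) ?s0//.
apply: (@le_trans _ _ ((`|c| + 1) * (t - s))).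
  by apply: ler_wpM2r; [rewrite subr_ge0 ltW|have := ler_norm c; lra].
rewrite mulrC -ler_pdivlMr// lerBlDr -lerBlDl.
by near: s; apply: nbhs_left_ge; rewrite ltrBlDl ltrDr divr_gt0.
Unshelve. all: by end_near. Qed.

(** [right_deriv_bound] acts twice on the curve shifted to start at time 0. With centre 0 it bounds
    the displacement by [K] times the elapsed time, hence the variation of the velocity by [L * K]
    times that time; with centre [w (y t)] it then gives the quadratic error. *)
Lemma ode_qsol I y : is_interval I ->
  (forall t, I t ->
     (rval (y s) - rval (y t)) / (s - t) @[s --> within I t^'] --> w (y t)) ->
  qsol w K L I y.
Proof.
move=> iI hy t u It Iu tu.
have sub r : 0 <= r <= u - t -> I (t + r).
  by move=> /andP[r0 ru]; apply: (iI _ _ It Iu); lra.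
have eps r : 0 <= r <= u - t -> forall e : R, 0 < e -> exists2 h : R, 0 < h &
    forall q, 0 <= q <= u - t -> `|q - r| < h ->
    `|rval (y (t + q)) - rval (y (t + r)) - w (y (t + r)) * (q - r)| <= e * `|q - r|.
  move=> hr e /(ode_deriv_eps _ _ _ (hy _ (sub r hr)))[h h0 hh].
  exists h => // q hq qr.
  have E : t + q - (t + r) = q - r by ring.
  by have := hh _ (sub q hq); rewrite E; apply.
have rd r : 0 <= r < u - t -> right_deriv (fun q => rval (y (t + q))) r (w (y (t + r))).
  move=> /andP[r0 ru] e /(eps r _)[|h h0 hh]; first by rewrite r0 ltW.
  exists (Num.min h (u - t - r)); first by rewrite lt_min h0 subr_gt0.
  move=> q /andP[rq]; rewrite -ltrBlDl lt_min => /andP[qh qu].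
  have qr0 : 0 <= q - r by lra.
  by have := hh q; rewrite (ger0_norm qr0); apply; lra.
have lc r : 0 < r <= u - t -> left_cont (fun q => rval (y (t + q))) r.
  move=> /andP[r0 ru]; have [|h h0 hh] := eps r _ _ ltr01; first by rewrite ru ltW.
  apply/cvgrPdist_le => e e0; near=> q.
  have qr : q < r by near: q; exact: nbhs_left_lt.
  have q0 : 0 <= q by near: q; exact: nbhs_left_ge.
  have nE : `|q - r| = r - q by rewrite distrC gtr0_norm ?subr_gt0.
  have := hh q; rewrite nE => h1.
  have {}h1 : `|rval (y (t + q)) - rval (y (t + r)) - w (y (t + r)) * (q - r)| <= r - q.
    rewrite -[leRHS]mul1r; apply: h1; first lra.
    rewrite ltrBlDr -ltrBlDl.
    by near: q; apply: nbhs_left_gt; rewrite ltrBlDl ltrDr.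
  have h2 : `|w (y (t + r)) * (q - r)| <= K * (r - q).
    by rewrite normrM nE ler_wpM2r// subr_ge0 ltW.
  rewrite distrC.
  rewrite (_ : rval _ - _ = (rval (y (t + q)) - rval (y (t + r)) -
    w (y (t + r)) * (q - r)) + w (y (t + r)) * (q - r)); last by ring.
  rewrite (le_trans (ler_normD _ _))// (le_trans (lerD h1 h2))//.
  rewrite (_ : _ + _ = (K + 1) * (r - q)); last by ring.
  rewrite mulrC -ler_pdivlMr ?ltr_pwDr// lerBlDr -lerBlDl.
  by near: q; apply: nbhs_left_ge; rewrite ltrBlDl ltrDr divr_gt0// ltr_pwDr.
have K1 r : 0 <= r <= u - t -> `|rval (y (t + r)) - rval (y t)| <= K * r.
  move=> /andP[r0 ru].
  have := @right_deriv_bound _ (fun q => rval (y (t + q))) r 0 K r0.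
  rewrite addr0 mul0r subr0; apply.
    move=> q /andP[q0 qr]; exists (w (y (t + q))); first by rewrite subr0.
    by apply: rd; lra.
  by move=> q /andP[q0 qr]; apply: lc; lra.
have ut0 : 0 <= u - t by rewrite subr_ge0.
have utE : t + (u - t) = u by ring.
split; first by have := K1 (u - t); rewrite utE ut0 lexx => /(_ isT).
have := @right_deriv_bound _ (fun q => rval (y (t + q))) (u - t) (w (y t)) (L * K * (u - t)) ut0.
rewrite addr0 utE expr2 mulrA; apply => r hr; last exact: lc.
exists (w (y (t + r))); last exact: rd.
have /andP[r0 ru] := hr.
rewrite (le_trans (wL _ _))// -mulrA ler_wpM2l// (le_trans (K1 r _))//; first by rewrite r0 ltW.
by rewrite ler_wpM2l// ltW.
Unshelve. all: by end_near. Qed.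

(** For [s] before [t] the estimate is based at [y s]; exchanging [w (y s)] for [w (y t)] costs a
    second [L * K * (s - t) ^+ 2], whence the factor 2. *)
Lemma qsol_two_sided I y t s : qsol w K L I y -> I t -> I s ->
  `|rval (y s) - rval (y t) - w (y t) * (s - t)| <= 2 * (L * K) * (s - t) ^+ 2.
Proof.
move=> q It Is; have sq : 0 <= (s - t) ^+ 2 by rewrite sqr_ge0.
have := mulr_ge0 LK0 sq => h0.
have [ts|/ltW st] := leP t s; first by have [_] := q _ _ It Is ts; lra.
have [h1 h2] := q _ _ Is It st.
rewrite (_ : _ - _ = - (rval (y t) - rval (y s) - w (y s) * (t - s)) +
  (w (y t) - w (y s)) * (t - s)); last by ring.
have h3 : `|(w (y t) - w (y s)) * (t - s)| <= L * K * (t - s) ^+ 2.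
  rewrite normrM (ger0_norm (_ : 0 <= t - s)) ?subr_ge0// expr2 mulrA ler_wpM2r ?subr_ge0//.
  by rewrite (le_trans (wL _ _))// -mulrA ler_wpM2l.
have E : (t - s) ^+ 2 = (s - t) ^+ 2 by ring.
rewrite E in h2 h3; rewrite (le_trans (ler_normD _ _))// normrN; lra.
Qed.

Lemma qsol_ode I y : qsol w K L I y -> forall t, I t ->
  (rval (y s) - rval (y t)) / (s - t) @[s --> within I t^'] --> w (y t).
Proof.
move=> q t It; apply/cvgrPdist_le => eps eps0.
have c0 : 0 < 2 * (L * K) + 1 by rewrite ltr_pwDr// mulr_ge0.
apply/nbhs_ballP; exists (eps / (2 * (L * K) + 1)); first exact: divr_gt0.
move=> s; rewrite /ball/= distrC => st nst Is.
have st0 : s - t != 0 by rewrite subr_eq0.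
have nst0 : 0 < `|s - t| by rewrite normr_gt0.
rewrite -(ler_pM2r nst0) -normrM.
rewrite (_ : (_ - _) * _ = - (rval (y s) - rval (y t) - w (y t) * (s - t)));
  last by field.
rewrite normrN.
apply: le_trans (qsol_two_sided _ _ _ _ q It Is) _.
rewrite -(real_normK (num_real (s - t))) expr2 (mulrA (2 * (L * K))) ler_wpM2r//.
have := ltW st; rewrite ler_pdivlMr// => h; apply: le_trans h.
by rewrite mulrC ler_wpM2l// lerDl.
Qed.

Lemma qsol_right_deriv I y t t' : is_interval I -> qsol w K L I y ->
  I t -> I t' -> t < t' -> right_deriv (fun s => rval (y s)) t (w (y t)).
Proof.
move=> iI q It It' tt' eps eps0.
have c0 : 0 < L * K + 1 by rewrite ltr_pwDr.
exists (Num.min (t' - t) (eps / (L * K + 1))).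
  by rewrite lt_min subr_gt0 tt' divr_gt0.
move=> s /andP[ts]; rewrite -ltrBlDl lt_min => /andP[s1 s2].
have Is : I s by apply: (iI _ _ It It'); lra.
have [_ h] := q _ _ It Is (ltW ts); apply: le_trans h _.
rewrite expr2 mulrA; apply: ler_wpM2r; first by rewrite subr_ge0 ltW.
move: s2; rewrite ltr_pdivlMr// => /ltW s2; apply: le_trans s2.
by rewrite mulrC ler_wpM2l// ?subr_ge0 ?lerDl// ltW.
Qed.

Lemma qsol_left_cont I y t : is_interval I -> qsol w K L I y ->
  I 0 -> I t -> 0 < t -> left_cont (fun s => rval (y s)) t.
Proof.
move=> iI q Iz It t0; apply: (left_cont_lip _ K) => // s /andP[s0 st].
by have [] := q s t _ It (ltW st); first by apply: (iI _ _ Iz It); rewrite s0 ltW.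
Qed.

(* e is a possible speed of the stopped flow at p; where w points outwards, both
   w p and 0 are allowed. *)
Definition vel p (e : R) := e = w p \/
  (e = 0 /\ ((rval p = 1 /\ 0 <= w p) \/ (rval p = 0 /\ w p <= 0))).

End maximal_solutions.

Lemma vel_le {R : realType} (w : I01 R -> R) p e (q : I01 R) : vel w p e ->
  (rval p - rval q) * e <= (rval p - rval q) * w p.
Proof.
have /andP[q0 q1] := rval_itv q.
move=> [->//|[-> [[pE wp]|[pE wp]]]]; rewrite mulr0 pE.
  by rewrite mulr_ge0// subr_ge0.
by rewrite mulr_le0// subr_le0.
Qed.

Lemma vel_monotone {R : realType} (w1 w2 : I01 R -> R) (L eta : R) p1 p2 e1 e2 :
  lip_by L w1 -> (forall x, `|w1 x - w2 x| <= eta) ->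
  vel w1 p1 e1 -> vel w2 p2 e2 ->
  (rval p1 - rval p2) * (e1 - e2) <=
    L * `|rval p1 - rval p2| ^+ 2 + eta * `|rval p1 - rval p2|.
Proof.
move=> hL heta /(vel_le _ _ _ p2) h1 /(vel_le _ _ _ p1) h2.
set d := rval p1 - rval p2 in h1 *.
have dE : rval p2 - rval p1 = - d by rewrite /d opprB.
rewrite dE !mulNr in h2.
have h3 : d * (w1 p1 - w1 p2) <= L * `|d| ^+ 2.
  rewrite (le_trans (ler_norm _))// normrM expr2 mulrCA ler_wpM2l//; exact: hL.
have h4 : d * (w1 p2 - w2 p2) <= eta * `|d|.
  by rewrite (le_trans (ler_norm _))// normrM mulrC ler_wpM2r.
lra.
Qed.

(** * Uniqueness, continuation and the end of maximal solutions *)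

Section stopped_flow.
Context {R : realType}.
Variables (w : I01 R -> R) (K L : R).
Hypothesis hw : BL_by K L w.
Implicit Types (I J : set R) (y z : R -> I01 R).

Let K0 : 0 <= K. Proof. by have [] := hw. Qed.
Let L0 : 0 <= L. Proof. by have [] := hw. Qed.
Let wK : bounded_by K w. Proof. by have [] := hw. Qed.
Let wL : lip_by L w. Proof. by have [] := hw. Qed.
Let LK0 : 0 <= L * K. Proof. exact: mulr_ge0. Qed.

Lemma ode_solutionP x0 I y : ode_solution w x0 I y <->
  [/\ is_interval I, I `<=` [set t | 0 <= t], I 0, y 0 = x0 & qsol w K L I y].
Proof.
split=> -[iI I0 Iz y0 h]; split=> //; first exact: ode_qsol hw _ _ iI h.
exact: qsol_ode hw _ _ h.
Qed.

Lemma ode_solution_uniq x0 I y J z t :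
  ode_solution w x0 I y -> ode_solution w x0 J z -> I t -> J t -> y t = z t.
Proof.
move=> /ode_solutionP[iI I0 Iz y0 hy] /ode_solutionP[iJ J0 Jz z0 hz] It Jt.
have t0 : 0 <= t := I0 _ It.
apply: rval_inj; apply/eqP; rewrite -subr_eq0 -normr_le0.
have := @right_deriv_comparison _ (fun s => rval (y s)) (fun s => rval (z s))
  (fun s => w (y s)) (fun s => w (z s)) t L 0 t0 L0 (lexx _).
rewrite y0 z0 subrr normr0 !mul0r addr0 mul0r; apply.
- move=> r /andP[r0 rt]; split.
    apply: (qsol_right_deriv _ _ _ hw _ _ _ t iI hy) => //.
    by apply: (iI _ _ Iz It); rewrite r0 ltW.
  apply: (qsol_right_deriv _ _ _ hw _ _ _ t iJ hz) => //.
  by apply: (iJ _ _ Jz Jt); rewrite r0 ltW.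
- move=> r /andP[r0 rt]; split.
    apply: (qsol_left_cont _ _ _ _ _ _ iI hy) => //.
    by apply: (iI _ _ Iz It); rewrite rt ltW.
  apply: (qsol_left_cont _ _ _ _ _ _ iJ hz) => //.
  by apply: (iJ _ _ Jz Jt); rewrite rt ltW.
move=> r _; apply: (vel_monotone w w) => // [x||]; last 2 first.
- by left.
- by left.
by rewrite subrr normr0.
Qed.

(* By uniqueness the union of all solutions is a solution. *)
Lemma maximal_solution_exists x0 :
  exists p : set R * (R -> I01 R), maximal_solution w x0 p.1 p.2.
Proof.
pose J : set R := [set t | exists I y, ode_solution w x0 I y /\ I t].
pose g t := if pselect (exists v, exists I y, ode_solution w x0 I y /\ I t /\ y t = v)
  is left e then sval (cid e) else x0.
have gE I y t : ode_solution w x0 I y -> I t -> g t = y t.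
  move=> hy It; rewrite /g; case: pselect => [e|ne].
    case: cid => v [I' [y' [hy' [It' vE]]]] /=; rewrite -vE.
    exact: ode_solution_uniq hy' hy It' It.
  by case: ne; exists (y t), I, y.
have triv : ode_solution w x0 [set 0] (fun=> x0).
  apply/ode_solutionP; split => //.
  - move=> a b /= -> -> c /andP[c1 c2].
    by apply/eqP; rewrite eq_le c1 c2.
  - by move=> t /= ->.
  - by move=> t u -> -> _; rewrite !subrr !mulr0 ?subrr ?subr0 !normr0 expr2 !mulr0.
exists (J, g); split.
  apply/ode_solutionP; split.
  - move=> a b [Ia [ya [ha Iaa]]] [Ib [yb [hb Ibb]]] c /andP[ac cb].
    exists Ib, yb; split => //.
    have /ode_solutionP[iI I0 Iz _ _] := hb.
    have /ode_solutionP[_ I0' _ _ _] := ha.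
    by apply: (iI _ _ Iz Ibb); rewrite cb (le_trans (I0' _ Iaa)).
  - by move=> t [I [y [/ode_solutionP[_ I0 _ _ _] It]]]; exact: I0.
  - by exists [set 0], (fun=> x0).
  - exact: gE triv (erefl _).
  - move=> t u [It [yt [ht Itt]]] [Iu [yu [hu Iuu]]] tu.
    have /ode_solutionP[iI _ Iz _ hq] := hu.
    have /ode_solutionP[_ I0' _ _ _] := ht.
    have Iut : Iu t by apply: (iI _ _ Iz Iuu); rewrite tu (I0' _ Itt).
    rewrite /= (gE _ _ _ hu Iut) (gE _ _ _ hu Iuu); exact: hq.
by move=> I y hy _ _ t It; exists I, y.
Qed.

Lemma max_sol_maximal x0 : maximal_solution w x0 (max_sol w x0).1 (max_sol w x0).2.
Proof.
rewrite /max_sol /choose_or; case: pselect => [e|ne]; last first.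
  by case: ne; exact: maximal_solution_exists.
exact: svalP (cid e).
Qed.

(** Across the junction [w (y a)] stands in for [w (y t)], an error of at most
    [L * K * ((t - a) * (b - t))]. The cross term of [(b - a) ^+ 2] is twice this product and has
    room for it, so the constants of [qsol] survive gluing. *)
Lemma qsol_glue x0 I y t h z : ode_solution w x0 I y -> I t ->
  (forall s, I s -> s <= t) -> 0 < h -> z 0 = y t ->
  qsol w K L [set s | 0 <= s <= h] z ->
  ode_solution w x0 [set s | 0 <= s <= t + h]
    (fun s => if s <= t then y s else z (s - t)).
Proof.
move=> /ode_solutionP[iI I0 Iz y0 hy] It Imax h0 z0 hz.
have t0 : 0 <= t := I0 _ It.
have Is s : 0 <= s <= t -> I s by move=> hs; exact: (iI _ _ Iz It).
apply/ode_solutionP; split.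
- by move=> a b /= /andP[a0 _] /andP[_ bt] c /andP[ac cb]; rewrite (le_trans a0)//= (le_trans cb).
- by move=> s /= /andP[].
- by rewrite /= lexx /=; lra.
- by rewrite t0.
move=> a b /= /andP[a0 ath] /andP[b0 bth] ab.
have [bt|tb] := leP b t.
  rewrite (le_trans ab bt); apply: hy => //; apply: Is; rewrite ?b0// a0.
  exact: le_trans bt.
have [at_|ta] := leP a t; last first.
  have [|||h1 h2] := hz (a - t) (b - t); rewrite /=; [lra|lra|lra|].
  by move: h1 h2; rewrite (_ : b - t - (a - t) = b - a)//; ring.
have [|||h1 h2] := hy a t; [by apply: Is; rewrite a0|by []|by []|].
have [|||h3 h4] := hz 0 (b - t); rewrite /=; [lra|lra|lra|].
rewrite z0 subr0 in h3 h4.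
have E1 : rval (z (b - t)) - rval (y a) =
  (rval (z (b - t)) - rval (y t)) + (rval (y t) - rval (y a)) by ring.
split.
  by rewrite E1 (le_trans (ler_normD _ _))//; lra.
have E2 : rval (z (b - t)) - rval (y a) - w (y a) * (b - a) =
  (rval (z (b - t)) - rval (y t) - w (y t) * (b - t)) +
  (rval (y t) - rval (y a) - w (y a) * (t - a)) +
  (w (y t) - w (y a)) * (b - t) by ring.
have bt0 : 0 <= b - t by lra.
have h5 : `|(w (y t) - w (y a)) * (b - t)| <= L * K * ((t - a) * (b - t)).
  rewrite normrM (ger0_norm bt0) mulrA ler_wpM2r//.
  by rewrite (le_trans (wL _ _))// -mulrA ler_wpM2l.
have h6 : 0 <= L * K * ((t - a) * (b - t)).
  by rewrite mulr_ge0// mulr_ge0// subr_ge0.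
rewrite E2 (le_trans (ler_normD _ _))// (le_trans (lerD (ler_normD _ _) (lexx _)))//.
rewrite (_ : (b - a) ^+ 2 = (b - t) ^+ 2 + (t - a) ^+ 2 + 2 * ((t - a) * (b - t))); last by ring.
lra.
Qed.

(** Where the velocity is nonzero and leaves room to move, [local_ode] and [qsol_glue] would
    continue the solution past [t]. If the velocity vanishes, 0 is the speed itself; if it points
    outwards at an endpoint, 0 is the other speed allowed by [vel]. *)
Lemma maximal_stuck x0 I y t : maximal_solution w x0 I y -> I t ->
  (forall s, I s -> s <= t) -> vel w (y t) 0.
Proof.
move=> [hy hmax] It Imax.
have /ode_solutionP[iI I0 Iz y0 hq] := hy.
have t0 : 0 <= t := I0 _ It.
have [p0 p1] := andP (rval_itv (y t)).
apply: contrapT => nvel.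
have hp : (0 < w (y t) /\ rval (y t) < 1) \/ (w (y t) < 0 /\ 0 < rval (y t)).
  have [wn|wp|w0] := ltgtP (w (y t)) 0; last by case: nvel; left.
    right; split=> //; rewrite lt_neqAle p0 andbT; apply/eqP => pE.
    by apply: nvel; right; split => //; right; rewrite ltW.
  left; split=> //; rewrite lt_neqAle p1 andbT; apply/eqP => pE.
  by apply: nvel; right; split => //; left; rewrite ltW.
have [h [z [h0 z0 hz]]] := local_ode _ _ _ _ hw hp.
have glue := qsol_glue _ _ _ _ _ _ hy It Imax h0 z0 hz.
have sub : I `<=` [set s | 0 <= s <= t + h].
  by move=> s Is /=; rewrite (I0 _ Is)/=; have := Imax _ Is; lra.
have agree s : I s -> (if s <= t then y s else z (s - t)) = y s.
  by move=> Is; rewrite (Imax _ Is).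
have /Imax : I (t + h) by apply: (hmax _ _ glue sub agree) => /=; lra.
lra.
Qed.

(** A bounded interval without its supremum could be closed: the curve is Lipschitz, so it has a
    limit in $[0,1]$ there, and adding this limit gives a strictly larger solution. *)
Lemma maximal_closed x0 I y b : maximal_solution w x0 I y -> 0 <= b -> ~ I b ->
  I (sup I) /\ sup I < b.
Proof.
move=> [hy hmax] b0 nIb.
have /ode_solutionP[iI I0 Iz y0 hq] := hy.
have Ib s : I s -> s < b.
  move=> Is; rewrite ltNge; apply/negP => bs; apply: nIb.
  by apply: (iI _ _ Iz Is); rewrite b0.
have I_ub : has_ubound I by exists b => s /Ib /ltW.
have I_sup : has_sup I by split => //; exists 0.
suff It : I (sup I) by split => //; exact: Ib.
set t := sup I; apply: contrapT => nIt.
have t0 : 0 <= t by exact: ub_le_sup.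
have tpos : 0 < t.
  by rewrite lt_neqAle t0 andbT; apply/eqP => tE; apply: nIt; rewrite -tE.
have Ilt s : I s -> s < t.
  move=> Is; rewrite lt_neqAle (ub_le_sup I_ub Is) andbT.
  by apply/eqP => sE; apply: nIt; rewrite -sE.
have Is s : 0 <= s < t -> I s.
  move=> /andP[s0 st]; have [u Iu su] := sup_gt I_sup.1 st.
  by apply: (iI _ _ Iz Iu); rewrite s0 ltW.
(* [rval (y s) + K * s] is nondecreasing in [s], so its limit at [t] is a supremum, and [p] is the
   limit of the curve. *)
pose V := [set rval (y s) + K * s | s in I].
pose p := sup V - K * t.
have V_sup : has_sup V.
  split; first by exists (rval (y 0) + K * 0); exists 0.
  exists (1 + K * t) => _ [s /[dup] Is' /Ilt st <-].
  have /andP[_ y1] := rval_itv (y s); rewrite lerD// ler_wpM2l//; exact: ltW.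
have pub s : I s -> `|p - rval (y s)| <= K * (t - s).
  move=> Is'; have st := Ilt _ Is'.
  have h1 : rval (y s) + K * s <= sup V.
    by apply: ub_le_sup; [exact: V_sup.2|exists s].
  have h2 : sup V <= rval (y s) - K * s + 2 * (K * t).
    apply: ge_sup; first exact: V_sup.1.
    move=> _ [r Ir <-]; have rt := Ilt _ Ir.
    have Krt : K * r <= K * t by rewrite ler_wpM2l// ltW.
    have Kst : K * s <= K * t by rewrite ler_wpM2l// ltW.
    have [sr|/ltW rs] := leP s r.
      have [/ler_normlP[_ h] _] := hq _ _ Is' Ir sr; lra.
    have [/ler_normlP[h _] _] := hq _ _ Ir Is' rs; lra.
  by rewrite ler_norml /p; lra.
have p01 : 0 <= p <= 1.
  have close (e : R) : 0 < e -> exists2 s, I s & K * (t - s) <= e.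
    move=> e0; have K1 : 0 < K + 1 by rewrite ltr_pwDr.
    have [s Is' ts] := sup_adherent (divr_gt0 e0 K1) I_sup; exists s => //.
    have st := Ilt _ Is'.
    have : t - s <= e / (K + 1) by rewrite -/t in ts; lra.
    rewrite ler_pdivlMr// => h; apply: le_trans h; rewrite mulrC ler_wpM2l//; lra.
  apply/andP; split; apply/ler_addgt0Pr => e /close[s Is' se];
    have := pub _ Is'; have /andP[y1 y2] := rval_itv (y s);
    move=> /ler_normlP[h1 h2]; lra.
pose q := clamp01 p.
have qE : rval q = p by exact: clamp01_id.
pose g s := if s < t then y s else q.
have hg : ode_solution w x0 [set s | 0 <= s <= t] g.
  apply/ode_solutionP; split.
  - by move=> a c /= /andP[a0 _] /andP[_ ct] u /andP[au uc]; rewrite (le_trans a0)//= (le_trans uc).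
  - by move=> s /= /andP[].
  - by rewrite /= lexx.
  - by rewrite /g tpos.
  move=> a c /= /andP[a0 at_] /andP[c0 ct] ac; rewrite /g.
  have [clt|tc] := ltP c t.
    by rewrite (le_lt_trans ac clt); apply: hq => //; apply: Is; rewrite ?c0// a0 (le_lt_trans ac).
  have cE : c = t by apply/eqP; rewrite eq_le ct.
  rewrite {}cE in ac *; have [alt|ta] := ltP a t; last first.
    have -> : a = t by apply/eqP; rewrite eq_le at_.
    by rewrite !subrr !mulr0 ?subrr ?subr0 !normr0 expr2 !mulr0.
  have Ia : I a by apply: Is; rewrite a0.
  rewrite qE; split; first exact: pub.
  apply/ler_addgt0Pr => e e0.
  (* The estimate is known at times [r < t]. Passing from [r] to [t] costs at most
     [2 * K * (t - r)], half for the position and half for the velocity term. *)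
  have K1 : 0 < 2 * K + 1 by rewrite ltr_pwDr// mulr_ge0.
  have [s Is' ts] := sup_adherent (divr_gt0 e0 K1) I_sup; rewrite -/t in ts.
  pose r := Num.max a s.
  have Ir : I r by rewrite /r; case: leP.
  have rt := Ilt _ Ir.
  have ar : a <= r by rewrite /r le_max lexx.
  have sr : s <= r by rewrite /r le_max lexx orbT.
  have [_ h1] := hq _ _ Ia Ir ar.
  have h2 := pub _ Ir.
  have h3 : `|w (y a) * (t - r)| <= K * (t - r).
    by rewrite normrM (ger0_norm (_ : 0 <= t - r)) ?subr_ge0 ?ler_wpM2r// ?subr_ge0 ltW.
  have h4 : (2 * K + 1) * (t - r) <= e.
    have : t - r <= e / (2 * K + 1) by lra.
    by rewrite ler_pdivlMr// mulrC.
  have h5 : L * K * (r - a) ^+ 2 <= L * K * (t - a) ^+ 2.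
    by rewrite ler_wpM2l// ler_sqr ?nnegrE; lra.
  rewrite (_ : _ - _ = (rval (y r) - rval (y a) - w (y a) * (r - a)) +
    (p - rval (y r)) - w (y a) * (t - r)); last by ring.
  rewrite (le_trans (ler_normB _ _))// (le_trans (lerD (ler_normD _ _) (lexx _)))//; lra.
have sub : I `<=` [set s | 0 <= s <= t].
  by move=> s Is' /=; rewrite (I0 _ Is')/= ltW// Ilt.
have agree s : I s -> g s = y s by move=> Is'; rewrite /g Ilt.
by apply: nIt; apply: (hmax _ _ hg sub agree) => /=; rewrite lexx andbT.
Qed.

End stopped_flow.

(** * Lipschitz estimates for the stopped flow *)

Section flow_properties.
Context {R : realType}.
Variables (K L : R).
Implicit Types (w : I01 R -> R) (y z : R -> I01 R).

(** What the comparison uses of the flow: right derivatives among the admissible speeds, and a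
    Lipschitz bound that provides left continuity. It does not refer to a maximal interval, so it
    passes to time shifts. *)
Definition stopped_curve w y :=
  (forall t, 0 <= t ->
    exists e, vel w (y t) e /\ right_deriv (fun s => rval (y s)) t e) /\
  (forall s t, 0 <= s <= t -> `|rval (y t) - rval (y s)| <= K * (t - s)).

Lemma exists_velocity w y : (forall t, 0 <= t ->
    exists e, vel w (y t) e /\ right_deriv (fun s => rval (y s)) t e) ->
  forall t, exists e, 0 <= t ->
    vel w (y t) e /\ right_deriv (fun s => rval (y s)) t e.
Proof.
move=> h t; have [/h[e he]|t0] := leP 0 t; first by exists e.
by exists 0.
Qed.

Lemma stopped_curve_compare w1 w2 y1 y2 (eta t : R) :
  BL_by K L w1 -> 0 <= eta -> (forall x, `|w1 x - w2 x| <= eta) ->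
  stopped_curve w1 y1 -> stopped_curve w2 y2 -> 0 <= t ->
  `|rval (y1 t) - rval (y2 t)| <=
    (`|rval (y1 0) - rval (y2 0)| + eta * t) * expR (L * t).
Proof.
move=> [K0 L0 _ hL] eta0 heta [h1 l1] [h2 l2] t0.
have [e1 he1] := choice (exists_velocity _ _ h1).
have [e2 he2] := choice (exists_velocity _ _ h2).
apply: (@right_deriv_comparison _ (fun s => rval (y1 s)) (fun s => rval (y2 s)) e1 e2) => //.
- by move=> r /andP[r0 _]; have [_ ?] := he1 r r0; have [_ ?] := he2 r r0.
- move=> r /andP[r0 _]; split; apply: (left_cont_lip _ K) => // s /andP[s0 sr].
    by apply: l1; rewrite s0 ltW.
  by apply: l2; rewrite s0 ltW.
move=> r /andP[r0 _]; apply: (vel_monotone w1 w2) => //.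
  by have [] := he1 r r0.
by have [] := he2 r r0.
Qed.

Lemma right_deriv_cst (f : R -> R) (t : R) : (forall s, t < s -> f s = f t) ->
  right_deriv f t 0.
Proof.
move=> h e e0; exists 1 => // s /andP[ts _].
by rewrite h// subrr mul0r subr0 normr0; apply: mulr_ge0; rewrite ?subr_ge0 ltW.
Qed.

Variable w : I01 R -> R.
Hypothesis hw : BL_by K L w.

Lemma flow_stopped_curve x0 :
  flow w 0 x0 = x0 /\ stopped_curve w (fun t => flow w t x0).
Proof.
have := max_sol_maximal _ _ _ hw x0.
rewrite /flow; case: (max_sol w x0) => J y /= hmax.
have [hy _] := hmax.
have [iJ J0 Jz y0 hq] := (ode_solutionP _ _ _ hw _ _ _).1 hy.
pose a t := if `[< J t >] then t else sup J.
pose F t := if `[< J t >] then y t else y (sup J).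
have Fin t : J t -> F t = y t by move=> Jt; rewrite /F asboolT.
have Fout t : ~ J t -> F t = y (sup J) by move=> Jt; rewrite /F asboolF.
have hout t : 0 <= t -> ~ J t -> J (sup J) /\ sup J < t.
  exact: maximal_closed hw _ _ _ _ hmax.
have hub t : 0 <= t -> ~ J t -> forall s, J s -> s <= sup J.
  move=> t0 Jt s Js; apply: ub_le_sup => //; exists t => u Ju; apply: ltW.
  by rewrite ltNge; apply/negP => tu; apply: Jt; apply: (iJ _ _ Jz Ju); rewrite t0.
have K0 : 0 <= K by have [] := hw.
split; first by rewrite -/(F 0) Fin.
split=> [t t0|s t /andP[s0 st]]; last first.
  rewrite -/(F t) -/(F s).
  have [Jt|Jt] := pselect (J t).
    have Js : J s by apply: (iJ _ _ Jz Jt); rewrite s0.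
    by rewrite !Fin//; have [] := hq _ _ Js Jt st.
  have [Jm mt] := hout _ (le_trans s0 st) Jt.
  rewrite (Fout t)//; have [Js|Js] := pselect (J s); last first.
    by rewrite Fout// subrr normr0 mulr_ge0// subr_ge0.
  rewrite Fin//; have sm := hub _ (le_trans s0 st) Jt _ Js.
  have [h _] := hq _ _ Js Jm sm; apply: le_trans h _.
  by rewrite ler_wpM2l// lerB// ltW.
change (exists e, vel w (F t) e /\ right_deriv (fun s => rval (F s)) t e).
(* From the last time [m] of the maximal interval on, the flow is constant, and [maximal_stuck]
   makes 0 an admissible speed. This serves for [t] beyond the interval and for [t] equal to its
   last time. *)
have stay m : J m -> (forall s, J s -> s <= m) -> t >= m ->
    exists e, vel w (F t) e /\ right_deriv (fun s => rval (F s)) t e.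
  move=> Jm Jmax mt.
  have Fm s : m <= s -> F s = y m.
    rewrite le_eqVlt => /orP[/eqP <-|ms]; first exact: Fin.
    have Js : ~ J s by move=> /Jmax; rewrite leNgt ms.
    have s0 : 0 <= s by rewrite (le_trans (J0 _ Jm))// ltW.
    have [Jsup _] := hout _ s0 Js.
    by rewrite Fout//; congr y; apply/eqP; rewrite eq_le Jmax// (hub _ s0 Js).
  exists 0; rewrite Fm//; split; first exact: maximal_stuck hw _ _ _ _ hmax Jm Jmax.
  by apply: right_deriv_cst => s ts; rewrite !Fm// (le_trans mt)// ltW.
have [Jt|Jt] := pselect (J t); last first.
  have [Jm mt] := hout _ t0 Jt.
  by apply: (stay _ Jm _ (ltW mt)) => s; exact: hub t0 Jt s.
have [[t' [Jt' tt']]|nt'] := pselect (exists t', J t' /\ t < t'); last first.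
  by apply: (stay t) => // s Js; rewrite leNgt; apply/negP => ts; apply: nt'; exists s.
exists (w (y t)); rewrite Fin//; split; first by left.
move=> e e0; have [h h0 hh] := qsol_right_deriv _ _ _ hw _ _ _ t' iJ hq Jt Jt' tt' _ e0.
exists (Num.min h (t' - t)); first by rewrite lt_min h0 subr_gt0.
move=> s /andP[ts]; rewrite -ltrBlDl lt_min => /andP[sh st'].
rewrite !Fin//; last by apply: (iJ _ _ Jt Jt'); lra.
by apply: hh; lra.
Qed.

Lemma flow0 x0 : flow w 0 x0 = x0.
Proof. exact: (flow_stopped_curve x0).1. Qed.

Lemma flow_lip_time x0 s t : 0 <= s <= t ->
  `|rval (flow w t x0) - rval (flow w s x0)| <= K * (t - s).
Proof. exact: (flow_stopped_curve x0).2.2. Qed.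

Lemma flow_lip t : 0 <= t -> lip_by (expR (L * t)) (fun x => rval (flow w t x)).
Proof.
move=> t0 x y; have [fx cx] := flow_stopped_curve x.
have [fy cy] := flow_stopped_curve y.
have := stopped_curve_compare w w _ _ 0 t hw (lexx _) _ cx cy t0.
rewrite fx fy mul0r addr0 mulrC; apply.
by move=> z; rewrite subrr normr0.
Qed.

Lemma measurable_flow t : 0 <= t -> measurable_fun setT (flow w t).
Proof. by move=> /flow_lip; exact: measurable_lip_map. Qed.

(** As functions of [t], both sides are stopped curves that start at [flow w s x0]; the comparison
    with [eta = 0] forces them to agree. *)
Lemma flow_semigroup x0 s t : 0 <= s -> 0 <= t ->
  flow w (s + t) x0 = flow w t (flow w s x0).
Proof.
move=> s0 t0; have [fx [hx lx]] := flow_stopped_curve x0.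
have [fy cy] := flow_stopped_curve (flow w s x0).
have cz : stopped_curve w (fun r => flow w (s + r) x0).
  split=> [r r0|r u /andP[r0 ru]].
    have [|e [ve he]] := hx (s + r); first exact: addr_ge0.
    exists e; split=> // d /he[h h0 hh]; exists h => // q /andP[rq qh].
    have := hh (s + q); rewrite (_ : s + q - (s + r) = q - r); last by ring.
    by apply; rewrite ltrD2l rq -addrA ltrD2l.
  have := lx (s + r) (s + u); rewrite (_ : s + u - (s + r) = u - r); last by ring.
  by apply; rewrite addr_ge0// lerD2l.
apply: rval_inj; apply/eqP; rewrite -subr_eq0 -normr_le0.
have := stopped_curve_compare w w _ _ 0 t hw (lexx _) _ cz cy t0.
rewrite addr0 fy subrr normr0 mul0r addr0 mul0r; apply.
by move=> z; rewrite subrr normr0.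
Qed.

End flow_properties.

Lemma flow_lip_velocity {R : realType} (K L eta : R) (w1 w2 : I01 R -> R) t x0 :
  BL_by K L w1 -> BL_by K L w2 -> 0 <= eta ->
  (forall x, `|w1 x - w2 x| <= eta) -> 0 <= t ->
  `|rval (flow w1 t x0) - rval (flow w2 t x0)| <= eta * t * expR (L * t).
Proof.
move=> h1 h2 eta0 heta t0.
have [f1 c1] := flow_stopped_curve _ _ _ h1 x0.
have [f2 c2] := flow_stopped_curve _ _ _ h2 x0.
have := stopped_curve_compare _ _ _ _ _ _ _ t h1 eta0 heta c1 c2 t0.
by rewrite f1 f2 subrr normr0 add0r.
Qed.

(** * The linear equation *)

Section bochner.
Context {R : realType}.
Implicit Types (phi : I01 R -> R) (g : simple_path R).
Local Notation leb := (@lebesgue_measure R).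

Lemma ge0_le_lower_integral d (T : measurableType d) (m : {measure set T -> \bar R})
    (D : set T) (f1 f2 : T -> \bar R) :
  (forall x, D x -> 0 <= f1 x)%E -> (forall x, D x -> f1 x <= f2 x)%E ->
  (\int[m]_(x in D) f1 x <= \int[m]_(x in D) f2 x)%E.
Proof.
move=> f10 f12; have f20 x : D x -> (0 <= f2 x)%E.
  by move=> Dx; apply: le_trans (f10 _ Dx) (f12 _ Dx).
rewrite !ge0_integralE//; apply: ereal_sup_le => _ [h hf <-].
exists h => // x; apply: le_trans (hf x) _; rewrite !patchE.
by case: ifPn => // /[!inE]; exact: f12.
Qed.

Lemma cint_simple_eval g s B L phi : BL_by B L phi ->
  cint (simple_eval g s) phi = \sum_(p <- g) \1_(p.1) s * cint p.2 phi.
Proof.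
move=> [_ _ hB hL]; have mphi := measurable_lip _ _ hL.
rewrite /simple_eval; elim: g => [|p g IH].
  by rewrite !big_nil (cint_M0 B).
by rewrite !big_cons (cint_Madd _ _ B)// IH (cint_Mscale _ _ B).
Qed.

Lemma cint_simple_int g B L phi : BL_by B L phi ->
  cint (simple_int g) phi = \sum_(p <- g) fine (leb p.1) * cint p.2 phi.
Proof.
move=> [_ _ hB hL]; have mphi := measurable_lip _ _ hL.
rewrite /simple_int; elim: g => [|p g IH].
  by rewrite !big_nil (cint_M0 B).
by rewrite !big_cons (cint_Madd _ _ B)// IH (cint_Mscale _ _ B).
Qed.

Lemma simple_path_integral (t : R) g phi : simple_wf t g ->
  leb.-integrable `[0, t] (EFin \o (fun s => \sum_(p <- g) \1_(p.1) s * cint p.2 phi)) /\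
  \int[leb]_(s in `[0, t]) (\sum_(p <- g) \1_(p.1) s * cint p.2 phi) =
  \sum_(p <- g) fine (leb p.1) * cint p.2 phi.
Proof.
have mI : measurable (`[0, t]%classic : set (measurableTypeR R)) by exact: measurable_itv.
have fin : (leb `[0%R, t]%classic < +oo)%E.
  by rewrite lebesgue_measure_itv; case: ifP => _; rewrite ?ltry// -EFinB ltry.
elim: g => [_|[A rho] g IH wf].
  rewrite (_ : (fun s => _) = cst 0); last by apply/funext => s; rewrite big_nil.
  rewrite big_nil Rintegral_cst// mul0r; split => //.
  exact: (@integrable0 _ _ _ leb `[0, t]%classic).
have [/= mA sA] := wf 0%N isT.
have [|i1 e1] := IH; first by move=> i hi; exact: (wf i.+1).
have i0 : leb.-integrable `[0, t] (EFin \o (\1_A : R -> R)).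
  apply: (measurable_bounded_integrable mI fin).
    exact: measurable_indic.
  exists 1; split=> [|y /ltW y1 s _ /=]; first exact: num_real.
  by rewrite indicE; case: (s \in A); rewrite ?normr1 ?normr0// (le_trans ler01).
have i2 : leb.-integrable `[0, t] (EFin \o (fun s => \1_A s * cint rho phi)).
  have := integrableZr mI (cint rho phi) i0.
  by apply: eq_integrable => // s _; rewrite /= EFinM.
have E : (fun s => \sum_(p <- (A, rho) :: g) \1_(p.1) s * cint p.2 phi) =
    (fun s => \1_A s * cint rho phi + \sum_(p <- g) \1_(p.1) s * cint p.2 phi).
  by apply/funext => s; rewrite big_cons.
rewrite E big_cons /=; split; first exact: (integrableD mI i2 i1).
rewrite RintegralD// e1 RintegralZr//; congr (_ * _ + _).
by rewrite /Rintegral integral_indic//; congr (fine (leb _)); exact: setIidl.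
Qed.

(** Pairing with [phi] is linear and [C]-Lipschitz for [distBL]: it commutes with the integral of
    simple functions and passes to the limit. Half of [e] pays for the distance from
    [simple_int (g n)] to [I], half for the integrated distance from [simple_eval (g n)] to [h]. *)
Lemma bochner_cint (t : R) (h : R -> M R) (I : M R) B L phi :
  BL_by B L phi -> bochner_integral t h I ->
  leb.-integrable `[0, t] (EFin \o (fun s => cint (h s) phi)) ->
  cint I phi = \int[leb]_(s in `[0, t]) cint (h s) phi.
Proof.
move=> hphi [g [wf _ gint gI]] hint.
have [B0 L0 _ _] := hphi.
pose C := B + L + 1; have C0 : 0 < C by rewrite /C; lra.
have mI : measurable (`[0, t]%classic : set (measurableTypeR R)) by exact: measurable_itv.
pose u s := cint (h s) phi.
pose f n s := \sum_(p <- g n) \1_(p.1) s * cint p.2 phi.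
have fE n s : f n s = cint (simple_eval (g n) s) phi.
  by rewrite (cint_simple_eval _ _ _ _ _ hphi).
have fi n : leb.-integrable `[0, t] (EFin \o f n) := (simple_path_integral _ _ _ (wf n)).1.
have ff n : \int[leb]_(s in `[0, t]) f n s = cint (simple_int (g n)) phi.
  by rewrite (simple_path_integral _ _ _ (wf n)).2 (cint_simple_int _ _ _ _ hphi).
apply/eqP; rewrite -subr_eq0 -normr_le0; apply/ler_addgt0Pr => e e0; rewrite add0r.
have e1 : 0 < e / (2 * C) by rewrite divr_gt0// mulr_gt0.
have [gfin /cvgrPdist_lt /(_ _ e1) gfine] := (fine_cvgP _ _).1 gint.
move/cvgrPdist_lt : gI => /(_ _ e1) gI.
near \oo => n.
have h1 : distBL (simple_int (g n)) I < e / (2 * C).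
  have : `|0 - distBL (simple_int (g n)) I| < e / (2 * C) by near: n; exact: gI.
  by rewrite sub0r normrN ger0_norm// distBL_ge0.
have h2 : (\int[leb]_(s in `[0%R, t]) (distBL (simple_eval (g n) s) (h s))%:E)%E \is a fin_num.
  by near: n; exact: gfin.
have h3 : fine (\int[leb]_(s in `[0%R, t]) (distBL (simple_eval (g n) s) (h s))%:E)%E < e / (2 * C).
  have : `|0 - fine (\int[leb]_(s in `[0%R, t]) (distBL (simple_eval (g n) s) (h s))%:E)%E| < e / (2 * C).
    by near: n; exact: gfine.
  by rewrite sub0r normrN => /(le_lt_trans (ler_norm _)).
have di : leb.-integrable `[0, t] (EFin \o (fun s => f n s - u s)) by exact: (integrableB mI (fi n) hint).
have dn := integrable_norm di.
have hd s : `|f n s - u s| <= C * distBL (simple_eval (g n) s) (h s).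
  rewrite fE /u (le_trans (le_distBL _ _ _ _ _ hphi))// ler_wpM2r ?distBL_ge0//.
  by rewrite /C; lra.
have hle : \int[leb]_(s in `[0, t]) `|f n s - u s| <= C * (e / (2 * C)).
  rewrite -ler_pdivrMl// -RintegralZl//.
  apply: le_trans (ltW h3); rewrite -lee_fin (fineK h2) /Rintegral fineK; last first.
    apply: integrable_fin_num => //.
    by have := integrableZl mI C^-1 dn; apply: eq_integrable.
  apply: ge0_le_lower_integral => s _; rewrite lee_fin.
    by rewrite mulr_ge0// invr_ge0 ltW.
  by rewrite ler_pdivrMl.
have h4 : `|cint I phi - cint (simple_int (g n)) phi| <= C * (e / (2 * C)).
  rewrite distrC (le_trans (le_distBL _ _ _ _ _ hphi))//.
  by apply: ler_pM; [exact: addr_ge0|exact: distBL_ge0|rewrite /C; lra|exact: ltW].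
have h5 : `|cint (simple_int (g n)) phi - \int[leb]_(s in `[0, t]) u s| <= C * (e / (2 * C)).
  rewrite -ff -RintegralB//; apply: le_trans hle.
  exact: le_normr_Rintegral.
have CE : C * (e / (2 * C)) = e / 2 by field; rewrite gt_eqF.
rewrite CE in h4 h5.
apply: le_trans (ler_distD (cint (simple_int (g n)) phi) _ _) _; lra.
Unshelve. all: by end_near. Qed.

Lemma path_continuous_eps (T : R) (mu : R -> M R) : path_continuous T mu ->
  forall t, 0 <= t <= T -> forall e : R, 0 < e -> exists2 h : R, 0 < h &
    forall s, 0 <= s <= T -> `|s - t| < h -> distBL (mu s) (mu t) <= e.
Proof.
move=> hmu t ht e e0; have := hmu t; rewrite in_itv /= ht => /(_ isT).
move=> /cvgrPdist_le /(_ e e0) /nbhs_ballP[h h0 hh]; exists h => // s hs st.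
have := hh s; rewrite /ball/= distrC => /(_ st); rewrite in_itv /= hs => /(_ isT).
by rewrite sub0r normrN ger0_norm// distBL_ge0.
Qed.

End bochner.

(** * The variation of constants formula, tested *)

Section linear_solutions.
Context {R : realType}.
Local Notation leb := (@lebesgue_measure R).
Implicit Types (phi psi : I01 R -> R) (mu : M R).

Lemma BL_byM (B L B' L' : R) phi psi : BL_by B L phi -> BL_by B' L' psi ->
  BL_by (B * B') (L * B' + B * L') (fun x => phi x * psi x).
Proof.
move=> [B0 L0 hB hL] [B'0 L'0 hB' hL']; split.
- exact: mulr_ge0.
- by rewrite addr_ge0// mulr_ge0.
- by move=> x; rewrite normrM ler_pM.
move=> x y; rewrite (_ : _ - _ = (phi x - phi y) * psi x + phi y * (psi x - psi y)); last by ring.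
rewrite (le_trans (ler_normD _ _))// !normrM mulrDl lerD//.
  by rewrite mulrAC ler_pM.
by rewrite -mulrA ler_pM.
Qed.

Variables (f w : I01 R -> R) (Bf Lf K L : R).
Hypotheses (hf : BL_by Bf Lf f) (hw : BL_by K L w).

Lemma BL_by_flow (B Lp t u : R) phi : BL_by B Lp phi -> 0 <= t <= u ->
  BL_by B (Lp * expR (L * u)) (phi \o flow w t).
Proof.
move=> [B0 Lp0 hB hL] /andP[t0 tu]; split=> //.
- by rewrite mulr_ge0// expR_ge0.
- by move=> x; exact: hB.
move=> x y /=; rewrite (le_trans (hL _ _))// -mulrA ler_wpM2l//.
rewrite (le_trans (flow_lip _ _ _ hw _ t0 _ _))// ler_wpM2r// ler_expR ler_wpM2l//.
by have [] := hw.
Qed.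

(** The adjoint of [mu |-> Pw w t (density f mu)] applied to [phi]; it moves the whole source term
    onto the test function. *)
Definition source phi (t : R) : I01 R -> R := fun x => f x * phi (flow w t x).

(** A Lipschitz constant of [source phi t] common to all [t] in $[0,u]$. *)
Definition sourceL (B Lp u : R) := Lf * B + Bf * (Lp * expR (L * u)).

Lemma BL_by_source (B Lp t u : R) phi : BL_by B Lp phi -> 0 <= t <= u ->
  BL_by (Bf * B) (sourceL B Lp u) (source phi t).
Proof. by move=> hphi tu; exact: BL_byM hf (BL_by_flow _ _ _ _ _ hphi tu). Qed.

Lemma source_lip_time (B Lp s t : R) phi x : BL_by B Lp phi -> 0 <= s -> 0 <= t ->
  `|source phi s x - source phi t x| <= Bf * Lp * K * `|s - t|.
Proof.
move=> [_ Lp0 _ hL]; wlog st : s t / s <= t => [hwlog s0 t0|s0 t0].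
  have [/hwlog|/ltW /hwlog h] := leP s t; first exact.
  by rewrite distrC (distrC s); exact: h.
have [Bf0 _ hBf _] := hf.
rewrite /source -mulrBr normrM -!mulrA ler_pM// (le_trans (hL _ _))// ler_wpM2l//.
rewrite distrC (distrC s) (ger0_norm (_ : 0 <= t - s)) ?subr_ge0//.
by apply: (flow_lip_time _ _ _ hw); rewrite s0.
Qed.

Lemma cint_Pw (t B Lp : R) mu phi : 0 <= t -> BL_by B Lp phi ->
  cint (Pw w t mu) phi = cint mu (phi \o flow w t).
Proof.
move=> t0 [_ _ hB hL]; apply: cint_pushforward hB.
  exact: measurable_flow hw _ t0.
exact: measurable_lip hL.
Qed.

Lemma cint_Pw_density (t B Lp : R) mu phi : 0 <= t -> BL_by B Lp phi ->
  cint (Pw w t (density f mu)) phi = cint mu (source phi t).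
Proof.
move=> t0 hphi; rewrite (cint_Pw _ _ _ _ _ t0 hphi).
have tt : 0 <= t <= t by rewrite t0 lexx.
have [_ _ hB hL] := BL_by_flow _ _ _ _ _ hphi tt.
have [_ _ hBf hLf] := hf.
by apply: (cint_density _ _ _ Bf B) => //; [exact: measurable_lip hLf|exact: measurable_lip hL].
Qed.

Variables (T : R) (nu : M R) (rho : R -> M R).
Hypothesis hrho : linear_solution f w T nu rho.

Definition integrand phi (u s : R) := cint (rho s) (source phi (u - s)).

(** Two things vary with [s]: the measure, controlled in [distBL] because the functions
    [source phi (u - s)] have common bounds, and the function, controlled uniformly and multiplied
    by the bounded total variation. The result supplies the integrability that [bochner_cint] asks
    for. *)
Lemma integrand_continuous (B Lp u : R) phi : BL_by B Lp phi -> 0 <= u <= T ->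
  {within `[0, u], continuous (integrand phi u)}.
Proof.
move=> hphi /andP[u0 uT]; have [cont [V hV] _] := hrho.
have [Bf0 Lf0 _ _] := hf; have [K0 L0 _ _] := hw; have [B0 Lp0 _ _] := hphi.
have V0 : 0 <= V.
  apply: le_trans (normTV_ge0 (rho 0)) (hV 0 _).
  by rewrite in_itv/= lexx (le_trans u0).
pose C1 := Bf * B + sourceL B Lp u.
pose C2 := Bf * Lp * K * V.
have C10 : 0 <= C1.
  by rewrite /C1 /sourceL !addr_ge0// !mulr_ge0// ?expR_ge0// mulr_ge0// expR_ge0.
have C20 : 0 <= C2 by rewrite /C2 !mulr_ge0.
have D1 : 0 < 2 * (C1 + 1) by lra.
have D2 : 0 < 2 * (C2 + 1) by lra.
apply/subspace_continuousP => r; rewrite /= in_itv/= => /andP[r0 ru].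
apply/cvgrPdist_le => e e0.
have [|h h0 hh] := path_continuous_eps _ _ cont r _ _ (divr_gt0 e0 D1).
  by rewrite r0 (le_trans ru).
apply/nbhs_ballP; exists (Num.min h (e / (2 * (C2 + 1)))).
  by rewrite /= lt_min h0 divr_gt0.
move=> s; rewrite /ball/= lt_min in_itv/= => /andP[sh s2] /andP[s0 su].
have d1 : distBL (rho s) (rho r) <= e / (2 * (C1 + 1)).
  by apply: hh; [rewrite s0 (le_trans su)|rewrite distrC].
have us : 0 <= u - s <= u by lra.
have ur : 0 <= u - r <= u by lra.
have us0 : 0 <= u - s by lra.
have ur0 : 0 <= u - r by lra.
have bs := BL_by_source _ _ _ _ _ hphi us.
have br := BL_by_source _ _ _ _ _ hphi ur.
have [_ _ bs1 bs2] := bs; have [_ _ br1 br2] := br.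
have ms := measurable_lip _ _ bs2; have mr := measurable_lip _ _ br2.
have h1 : `|cint (rho r) (source phi (u - s)) - cint (rho s) (source phi (u - s))| <=
    C1 * (e / (2 * (C1 + 1))).
  by rewrite distrC (le_trans (le_distBL _ _ _ _ _ bs))// ler_wpM2l.
have h2 : `|cint (rho r) (source phi (u - r)) - cint (rho r) (source phi (u - s))| <=
    C2 * (e / (2 * (C2 + 1))).
  rewrite -(cintB _ _ _ _ _ mr br1 ms bs1).
  apply: le_trans (le_cint _ (Bf * Lp * K * `|r - s|) _ (measurable_funB mr ms) _) _.
    move=> x; rewrite (le_trans (source_lip_time _ _ _ _ _ x hphi ur0 us0))//.
    by rewrite (_ : u - r - (u - s) = s - r) 1?(distrC s)//; ring.
  rewrite /C2 mulrAC; apply: ler_pM.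
  - by rewrite !mulr_ge0// normTV_ge0.
  - exact: normr_ge0.
  - by rewrite ler_wpM2l ?mulr_ge0// hV// in_itv/= r0 (le_trans ru).
  exact: ltW.
rewrite /integrand.
have E1 : C1 * (e / (2 * (C1 + 1))) <= e / 2.
  rewrite mulrA ler_pdivrMr// (_ : e / 2 * (2 * (C1 + 1)) = (C1 + 1) * e); last by field.
  by rewrite ler_wpM2r ?ltW// ltrDl.
have E2 : C2 * (e / (2 * (C2 + 1))) <= e / 2.
  rewrite mulrA ler_pdivrMr// (_ : e / 2 * (2 * (C2 + 1)) = (C2 + 1) * e); last by field.
  by rewrite ler_wpM2r ?ltW// ltrDl.
apply: le_trans (ler_distD (cint (rho r) (source phi (u - s))) _ _) _; lra.
Qed.

Lemma integrand_integrable (B Lp u : R) phi : BL_by B Lp phi -> 0 <= u <= T ->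
  leb.-integrable `[0, u] (EFin \o integrand phi u).
Proof.
move=> hphi hu; apply: continuous_compact_integrable; first exact: segment_compact.
exact: integrand_continuous hphi hu.
Qed.

Lemma eq_integrable_itv (u : R) (g g' : R -> R) :
  (forall s, 0 <= s <= u -> g s = g' s) ->
  leb.-integrable `[0, u] (EFin \o g) -> leb.-integrable `[0, u] (EFin \o g').
Proof.
move=> h; apply: eq_integrable; first exact: measurable_itv.
by move=> s; rewrite inE/= in_itv/= => /h ->.
Qed.

Lemma variation_of_constants (B Lp u : R) phi : BL_by B Lp phi -> 0 <= u <= T ->
  cint (rho u) phi = cint nu (phi \o flow w u) +
    \int[leb]_(s in `[0, u]) integrand phi u s.
Proof.
move=> hphi /[dup] hu /andP[u0 uT]; have [_ _ hb] := hrho.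
have uin : u \in `[0, T] by rewrite in_itv/= u0.
have E s : 0 <= s <= u ->
    cint (Pw w (u - s) (density f (rho s))) phi = integrand phi u s.
  by move=> /andP[s0 su]; apply: cint_Pw_density hphi; rewrite subr_ge0.
have := bochner_cint _ _ _ _ _ _ hphi (hb u uin).
rewrite (cint_Msub_BL _ _ _ _ _ hphi) (cint_Pw _ _ _ _ _ u0 hphi) => h.
rewrite (_ : \int[leb]_(s in `[0, u]) integrand phi u s =
  \int[leb]_(s in `[0, u]) cint (Pw w (u - s) (density f (rho s))) phi); last first.
  by apply: eq_Rintegral => s; rewrite inE/= in_itv/= => /E ->.
rewrite -h; first by ring.
apply: eq_integrable_itv (integrand_integrable _ _ _ _ hphi hu) => s hs.
by rewrite E.
Qed.

Lemma linear_solution0 (B Lp : R) phi : BL_by B Lp phi -> 0 <= T ->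
  cint (rho 0) phi = cint nu phi.
Proof.
move=> hphi T0; rewrite (variation_of_constants _ _ 0 _ hphi) ?lexx//.
rewrite set_itv1 Rintegral_set1 addr0; congr cint.
by apply/funext => x /=; rewrite (flow0 _ _ _ hw).
Qed.

(** By the semigroup law, the formula at [t + d] tested with [phi] and the one at [t] tested with
    [phi \o flow w d] share the initial term and the integrand on $[0,t]$. What remains is the
    integral over $(t,t+d]$, where the integrand is within [e] of [c]. *)
Lemma linear_solution_step (B Lp t d c e : R) phi : BL_by B Lp phi ->
  0 <= t -> 0 <= d -> t + d <= T ->
  (forall s, t <= s <= t + d -> `|integrand phi (t + d) s - c| <= e) ->
  `|cint (rho (t + d)) phi - cint (rho t) (phi \o flow w d) - d * c| <= d * e.
Proof.
move=> hphi t0 d0 tdT hc.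
have td0 : 0 <= t + d by exact: addr_ge0.
have htd : 0 <= t + d <= T by rewrite td0.
have ht : 0 <= t <= T by rewrite t0 (le_trans _ tdT)// lerDl.
have dd : 0 <= d <= d by rewrite d0 lexx.
have hphid := BL_by_flow _ _ _ _ _ hphi dd.
rewrite (variation_of_constants _ _ _ _ hphi htd) (variation_of_constants _ _ _ _ hphid ht).
rewrite (_ : (phi \o flow w d) \o flow w t = phi \o flow w (t + d)); last first.
  by apply/funext => x /=; rewrite (flow_semigroup _ _ _ hw).
rewrite (_ : \int[leb]_(s in `[0, t]) integrand (phi \o flow w d) t s =
   \int[leb]_(s in `[0, t]) integrand phi (t + d) s); last first.
  apply: eq_Rintegral => s; rewrite inE/= in_itv/= => /andP[s0 st].
  rewrite /integrand; congr cint; apply/funext => x; rewrite /source /=.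
  by rewrite -(flow_semigroup _ _ _ hw) ?subr_ge0//; congr (_ * phi (flow w _ _)); ring.
have int := integrand_integrable _ _ _ _ hphi htd.
rewrite (_ : _ - _ - _ = (\int[leb]_(s in `[0, t + d]) integrand phi (t + d) s -
  \int[leb]_(s in `[0, t]) integrand phi (t + d) s) - d * c); last by ring.
rewrite Rintegral_itvB//; last by rewrite bnd_simp lerDl.
have mI : measurable (`]t, t + d]%classic : set (measurableTypeR R)) by exact: measurable_itv.
have sub : `]t, t + d]%classic `<=` `[0, t + d]%classic.
  by move=> s; rewrite /= !in_itv/= => /andP[ts ->]; rewrite andbT (le_trans t0)// ltW.
have len : fine (leb `]t, t + d]%classic) = d.
  rewrite lebesgue_measure_itv/= lte_fin ltrDl; case: ltP => h.
    by rewrite -EFinB /=; ring.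
  by apply/eqP; rewrite eq_le d0 h.
have fin : (leb `]t, (t + d)%R]%classic < +oo)%E.
  by rewrite lebesgue_measure_itv; case: ifP => _; rewrite ?ltry// -EFinB ltry.
have int' : leb.-integrable `]t, t + d] (EFin \o integrand phi (t + d)).
  by apply: integrableS int => //; exact: measurable_itv.
have intc (r : R) : leb.-integrable `]t, t + d] (EFin \o (fun=> r)).
  apply: (measurable_bounded_integrable mI fin); first exact: measurable_cst.
  by exists `|r|; split=> [|y /ltW yr s _]; [exact: num_real|exact: yr].
rewrite -[X in _ - X * c]len (mulrC _ c) -Rintegral_cst// -RintegralB//.
have intB := integrableB mI int' (intc c).
apply: le_trans (le_normr_Rintegral mI intB) _.
rewrite -[X in X * e]len (mulrC _ e) -Rintegral_cst//; apply: le_Rintegral => //.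
  exact: (integrable_norm intB).
move=> s; rewrite /= in_itv/= => /andP[ts st]; apply: hc.
by rewrite st ltW.
Qed.

End linear_solutions.

(** * Euler approximations *)

Section partitions.
Context {R : realType}.
Variables (T : R) (a : seq R).
Hypothesis ha : itv_partition 0 T a.

Lemma node_lt j : (j < size a)%N -> node a j < node a j.+1.
Proof. by move=> ja; have [/(pathP 0) h _] := ha; exact: h. Qed.

Lemma node_last : node a (size a) = T.
Proof. by have [_ /eqP <-] := ha; rewrite /node -nth_last /=; case: a. Qed.

Lemma node_le i j : (i <= j)%N -> (j <= size a)%N -> node a i <= node a j.
Proof.
elim: j => [|j IH]; first by rewrite leqn0 => /eqP ->.
rewrite leq_eqVlt => /orP[/eqP -> //|ij ja].
by rewrite (le_trans (IH ij (ltnW ja)))// ltW// node_lt.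
Qed.

Lemma node_itv j : (j <= size a)%N -> 0 <= node a j <= T.
Proof.
move=> ja; have := node_le j _ ja (leqnn _); rewrite node_last => ->.
by rewrite andbT; exact: (node_le 0 j).
Qed.

Lemma node_mesh j : (j < size a)%N -> node a j.+1 - node a j <= mesh a.
Proof.
move=> ja; rewrite /mesh.
exact: (le_bigmax _ (fun i : 'I_(size a) => node a i.+1 - node a i) (Ordinal ja)).
Qed.

Lemma node_cover_left (r : R) : 0 <= r < T ->
  exists2 j, (j < size a)%N & node a j <= r < node a j.+1.
Proof.
move=> /andP[r0 rT]; apply: contrapT => no.
have : forall j, (j <= size a)%N -> node a j <= r.
  elim=> [//|j IH ja]; rewrite leNgt; apply/negP => rj; apply: no.
  by exists j => //; rewrite IH// ltnW.
by move=> /(_ _ (leqnn _)); rewrite node_last leNgt rT.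
Qed.

Lemma node_cover_right (r : R) : 0 < r <= T ->
  exists2 j, (j < size a)%N & node a j < r <= node a j.+1.
Proof.
move=> /andP[r0 rT]; apply: contrapT => no.
have : forall j, (j <= size a)%N -> node a j < r.
  elim=> [//|j IH ja]; rewrite ltNge; apply/negP => rj; apply: no.
  by exists j => //; rewrite IH// ltnW.
by move=> /(_ _ (leqnn _)); rewrite node_last ltNge rT.
Qed.

End partitions.

(** * Weak evolution and growth of the total variation *)

Section evolution.
Context {R : realType}.
Implicit Types (f w phi : I01 R -> R) (mu nu : R -> M R).

(* On [p, q] the path [mu] solves the linear equation with velocity [w], in the
   form of the one step estimate of linear_solution_step. *)
Definition evolves f w mu (p q : R) := forall phi (B Lp t d c e : R),
  BL_by B Lp phi -> p <= t -> 0 <= d -> t + d <= q ->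
  (forall s, t <= s <= t + d -> `|cint (mu s) (source f w phi (t + d - s)) - c| <= e) ->
  `|cint (mu (t + d)) phi - cint (mu t) (phi \o flow w d) - d * c| <= d * e.

Lemma euler_evolves f (v : M R -> I01 R -> R) (T : R) (a : seq R) (mu0 : M R) mu (r : R) :
  BL f -> (forall rho, BL (v rho)) -> itv_partition 0 T a ->
  euler_approx f v T a mu0 mu -> 0 <= r < T ->
  exists p q, [/\ 0 <= p <= r, r < q <= T, q - p <= mesh a &
    evolves f (v (mu p)) mu p q].
Proof.
move=> /BL_BL_by[Bf [Lf hf]] hv ha [_ _ hmu] hr.
have [j ja /andP[pr rq]] := node_cover_left _ _ ha _ hr.
exists (node a j), (node a j.+1); split.
- by rewrite pr andbT; have /andP[] := node_itv _ _ ha j (ltnW ja).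
- by rewrite rq; have /andP[] := node_itv _ _ ha j.+1 ja.
- exact: node_mesh.
have [rho hrho muE] := hmu j ja; move: hrho muE.
set p := node a j; set q := node a j.+1; move=> hrho muE.
have [K [L hw]] := BL_BL_by _ (hv (mu p)).
have pq : 0 <= q - p by rewrite subr_ge0 (le_trans pr)// ltW.
(* At [s = p] the path is not given by [rho], as the interval is open on the left; there [rho 0] and
   [mu p] agree when paired with test functions. *)
have cintE s psi B Lp : BL_by B Lp psi -> p <= s <= q ->
    cint (mu s) psi = cint (rho (s - p)) psi.
  move=> hpsi /andP[]; rewrite le_eqVlt => /orP[/eqP <- _|ps sq].
    by rewrite subrr (linear_solution0 _ _ _ _ _ _ hf hw _ _ _ hrho _ _ _ hpsi).
  by rewrite muE// in_itv/= ps.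
move=> phi B Lp t d c e hphi pt d0 tdq hc.
have dd : 0 <= d <= d by rewrite d0 lexx.
have hphid := BL_by_flow _ _ _ hw _ _ _ _ _ hphi dd.
rewrite (cintE _ _ _ _ hphi); last by rewrite tdq andbT; lra.
rewrite (cintE _ _ _ _ hphid); last by rewrite pt; lra.
rewrite (_ : t + d - p = (t - p) + d); last by ring.
apply: (linear_solution_step _ _ _ _ _ _ hf hw _ _ _ hrho _ _ _ _ _ _ _ hphi) => //; [lra|lra|].
move=> s hs; have hb : 0 <= t + d - (s + p) <= d by lra.
have := hc (s + p).
rewrite (cintE _ _ _ _ (BL_by_source _ _ _ _ _ _ hf hw _ _ _ _ _ hphi hb)); last by lra.
rewrite /integrand (_ : s + p - p = s); last by ring.
by rewrite (_ : t + d - (s + p) = t - p + d - s); [apply; lra|ring].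
Qed.

(** A maximum over the pieces, dependent on the partition. It only has to be finite: in
    [normTV_growth] it fixes the length of the steps and drops out of the bound. *)
Lemma euler_bounded f (v : M R -> I01 R -> R) (T : R) (a : seq R) (mu0 : M R) mu :
  itv_partition 0 T a -> euler_approx f v T a mu0 mu ->
  exists V : R, forall t, 0 <= t <= T -> normTV (mu t) <= V.
Proof.
move=> ha [_ h0 hmu].
have [V hV] : exists V : R, forall j, (j < size a)%N ->
    forall t, node a j < t <= node a j.+1 -> normTV (mu t) <= V.
  have : (size a <= size a)%N by [].
  elim: {1 3}(size a) => [_|n IH na]; first by exists 0.
  have [V hV] := IH (ltnW na).
  have [rho [_ [B hB] _] muE] := hmu n na.
  exists (Num.max V B) => j; rewrite ltnS leq_eqVlt => /orP[/eqP -> t ht|jn t ht].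
    rewrite le_max; apply/orP; right; rewrite muE; last by rewrite in_itv.
    by apply: hB; rewrite in_itv/=; lra.
  by rewrite le_max (hV j).
exists (Num.max (normTV mu0) V) => t /andP[]; rewrite le_eqVlt => /orP[/eqP <- _|t0 tT].
  by rewrite h0 le_max lexx.
have [|j ja jt] := node_cover_right _ _ ha t; first by rewrite t0.
by rewrite le_max (hV j ja _ jt) orbT.
Qed.

(** The total variation is merely lower semicontinuous for [distBL], which is enough here: by
    [normTV_le] each Lipschitz test function can be followed to the limit separately. *)
Lemma normTV_left_closed (T r b : R) mu : path_continuous T mu -> 0 < r <= T ->
  (forall s, 0 <= s < r -> normTV (mu s) <= b) -> normTV (mu r) <= b.
Proof.
move=> hmu /andP[r0 rT] hs; apply: normTV_le => L phi L0 h1 hL.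
have hphi : BL_by 1 L phi by [].
have L1 : 0 < 1 + L by lra.
apply/ler_addgt0Pr => e e0.
have [|h h0 hh] := path_continuous_eps _ _ hmu r _ _ (divr_gt0 e0 L1); first by rewrite ltW.
pose s := Num.max 0 (r - h / 2).
have s0 : 0 <= s by rewrite le_max lexx.
have sr : s < r by rewrite gt_max r0; lra.
have sh : r - h / 2 <= s by rewrite le_max lexx orbT.
have d1 : distBL (mu s) (mu r) <= e / (1 + L).
  apply: hh; first by rewrite s0; lra.
  by rewrite distrC ger0_norm; lra.
have := le_distBL (mu s) (mu r) _ _ _ hphi.
have h2 : (1 + L) * distBL (mu s) (mu r) <= e.
  by rewrite mulrC -ler_pdivlMr.
move=> /le_trans /(_ h2); rewrite distrC => h3.
have h4 : `|cint (mu s) phi| <= b.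
  apply: le_trans (le_cint _ _ _ (measurable_lip _ _ hL) h1) _.
  by rewrite mul1r hs// s0.
rewrite (_ : cint (mu r) phi = (cint (mu r) phi - cint (mu s) phi) + cint (mu s) phi); last by ring.
by rewrite (le_trans (ler_normD _ _))//; lra.
Qed.

Variables (f : I01 R -> R) (Bf Lf : R).
Hypothesis hf : BL_by Bf Lf f.

(** The source makes the total variation grow at rate [Bf]. The additional 1 in the rate of the
    barrier absorbs the correction [(u - r) * (Bf * (Bf * V))], which lies below the barrier as soon
    as the step is short; thus [V] does not enter the conclusion. *)
Lemma normTV_growth (T V c : R) mu : path_continuous T mu ->
  (forall t, 0 <= t <= T -> normTV (mu t) <= V) ->
  (forall r, 0 <= r < T -> exists w p q, [/\ BL w, p <= r, r < q <= T & evolves f w mu p q]) ->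
  normTV (mu 0) < c ->
  forall t, 0 <= t <= T -> normTV (mu t) <= c * expR ((Bf + 1) * t).
Proof.
move=> cont hV hloc hc.
have c0 : 0 < c := le_lt_trans (normTV_ge0 _) hc.
have [Bf0 _ hBf _] := hf.
have k0 : 0 <= Bf + 1 by lra.
pose g := gbound c (Bf + 1) 0.
have gE t : c * expR ((Bf + 1) * t) = g t by rewrite /g /gbound mul0r addr0.
have gmono s t : 0 <= s <= t -> g s <= g t.
  move=> /andP[s0 st]; rewrite -!gE; apply: ler_wpM2l; first exact: ltW.
  by rewrite ler_expR ler_wpM2l.
move=> t ht; rewrite gE; move: t ht; apply: real_induction.
- by rewrite /g /gbound mul0r addr0 mulr0 expR0 mulr1 ltW.
- move=> r /[dup] hr /andP[r0 rT] Pr.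
  have [w [p [q [/BL_BL_by[K [L hw]] pr /andP[rq qT] hev]]]] := hloc r hr.
  have V0 : 0 <= V by apply: le_trans (normTV_ge0 (mu 0)) (hV 0 _); rewrite lexx; lra.
  have step (d e : R) : 0 <= d -> r + d <= q ->
      (forall s, r <= s <= r + d -> Bf * normTV (mu s) <= e) ->
      normTV (mu (r + d)) <= normTV (mu r) + d * e.
    move=> d0 rdq he; apply: normTV_le => Lp phi Lp0 h1 hL.
    have hphi : BL_by 1 Lp phi by [].
    have dd : 0 <= d <= d by rewrite d0 lexx.
    have := hev phi _ _ r d 0 e hphi pr d0 rdq.
    rewrite mulr0 subr0 => h.
    have {}h : `|cint (mu (r + d)) phi - cint (mu r) (phi \o flow w d)| <= d * e.
      apply: h => s hs; rewrite subr0.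
      have hs2 : 0 <= r + d - s <= d by lra.
      have [_ _ b1 b2] := BL_by_source _ _ _ _ _ _ hf hw _ _ _ _ _ hphi hs2.
      apply: le_trans (le_cint _ _ _ (measurable_lip _ _ b2) b1) _.
      by rewrite mulr1 he.
    have [_ _ b1 b2] := BL_by_flow _ _ _ hw _ _ _ _ _ hphi dd.
    have h2 := le_cint (mu r) _ _ (measurable_lip _ _ b2) b1.
    rewrite mul1r in h2.
    rewrite (_ : cint (mu (r + d)) phi = cint (mu r) (phi \o flow w d) +
      (cint (mu (r + d)) phi - cint (mu r) (phi \o flow w d))); last by ring.
    by rewrite (le_trans (ler_normD _ _))// lerD.
  have crude d : 0 <= d -> r + d <= q -> normTV (mu (r + d)) <= normTV (mu r) + d * (Bf * V).
    move=> d0 rdq; apply: step => // s hs; rewrite ler_wpM2l// hV//; lra.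
  pose C := Bf * (Bf * V) + 1.
  have C0 : 0 < C by rewrite ltr_pwDr// !mulr_ge0.
  exists (Num.min (q - r) (c / C)); first by rewrite lt_min subr_gt0 rq divr_gt0.
  move=> u /andP[ru]; rewrite -ltrBlDl lt_min => /andP[u1 u2] uT.
  have d0 : 0 <= u - r by lra.
  have uE : u = r + (u - r) by ring.
  have BV0 : 0 <= Bf * V by rewrite mulr_ge0.
  (* The crude bound is fed back into [step], which replaces [V] by [normTV (mu r)] up to second
     order. *)
  have h1 : normTV (mu u) <= normTV (mu r) + (u - r) * (Bf * (normTV (mu r) + (u - r) * (Bf * V))).
    rewrite {1}uE; apply: step => //; first by lra.
    move=> s hs; rewrite ler_wpM2l// (_ : s = r + (s - r)); last by ring.
    apply: le_trans (crude _ _ _) _; [lra|lra|].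
    by rewrite lerD2l ler_wpM2r//; lra.
  have gc : c <= g r.
    rewrite -[leLHS]mulr1 -gE; apply: ler_wpM2l; first exact: ltW.
    by rewrite -[leLHS]expR0 ler_expR mulr_ge0.
  have h2 : (u - r) * (Bf * (Bf * V)) <= g r.
    apply: le_trans gc; move: u2; rewrite ltr_pdivlMr// => /ltW u2; apply: le_trans u2.
    by rewrite ler_wpM2l// /C lerDl.
  have := @gbound_step _ _ _ _ c0 k0 (lexx _) u r.
  rewrite r0 (ltW ru) addr0 -/(g r) -/(g u) => /(_ isT).
  apply: le_trans; apply: le_trans h1 _.
  have h3 : Bf * (normTV (mu r) + (u - r) * (Bf * V)) <= (Bf + 1) * g r.
    rewrite mulrDr (_ : (Bf + 1) * g r = Bf * g r + g r); last by ring.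
    apply: lerD; first by rewrite ler_wpM2l.
    by rewrite mulrCA.
  by rewrite lerD// mulrC ler_wpM2r.
move=> r /[dup] hr /andP[r0 rT] Pq; apply: (normTV_left_closed _ _ _ _ cont hr) => s hs.
by apply: le_trans (Pq s hs) _; apply: gmono; lra.
Qed.

End evolution.

Lemma ler_dist_split {R : realType} (x y x1 y1 y2 d p q e1 e2 e3 e4 e5 : R) :
  `|x - x1 - d * p| <= e1 -> `|y - y2 - d * q| <= e2 -> `|x1 - y1| <= e3 ->
  `|y1 - y2| <= e4 -> `|d * (p - q)| <= e5 -> `|x - y| <= e1 + e2 + e3 + e4 + e5.
Proof.
move=> h1 h2 h3 h4 h5.
rewrite (_ : x - y = (x - x1 - d * p) - (y - y2 - d * q) + (x1 - y1) + (y1 - y2) +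
  d * (p - q)); last by ring.
do 3 (apply: le_trans (ler_normD _ _) _; apply: lerD => //).
by apply: le_trans (ler_normB _ _) _; exact: lerD.
Qed.

Lemma ler_step {R : realType} (x y D G a b c : R) : D <= G -> 0 <= x + y ->
  a <= c -> b <= c -> c <= G -> x * D + (y * D + a) + b <= (x + y + 2) * G.
Proof. by move=> DG xy ac bc cG; have := ler_wpM2l xy DG; lra. Qed.

Lemma distBL_left_closed {R : realType} (T r b : R) (mu nu : R -> M R) :
  path_continuous T mu -> path_continuous T nu -> 0 < r <= T ->
  (forall s, 0 <= s < r -> distBL (mu s) (nu s) <= b) -> distBL (mu r) (nu r) <= b.
Proof.
move=> cmu cnu /andP[r0 rT] hb.
apply/ler_addgt0Pr => e e0.
have e2 : 0 < e / 2 by rewrite divr_gt0.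
have hr' : 0 <= r <= T by rewrite ltW.
have [h1 h10 hh1] := path_continuous_eps _ _ cmu r hr' _ e2.
have [h2 h20 hh2] := path_continuous_eps _ _ cnu r hr' _ e2.
pose h := Num.min h1 h2.
have h0 : 0 < h by rewrite lt_min h10.
have hh : h <= h1 /\ h <= h2 by rewrite /h !ge_min !lexx orbT.
pose s := Num.max 0 (r - h / 2).
have s0 : 0 <= s by rewrite le_max lexx.
have sr : s < r by rewrite gt_max r0; lra.
have sh : r - h / 2 <= s by rewrite le_max lexx orbT.
have sT : 0 <= s <= T by lra.
have nsr : `|s - r| < h by rewrite distrC ger0_norm; lra.
have d1 := hh1 s sT (lt_le_trans nsr hh.1).
have d2 := hh2 s sT (lt_le_trans nsr hh.2).
have d3 : distBL (mu s) (nu s) <= b by apply: hb; rewrite s0.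
apply: le_trans (distBL_triangle _ (mu s) _) _.
apply: le_trans (lerD (lexx _) (distBL_triangle _ (nu s) _)) _.
by rewrite distBLC addrCA [e in leRHS]splitr; exact: (lerD d3 (lerD d1 d2)).
Qed.

(** * Gronwall estimate for two Euler approximations *)

Section stability.
Context {R : realType}.
Variables (f : I01 R -> R) (Bf Lf K L V T : R).
Hypotheses (hf : BL_by Bf Lf f) (K0 : 0 <= K) (L0 : 0 <= L) (V0 : 0 <= V) (T0 : 0 <= T).
Implicit Types (w phi : I01 R -> R) (mu nu : R -> M R).

Let Bf0 : 0 <= Bf. Proof. by have [] := hf. Qed.
Let Lf0 : 0 <= Lf. Proof. by have [] := hf. Qed.

(** Transport displaces a mass of at most [V] at speed at most [K], and the source adds at most
    [Bf * V] per unit time. *)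
Lemma evolves_lip_time w mu (p q r s : R) : BL_by K L w -> evolves f w mu p q ->
  (forall t, p <= t <= q -> normTV (mu t) <= V) -> p <= r -> r <= s -> s <= q ->
  distBL (mu s) (mu r) <= V * (K + Bf) * (s - r).
Proof.
move=> hw hev hV pr rs sq; have d0 : 0 <= s - r by lra.
have dd : 0 <= s - r <= s - r by rewrite d0 lexx.
apply: distBL_le => B Lp phi hphi BL1.
have [B0 Lp0 b1 b2] := hphi.
have hflow := BL_by_flow _ _ _ hw _ _ _ _ _ hphi dd.
have sE : s = r + (s - r) by ring.
have h1 : `|cint (mu s) phi - cint (mu r) (phi \o flow w (s - r))| <= (s - r) * (Bf * V).
  have := hev phi _ _ r (s - r) 0 (Bf * V) hphi pr d0.
  rewrite -sE mulr0 subr0; apply => // t ht; rewrite subr0.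
  have ht2 : 0 <= s - t <= s - r by lra.
  have [_ _ c1 c2] := BL_by_source _ _ _ _ _ _ hf hw _ _ _ _ _ hphi ht2.
  apply: le_trans (le_cint _ _ _ (measurable_lip _ _ c2) c1) _.
  apply: ler_pM; rewrite ?normTV_ge0 ?mulr_ge0//; last by apply: hV; lra.
  by rewrite -[leRHS]mulr1 ler_wpM2l//; lra.
have h2 : `|cint (mu r) (phi \o flow w (s - r)) - cint (mu r) phi| <= K * (s - r) * V.
  have [_ _ c1 c2] := hflow.
  have m1 := measurable_lip _ _ c2; have m2 := measurable_lip _ _ b2.
  rewrite -(cintB _ _ _ _ _ m1 c1 m2 b1).
  apply: le_trans (le_cint _ (K * (s - r)) _ (measurable_funB m1 m2) _) _.
    move=> x; apply: le_trans (b2 _ _) _.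
    have z0 : 0 <= (0 : R) <= s - r by rewrite lexx.
    have := flow_lip_time _ _ _ hw x _ _ z0; rewrite (flow0 _ _ _ hw) subr0.
    move=> h; apply: le_trans h; rewrite -[leRHS]mul1r ler_wpM2r//; lra.
  by rewrite ler_wpM2l ?mulr_ge0//; apply: hV; lra.
apply: le_trans (ler_distD (cint (mu r) (phi \o flow w (s - r))) _ _) _.
by rewrite (_ : V * _ * _ = (s - r) * (Bf * V) + K * (s - r) * V); [exact: lerD|ring].
Qed.

Variable E : R.
Hypothesis E_le : forall d, 0 <= d <= T -> 1 <= expR (L * d) <= E.

(** The coefficient of $d^2$ when the source is frozen at the initial time. The first summand bounds
    the change of the measure, tested against [source], whose bounds add up to at most
    [Bf + (Lf + Bf * E)]; the second bounds the change of [source] in time. *)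
Definition step_error := (Bf + (Lf + Bf * E)) * (V * (K + Bf)) + Bf * K * V.

Lemma evolves_step w mu (p q r d : R) B Lp phi : BL_by K L w -> evolves f w mu p q ->
  (forall t, p <= t <= q -> normTV (mu t) <= V) -> p <= r -> 0 <= d -> r + d <= q -> d <= T ->
  BL_by B Lp phi -> B + Lp <= 1 ->
  `|cint (mu (r + d)) phi - cint (mu r) (phi \o flow w d) -
     d * cint (mu r) (fun x => f x * phi x)| <= d * (d * step_error).
Proof.
move=> hw hev hV pr d0 rdq dT hphi BL1.
have [B0 Lp0 b1 b2] := hphi.
apply: (hev phi _ _ r d _ _ hphi pr d0 rdq) => s hs.
have hs2 : 0 <= r + d - s <= d by lra.
have s0 : 0 <= r + d - s by lra.
have hd : 0 <= d <= T by rewrite d0.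
have /andP[E1 E2] := E_le d hd.
have E0 : 0 <= E := le_trans (le_trans ler01 E1) E2.
have z0 : 0 <= (0 : R) <= d by rewrite lexx.
have -> : (fun x => f x * phi x) = source f w phi 0.
  by apply/funext => x; rewrite /source (flow0 _ _ _ hw).
have hsrc := BL_by_source _ _ _ _ _ _ hf hw _ _ _ _ _ hphi hs2.
have hsrc0 := BL_by_source _ _ _ _ _ _ hf hw _ _ _ _ _ hphi z0.
have [_ S0 c1 c2] := hsrc; have [_ _ c3 c4] := hsrc0.
have m1 := measurable_lip _ _ c2; have m2 := measurable_lip _ _ c4.
have sL : Bf * B + sourceL Bf Lf L B Lp d <= Bf + (Lf + Bf * E).
  rewrite /sourceL; apply: lerD; first by rewrite -[leRHS]mulr1 ler_wpM2l//; lra.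
  apply: lerD; first by rewrite -[leRHS]mulr1 ler_wpM2l//; lra.
  rewrite ler_wpM2l// -[leRHS]mul1r; apply: ler_pM => //; lra.
have h1 : `|cint (mu s) (source f w phi (r + d - s)) - cint (mu r) (source f w phi (r + d - s))| <=
    (Bf + (Lf + Bf * E)) * (V * (K + Bf) * d).
  apply: le_trans (le_distBL _ _ _ _ _ hsrc) _.
  apply: ler_pM => //; [by rewrite addr_ge0// mulr_ge0|exact: distBL_ge0|].
  apply: le_trans (evolves_lip_time _ _ _ _ r s hw hev hV pr _ _) _; [lra|lra|].
  by rewrite ler_wpM2l ?mulr_ge0 ?addr_ge0//; lra.
have h2 : `|cint (mu r) (source f w phi (r + d - s)) - cint (mu r) (source f w phi 0)| <= Bf * K * d * V.
  rewrite -(cintB _ _ _ _ _ m1 c1 m2 c3).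
  apply: le_trans (le_cint _ (Bf * K * d) _ (measurable_funB m1 m2) _) _.
    move=> x; apply: le_trans (source_lip_time _ _ _ _ _ _ hf hw _ _ _ _ _ x hphi s0 (lexx _)) _.
    rewrite subr0 ger0_norm//; apply: ler_pM => //; [by rewrite !mulr_ge0| |lra].
    rewrite -mulrA ler_wpM2l// -[leRHS]mul1r ler_wpM2r//; lra.
  by rewrite ler_wpM2l ?mulr_ge0//; apply: hV; lra.
apply: le_trans (ler_distD (cint (mu r) (source f w phi (r + d - s))) _ _) _.
rewrite (_ : d * step_error = (Bf + (Lf + Bf * E)) * (V * (K + Bf) * d) + Bf * K * d * V).
  exact: lerD.
by rewrite /step_error; ring.
Qed.

Lemma distBL_step w1 w2 mu nu (p1 q1 p2 q2 r d eta : R) :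
  BL_by K L w1 -> BL_by K L w2 -> evolves f w1 mu p1 q1 -> evolves f w2 nu p2 q2 ->
  (forall t, p1 <= t <= q1 -> normTV (mu t) <= V) ->
  (forall t, p2 <= t <= q2 -> normTV (nu t) <= V) ->
  p1 <= r -> p2 <= r -> 0 <= d -> r + d <= q1 -> r + d <= q2 -> d <= T ->
  0 <= eta -> (forall x, `|w1 x - w2 x| <= eta) ->
  distBL (mu (r + d)) (nu (r + d)) <= distBL (mu r) (nu r) +
    d * ((L * E + Bf + Lf) * distBL (mu r) (nu r) + V * E * eta + 2 * (d * step_error)).
Proof.
move=> hw1 hw2 ev1 ev2 hV1 hV2 pr1 pr2 d0 rq1 rq2 dT eta0 heta.
apply: distBL_le => B Lp phi hphi BL1; have [B0 Lp0 b1 b2] := hphi.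
have B1 : B <= 1 by lra.
have hd : 0 <= d <= T by rewrite d0.
have dd : 0 <= d <= d by rewrite d0 lexx.
have /andP[E1 E2] := E_le d hd.
have E0 : 0 <= E := le_trans (le_trans ler01 E1) E2.
have s1 := evolves_step _ _ _ _ r d _ _ _ hw1 ev1 hV1 pr1 d0 rq1 dT hphi BL1.
have s2 := evolves_step _ _ _ _ r d _ _ _ hw2 ev2 hV2 pr2 d0 rq2 dT hphi BL1.
have f1 := BL_by_flow _ _ _ hw1 _ _ _ _ _ hphi dd.
have f2 := BL_by_flow _ _ _ hw2 _ _ _ _ _ hphi dd.
set D := distBL (mu r) (nu r); have D0 : 0 <= D by exact: distBL_ge0.
(* e^x - 1 <= x e^x *)
have expB : expR (L * d) <= 1 + L * E * d.
  have := expR_ge1Dx (- (L * d)); rewrite expRN => h.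
  have e0 := expR_gt0 (L * d).
  have : (1 + - (L * d)) * expR (L * d) <= 1.
    by rewrite -ler_pdivlMr// mul1r.
  have : (L * d) * expR (L * d) <= (L * d) * E by rewrite ler_wpM2l// mulr_ge0.
  lra.
have t1 : `|cint (mu r) (phi \o flow w1 d) - cint (nu r) (phi \o flow w1 d)| <= (1 + L * E * d) * D.
  apply: le_trans (le_distBL _ _ _ _ _ f1) _; rewrite ler_wpM2r//.
  apply: le_trans expB; have : Lp * expR (L * d) <= (1 - B) * expR (L * d).
    by rewrite ler_wpM2r ?expR_ge0//; lra.
  have : B * 1 <= B * expR (L * d) by rewrite ler_wpM2l.
  lra.
have t2 : `|cint (nu r) (phi \o flow w1 d) - cint (nu r) (phi \o flow w2 d)| <= V * E * eta * d.
  have [_ _ c1 c2] := f1; have [_ _ c3 c4] := f2.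
  have m1 := measurable_lip _ _ c2; have m2 := measurable_lip _ _ c4.
  rewrite -(cintB _ _ _ _ _ m1 c1 m2 c3).
  apply: le_trans (le_cint _ (eta * d * E) _ (measurable_funB m1 m2) _) _.
    move=> x; apply: le_trans (b2 _ _) _.
    rewrite -[leRHS]mul1r; apply: ler_pM => //; first by lra.
    apply: le_trans (flow_lip_velocity _ _ _ _ _ _ x hw1 hw2 eta0 heta d0) _.
    by rewrite ler_wpM2l// mulr_ge0.
  have : eta * d * E * normTV (nu r) <= eta * d * E * V.
    by rewrite ler_wpM2l ?mulr_ge0 ?expR_ge0//; apply: hV2; lra.
  lra.
have t3 : `|cint (mu r) (fun x => f x * phi x) - cint (nu r) (fun x => f x * phi x)| <= (Bf + Lf) * D.
  apply: le_trans (le_distBL _ _ _ _ _ (BL_byM _ _ _ _ _ _ hf hphi)) _.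
  rewrite ler_wpM2r//.
  have hB1 : Bf * (B + Lp) <= Bf * 1 by rewrite ler_wpM2l.
  have hB2 : Lf * B <= Lf * 1 by rewrite ler_wpM2l.
  apply: (@le_trans _ _ (Bf * 1 + Lf * 1)); last by rewrite !mulr1.
  rewrite (_ : Bf * B + (Lf * B + Bf * Lp) = Bf * (B + Lp) + Lf * B); last by ring.
  exact: lerD.
have t4 : `|d * (cint (mu r) (fun x => f x * phi x) - cint (nu r) (fun x => f x * phi x))| <=
    d * ((Bf + Lf) * D).
  by rewrite normrM (ger0_norm d0) ler_wpM2l.
apply: le_trans (ler_dist_split _ _ _ _ _ _ _ _ _ _ _ _ _ s1 s2 t1 t2 t4) _.
clearbody D; rewrite le_eqVlt; apply/orP; left; apply/eqP; ring.
Qed.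

(** In the rate [k0 + 2] of the barrier, [k0] collects the coefficients of the distance itself. One
    unit absorbs the mesh term, at most [c] by hypothesis, and the other the second-order term of
    [distBL_step], at most [c] for short steps. *)
Lemma distBL_growth (v : M R -> I01 R -> R) (m1 m2 Cv c : R) mu nu :
  0 <= Cv -> path_continuous T mu -> path_continuous T nu ->
  (forall t, 0 <= t <= T -> normTV (mu t) <= V) ->
  (forall t, 0 <= t <= T -> normTV (nu t) <= V) ->
  (forall rho, normTV rho <= V -> BL_by K L (v rho)) ->
  (forall rho sigma, normTV rho <= V -> normTV sigma <= V ->
    forall x, `|v rho x - v sigma x| <= Cv * distBL rho sigma) ->
  (forall r, 0 <= r < T -> exists p q, [/\ 0 <= p <= r, r < q <= T, q - p <= m1 &
    evolves f (v (mu p)) mu p q]) ->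
  (forall r, 0 <= r < T -> exists p q, [/\ 0 <= p <= r, r < q <= T, q - p <= m2 &
    evolves f (v (nu p)) nu p q]) ->
  0 < c -> distBL (mu 0) (nu 0) <= c ->
  V * E * Cv * (V * (K + Bf)) * (m1 + m2) <= c ->
  forall t, 0 <= t <= T -> distBL (mu t) (nu t) <=
    c * expR ((L * E + Bf + Lf + V * E * Cv + 2) * t).
Proof.
move=> Cv0 cmu cnu Vmu Vnu hK hC emu enu c0 hc0 hc.
have E0 : 0 <= E.
  by have /andP[h1] := E_le 0 (introT andP (conj (lexx _) T0)); apply: le_trans; exact: le_trans h1.
set k0 := L * E + Bf + Lf + V * E * Cv.
have k00 : 0 <= k0 by rewrite /k0 !addr_ge0// !mulr_ge0.
have k20 : 0 <= k0 + 2 by lra.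
pose g := gbound c (k0 + 2) 0.
have gE t : c * expR ((k0 + 2) * t) = g t by rewrite /g /gbound mul0r addr0.
have gmono s t : 0 <= s <= t -> g s <= g t.
  move=> /andP[s0 st]; rewrite -!gE; apply: ler_wpM2l; first exact: ltW.
  by rewrite ler_expR ler_wpM2l.
have C50 : 0 <= step_error by rewrite /step_error !(addr_ge0, mulr_ge0).
move=> t ht; rewrite gE; move: t ht; apply: real_induction.
- by rewrite /g /gbound mul0r addr0 mulr0 expR0 mulr1.
- move=> r /[dup] hr /andP[r0 rT] Pr.
  have [p1 [q1 [/andP[p10 p1r] /andP[rq1 q1T] mesh1 ev1]]] := emu r hr.
  have [p2 [q2 [/andP[p20 p2r] /andP[rq2 q2T] mesh2 ev2]]] := enu r hr.
  have V1 t : p1 <= t <= q1 -> normTV (mu t) <= V.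
    by move=> /andP[h1 h2]; apply: Vmu; rewrite (le_trans p10 h1) (le_trans h2 q1T).
  have V2 t : p2 <= t <= q2 -> normTV (nu t) <= V.
    by move=> /andP[h1 h2]; apply: Vnu; rewrite (le_trans p20 h1) (le_trans h2 q2T).
  have Vp1 : normTV (mu p1) <= V by apply: V1; rewrite lexx (le_trans p1r)// ltW.
  have Vp2 : normTV (nu p2) <= V by apply: V2; rewrite lexx (le_trans p2r)// ltW.
  have hw1 := hK _ Vp1; have hw2 := hK _ Vp2.
  set D := distBL (mu r) (nu r) in Pr.
  have VK0 : 0 <= V * (K + Bf) by rewrite mulr_ge0// addr_ge0.
  have l1 : distBL (mu r) (mu p1) <= V * (K + Bf) * m1.
    apply: le_trans (evolves_lip_time _ _ _ _ p1 r hw1 ev1 V1 (lexx _) p1r (ltW rq1)) _.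
    by rewrite ler_wpM2l// (le_trans _ mesh1)// lerB// ltW.
  have l2 : distBL (nu r) (nu p2) <= V * (K + Bf) * m2.
    apply: le_trans (evolves_lip_time _ _ _ _ p2 r hw2 ev2 V2 (lexx _) p2r (ltW rq2)) _.
    by rewrite ler_wpM2l// (le_trans _ mesh2)// lerB// ltW.
  (* Each velocity is frozen at the last node, [p1] or [p2], since when its path has moved by at
     most [V * (K + Bf)] times the bound on the mesh. *)
  pose eta := Cv * (D + V * (K + Bf) * (m1 + m2)).
  have etaP x : `|v (mu p1) x - v (nu p2) x| <= eta.
    apply: le_trans (hC _ _ Vp1 Vp2 x) _; rewrite ler_wpM2l//.
    apply: le_trans (distBL_triangle _ (mu r) _) _.
    apply: le_trans (lerD (lexx _) (distBL_triangle _ (nu r) _)) _.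
    by rewrite distBLC -/D (mulrDr _ m1) addrCA lerD2l; exact: (lerD l1 l2).
  have eta0 : 0 <= eta by apply: le_trans (normr_ge0 _) (etaP point).
  have gc : c <= g r.
    rewrite -[leLHS]mulr1 -gE; apply: ler_wpM2l; first exact: ltW.
    by rewrite -[leLHS]expR0 ler_expR mulr_ge0.
  have C51 : 0 < 2 * step_error + 1 by rewrite ltr_pwDr// mulr_ge0.
  exists (Num.min (Num.min (q1 - r) (q2 - r)) (c / (2 * step_error + 1))).
    by rewrite !lt_min !subr_gt0 rq1 rq2 divr_gt0.
  move=> u /andP[ru]; rewrite -ltrBlDl !lt_min => /andP[/andP[u1 u2] u3] uT.
  have d0 : 0 <= u - r by rewrite subr_ge0 ltW.
  have uE : r + (u - r) = u by rewrite addrC subrK.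
  have := distBL_step _ _ _ _ _ _ _ _ r (u - r) eta hw1 hw2 ev1 ev2 V1 V2 p1r p2r d0.
  rewrite uE -/D => st.
  have uq1 : u <= q1 by rewrite -(lerD2r (- r)) ltW.
  have uq2 : u <= q2 by rewrite -(lerD2r (- r)) ltW.
  have urT : u - r <= T by rewrite lerBlDr (le_trans uT)// lerDl.
  apply: le_trans (st uq1 uq2 urT eta0 etaP) _.
  have h3 : 2 * ((u - r) * step_error) <= c.
    move: u3; rewrite ltr_pdivlMr// => /ltW; apply: le_trans.
    by rewrite mulrCA ler_wpM2l// lerDl.
  have := @gbound_step _ _ _ _ c0 k20 (lexx _) u r.
  rewrite r0 (ltW ru) addr0 -/(g r) -/(g u) => /(_ isT).
  apply: le_trans; apply: lerD => //.
  rewrite [leRHS]mulrC ler_wpM2l//.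
  rewrite (_ : V * E * eta = V * E * Cv * D + V * E * Cv * (V * (K + Bf)) * (m1 + m2)).
    exact: (ler_step _ _ _ _ _ _ c).
  by rewrite /eta mulrA mulrDr !mulrA.
move=> r /[dup] hr /andP[r0 rT] Pq.
apply: (distBL_left_closed _ _ _ _ _ cmu cnu hr) => s hs.
apply: le_trans (Pq s hs) _; apply: gmono.
by case/andP: hs => -> /ltW.
Qed.

End stability.

(** * Passage to mild solutions *)

Section limits.
Context {R : realType}.

Lemma distBL_path_dist (T t : R) (mu nu : R -> M R) : 0 <= t <= T ->
  ((distBL (mu t) (nu t))%:E <= path_dist T mu nu)%E.
Proof. by move=> ht; apply: ereal_sup_ubound; exists t => //=; rewrite in_itv. Qed.

Lemma mild_solution_approx (f : I01 R -> R) (v : M R -> I01 R -> R) (T : R) mu0 mu (e : R) :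
  mild_solution f v T mu0 mu -> 0 < e ->
  exists a muk, [/\ itv_partition 0 T a, mesh a <= e, euler_approx f v T a mu0 muk &
    forall t, 0 <= t <= T -> distBL (muk t) (mu t) <= e].
Proof.
move=> [_ [alpha [muk [sub [[hpart _ hmesh] heul hsub /fine_cvgP[hfin hlim]]]]]] e0.
(* The mesh tends to 0 along the full sequence; this inequality carries it over to the convergent
   subsequence. *)
have subge n : (n <= sub n)%N.
  by elim: n => // n IH; exact: leq_ltn_trans IH (hsub _ _ (ltnSn n)).
move/cvgrPdist_lt : hmesh => /(_ e e0) [N _ hN].
move/cvgrPdist_lt : hlim => /(_ e e0) hlim.
near \oo => n.
have Nn : (N <= n)%N by near: n; exact: nbhs_infty_ge.
exists (alpha (sub n)), (muk (sub n)); split => //.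
  have := hN (sub n) (leq_trans Nn (subge n)); rewrite /= sub0r normrN.
  by move=> /(le_lt_trans (ler_norm _)) /ltW.
move=> t ht.
have h1 : path_dist T (muk (sub n)) mu \is a fin_num by near: n; exact: hfin.
have h2 : fine (path_dist T (muk (sub n)) mu) < e.
  have : `|0 - fine (path_dist T (muk (sub n)) mu)| < e by near: n; exact: hlim.
  by rewrite sub0r normrN => /(le_lt_trans (ler_norm _)).
apply: le_trans (ltW h2); rewrite -lee_fin fineK//; exact: distBL_path_dist.
Unshelve. all: by end_near. Qed.

End limits.

(** The summand 1 in [Rt + 1] provides the strict inequality that [normTV_growth] wants at time 0.
    The bound is the same for all partitions. *)
Lemma euler_normTV {R : realType} (f : I01 R -> R) (v : M R -> I01 R -> R)
    (Bf Lf T Rt : R) (a : seq R) (mu0 : M R) (mu : R -> M R) :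
  BL_by Bf Lf f -> (forall rho, BL (v rho)) -> itv_partition 0 T a ->
  euler_approx f v T a mu0 mu -> normTV mu0 <= Rt -> 0 <= Rt ->
  forall t, 0 <= t <= T -> normTV (mu t) <= (Rt + 1) * expR ((Bf + 1) * T).
Proof.
move=> hf hv ha hmu hmu0 Rt0 t ht; have [cmu mu0E _] := hmu.
have [Bf0 _ _ _] := hf.
have [W hW] := euler_bounded _ _ _ _ _ _ ha hmu.
apply: (@le_trans _ _ ((Rt + 1) * expR ((Bf + 1) * t))); last first.
  apply: ler_wpM2l; first by rewrite addr_ge0.
  by rewrite ler_expR; apply: ler_wpM2l; [rewrite addr_ge0|case/andP: ht].
apply: (normTV_growth _ _ _ hf T W _ mu) => //; last by rewrite mu0E (le_lt_trans hmu0)// ltrDl.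
move=> r hr; have [p [q [/andP[p0 pr] rq _ ev]]] :=
  euler_evolves _ _ _ _ _ _ _ (BL_byP _ _ _ hf) hv ha hmu hr.
by exists (v (mu p)), p, q.
Qed.

Theorem theorem3p12 (R : realType) (f : I01 R -> R) (v : M R -> I01 R -> R)
    (hf : BL f) (hv : velocity_assumption v)
    (T Rt : R) (hT : 0 < T) (hRt : 0 < Rt) :
  exists C : R, forall mu0 nu0 : M R,
    Mpos mu0 -> Mpos nu0 -> normTV mu0 <= Rt -> normTV nu0 <= Rt ->
    forall mu nu : R -> M R,
      mild_solution f v T mu0 mu -> mild_solution f v T nu0 nu ->
      (path_dist T mu nu <= (C * distBL mu0 nu0)%:E)%E.
Proof.
have [Bf [Lf hfb]] := BL_BL_by _ hf; have [Bf0 Lf0 _ _] := hfb.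
have [vBL vA] := hv.
(* The bound of [euler_normTV]. Velocity constants taken at this radius are valid along every Euler
   approximation whose initial value has total variation at most [Rt]. *)
pose V := (Rt + 1) * expR ((Bf + 1) * T).
have V0 : 0 < V by rewrite mulr_gt0 ?expR_gt0//; lra.
have [[[K0 L0] C0] hKLC] := vA V V0.
(* Absolute values make the constants nonnegative and only weaken the bounds. *)
pose K := `|K0|; pose L := `|L0|; pose Cv := `|C0|.
have [Kge0 Lge0 Cge0] : [/\ 0 <= K, 0 <= L & 0 <= Cv] by split; exact: normr_ge0.
have hK rho : normTV rho <= V -> BL_by K L (v rho).
  move=> hrho; have [h1 h2 _] := hKLC rho rho hrho hrho.
  split => //.
    move=> x; apply: le_trans (bounded_by_norm_sup _ (vBL rho) x) _.
    by apply: le_trans h1 _; exact: ler_norm.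
  move=> x y; apply: le_trans (lip_by_lip_const _ (vBL rho) x y) _; rewrite ler_wpM2r//.
  by apply: le_trans h2 _; exact: ler_norm.
have hC rho sigma : normTV rho <= V -> normTV sigma <= V ->
    forall x, `|v rho x - v sigma x| <= Cv * distBL rho sigma.
  move=> hrho hsigma x; have [_ _ h3] := hKLC rho sigma hrho hsigma.
  have [_ _ b1 _] := hK _ hrho; have [_ _ b2 _] := hK _ hsigma.
  have h4 : `|v rho x - v sigma x| <= norm_sup (fun x => v rho x - v sigma x).
    apply: ub_le_sup; last by exists x.
    exists (K + K) => _ [y _ <-].
    by apply: le_trans (ler_normB _ _) _; exact: lerD.
  apply: le_trans h4 _; apply: le_trans h3 _.
  by rewrite ler_wpM2r ?distBL_ge0// ler_norm.
pose E := expR (L * T).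
pose A := V * E * Cv * (V * (K + Bf)).
pose k := L * E + Bf + Lf + V * E * Cv + 2.
have E0 : 0 <= E by exact: expR_ge0.
have hE d : 0 <= d <= T -> 1 <= expR (L * d) <= E.
  move=> /andP[d0 dT]; rewrite -[leLHS]expR0 !ler_expR mulr_ge0//=.
  by rewrite ler_wpM2l.
clearbody E.
have V0' := ltW V0.
have VE : V = (Rt + 1) * expR ((Bf + 1) * T) by [].
clearbody V K L Cv.
have A0 : 0 <= A.
  by rewrite /A !mulr_ge0 ?addr_ge0.
have k0 : 0 <= k.
  by rewrite /k !addr_ge0 ?mulr_ge0.
exists (expR (k * T)) => mu0 nu0 _ _ hmu0 hnu0 mu nu hmu hnu.
apply: ge_ereal_sup => _ [t /= ht <-]; rewrite in_itv/= in ht; rewrite lee_fin.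
apply/ler_addgt0Pr => e e0.
pose C := expR (k * T); have C0' : 0 < C by exact: expR_gt0.
have C0'' := ltW C0'.
have S0 : 0 < 2 + (1 + 2 * A) * C.
  by rewrite ltr_pwDl// mulr_ge0// addr_ge0// mulr_ge0.
(* [dl] bounds both the meshes and the distances of the approximations to the mild solutions. These
   distances add [2 * dl], the excess of [c] over [D0] adds [(1 + 2 * A) * C * dl], and together
   this is [e]. *)
pose dl := e / (2 + (1 + 2 * A) * C).
have dl0 : 0 < dl by rewrite divr_gt0.
have [a [muk [ha ma ea da]]] := mild_solution_approx _ _ _ _ _ _ hmu dl0.
have [b [nuk [hb mb eb db]]] := mild_solution_approx _ _ _ _ _ _ hnu dl0.
have [ca mu0E _] := ea; have [cb nu0E _] := eb.
set D0 := distBL mu0 nu0; have D00 : 0 <= D0 by exact: distBL_ge0.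
(* [dl] keeps [c] positive when [D0] is 0, and [A * (dl + dl)] makes room for the mesh term of
   [distBL_growth]. *)
pose c := D0 + dl + A * (dl + dl).
have Adl : 0 <= A * (dl + dl) by rewrite mulr_ge0// addr_ge0// ltW.
have c0 : 0 < c by rewrite /c ltr_wpDr// ltr_wpDl.
have main : distBL (muk t) (nuk t) <= c * C.
  apply: (@le_trans _ _ (c * expR (k * t))); last first.
    apply: ler_wpM2l; first exact: ltW.
    by rewrite ler_expR; apply: ler_wpM2l => //; case/andP: ht.
  apply: (distBL_growth f Bf Lf K L V T hfb Kge0 Lge0 V0'
    (ltW hT) E hE v dl dl Cv c muk nuk) => //.
  - by rewrite VE; exact: (euler_normTV _ _ _ _ _ _ _ _ _ hfb vBL ha ea hmu0 (ltW hRt)).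
  - by rewrite VE; exact: (euler_normTV _ _ _ _ _ _ _ _ _ hfb vBL hb eb hnu0 (ltW hRt)).
  - move=> r hr; have [p [q [h1 h2 h3 h4]]] := euler_evolves _ _ _ _ _ _ _ hf vBL ha ea hr.
    by exists p, q; split => //; exact: le_trans ma.
  - move=> r hr; have [p [q [h1 h2 h3 h4]]] := euler_evolves _ _ _ _ _ _ _ hf vBL hb eb hr.
    by exists p, q; split => //; exact: le_trans mb.
  - by rewrite mu0E nu0E -/D0 /c -addrA lerDl addr_ge0// ltW.
  - by rewrite -/A /c lerDr addr_ge0// ltW.
apply: le_trans (distBL_triangle _ (muk t) _) _.
apply: le_trans (lerD (lexx _) (distBL_triangle _ (nuk t) _)) _.
rewrite distBLC.
have dlE : dl * (2 + (1 + 2 * A) * C) = e by rewrite /dl divfK// gt_eqF.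
apply: le_trans (lerD (da t ht) (lerD main (db t ht))) _.
rewrite -/C -dlE le_eqVlt; apply/orP; left; apply/eqP.
rewrite /c; clearbody dl D0 A C; ring.
Qed.
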